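(* Let $|\mathcal{X}|=\ell_1$, $|\mathcal{Y}|=\ell_2$, $|\mathcal{Z}|=n$ with $\ell_1\ge\ell_2$, and $\varepsilon\in(0,1]$. There exists a computationally efficient tester for $\mathcal{T}(\ell_1,\ell_2,n,\varepsilon)$ with sample complexity \[ O\!\left(\max\left(\min\left(\frac{n^{7/8}\ell_1^{1/4}\ell_2^{1/4}}{\varepsilon},\frac{n^{6/7}\ell_1^{2/7}\ell_2^{2/7}}{\varepsilon^{8/7}}\right),\ \frac{n^{3/4}\ell_1^{1/2}\ell_2^{1/2}}{\varepsilon},\ \frac{n^{2/3}\ell_1^{2/3}\ell_2^{1/3}}{\varepsilon^{4/3}},\ \frac{n^{1/2}\ell_1^{1/2}\ell_2^{1/2}}{\varepsilon^2}\right)\right). \]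
   Context: For finite sets $\mathcal{X},\mathcal{Y},\mathcal{Z}$, random variables $(X,Y,Z)$ with joint distribution $p$ on $\mathcal{X}\times\mathcal{Y}\times\mathcal{Z}$ are conditionally independent given $Z$ if for all $(i,j,z)$, $\Pr[X=i,Y=j\mid Z=z]=\Pr[X=i\mid Z=z]\Pr[Y=j\mid Z=z]$. Let $\mathcal{P}$ denote the set of such distributions. $d_{TV}(p,q)=\frac12\sum_\omega|p(\omega)-q(\omega)|$ and $d_{TV}(p,\mathcal{P})=\inf_{q\in\mathcal{P}}d_{TV}(p,q)$. The problem $\mathcal{T}(\ell_1,\ell_2,n,\varepsilon)$: given independent samples from an unknown distribution $p$ on $\mathcal{X}\times\mathcal{Y}\times\mathcal{Z}$, output accept or reject so that with probability at least $2/3$ the output is accept if $p\in\mathcal{P}$ and reject if $d_{TV}(p,\mathcal{P})\ge\varepsilon$. Sample complexity is the number of samples drawn. *)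

(* Defs.v *)
From mathcomp Require Import all_boot all_order all_algebra.
From mathcomp Require Import all_classical all_reals all_analysis.

Set Implicit Arguments.
Unset Strict Implicit.
Unset Printing Implicit Defensive.

Import Order.TTheory GRing.Theory Num.Theory.

Local Open Scope classical_set_scope.
Local Open Scope ring_scope.

(** * Distributions on finite sets and conditional independence *)

Definition is_dist (R : realType) (W : finType) (p : {ffun W -> R}) : Prop :=
  (forall w, 0 <= p w) /\ \sum_w p w = 1.

Definition Pr (R : realType) (W : finType) (p : {ffun W -> R}) (E : pred W) : R :=
  \sum_(w | E w) p w.

(* Since x / 0 = 0, this is 0 when the conditioning event has probability 0;
   such events therefore put no constraint on [cond_indep]. *)
Definition cond_Pr (R : realType) (W : finType) (p : {ffun W -> R})
    (E F : pred W) : R :=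
  Pr p (predI E F) / Pr p F.

Definition cond_indep (R : realType) (X Y Z : finType)
    (p : {ffun X * Y * Z -> R}) : Prop :=
  forall i j z,
    cond_Pr p [pred w | (w.1.1 == i) && (w.1.2 == j)] [pred w | w.2 == z] =
    cond_Pr p [pred w | w.1.1 == i] [pred w | w.2 == z] *
    cond_Pr p [pred w | w.1.2 == j] [pred w | w.2 == z].

Definition CI (R : realType) (X Y Z : finType) : set {ffun X * Y * Z -> R} :=
  [set p | is_dist p /\ cond_indep p].
Arguments CI : clear implicits.

Definition dTV (R : realType) (W : finType) (p q : {ffun W -> R}) : R :=
  2^-1 * \sum_w `|p w - q w|.

Definition dTV_set (R : realType) (W : finType) (p : {ffun W -> R})
    (S : set {ffun W -> R}) : R :=
  inf [set dTV p q | q in S].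

(** * Randomized algorithms with sample access

  The model is a structured random-access machine.  Its memory is an unbounded
  array of integers, its atomic actions are assignments (with indirect
  addressing), fair coin flips and draws of one fresh sample, and every step
  has unit cost.  Arithmetic is limited to addition and subtraction so that a
  step of a fixed program lengthens the binary representation of the numbers
  in play by O(1) bits only: unit-cost polynomial time is then the usual
  (Turing machine) polynomial time. *)

Inductive expr : Type :=
  | Cst of int
  | Cell of expr              (* the cell whose address is the argument *)
  | Add of expr & expr
  | Sub of expr & expr.

Inductive cmd : Type :=
  | Skip
  | Assign of expr & expr    (* Assign a e : cell a := e *)
  | Flip of expr             (* cell a := a fair coin, 0 or 1 *)
  | Draw of expr             (* cells a, a + 1, a + 2 := a fresh (x, y, z) *)
  | Seq of cmd & cmd
  | If of expr & cmd & cmd   (* tests whether the expression is > 0 *)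
  | While of expr & cmd.     (* same test *)

Definition memory : Type := int -> int.

Fixpoint eval (M : memory) (e : expr) : int :=
  match e with
  | Cst c => c
  | Cell a => M (eval M a)
  | Add a b => eval M a + eval M b
  | Sub a b => eval M a - eval M b
  end.

Definition upd (M : memory) (a v : int) : memory :=
  fun b => if b == a then v else M b.

(* [todo] is the stack of commands still to be executed; [samples] and [coins]
   are the parts of the two random tapes not read yet. *)
Record config : Type := Config {
  todo : seq cmd;
  mem : memory;
  samples : seq (nat * nat * nat);
  coins : seq bool }.

(* A machine reading past the end of a random tape is stuck: its stack stays
   nonempty, so it never halts. *)
Definition step (g : config) : config :=
  let: Config k M ss bs := g in
  match k with
  | [::] => g
  | Skip :: k' => Config k' M ss bs
  | Assign a e :: k' => Config k' (upd M (eval M a) (eval M e)) ss bs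
  | Flip a :: k' =>
      if bs is b :: bs' then Config k' (upd M (eval M a) (nat_of_bool b)%:Z) ss bs'
      else g
  | Draw a :: k' =>
      if ss is (x, y, z) :: ss' then
        let a0 := eval M a in
        Config k' (upd (upd (upd M a0 x%:Z) (a0 + 1) y%:Z) (a0 + 2) z%:Z) ss' bs
      else g
  | Seq c1 c2 :: k' => Config [:: c1, c2 & k'] M ss bs
  | If e c1 c2 :: k' => Config ((if 0 < eval M e then c1 else c2) :: k') M ss bs
  | While e c :: k' =>
      Config (if 0 < eval M e then [:: c, While e c & k'] else k') M ss bs
  end.

Definition init_mem (inp : seq int) : memory :=
  fun a => if a is Posz k then nth 0 inp k else 0.

(* The verdict reached within [t] steps: [None] if the machine has not halted,
   [Some true] (accept) if it halted with a positive number in cell 0, and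
   [Some false] (reject) if it halted with a nonpositive one. *)
Definition verdict (P : cmd) (inp : seq int) (t : nat)
    (ss : seq (nat * nat * nat)) (bs : seq bool) : option bool :=
  let g := iter t step (Config [:: P] (init_mem inp) ss bs) in
  if todo g is [::] then Some (0 < mem g 0) else None.

(** * Testers *)

Section Tester.
Variables (R : realType) (X Y Z : finType).

(* The machine sees the elements of the finite sets through their indices in
   0 .. #|X| - 1, and so on. *)
Definition encode (w : X * Y * Z) : nat * nat * nat :=
  (nat_of_ord (enum_rank w.1.1), nat_of_ord (enum_rank w.1.2),
   nat_of_ord (enum_rank w.2)).

(* The proximity parameter is handed to the machine as the integer
   ceil(1/eps), i.e. it knows the real number eps up to a factor 2 only. *)
Definition input (eps : R) : seq int :=
  [:: #|X|%:Z; #|Y|%:Z; #|Z|%:Z; Num.ceil eps^-1].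

(* Probability, over m independent samples from p and t independent fair coins
   (t steps cannot flip more than t coins), that the verdict after at most t
   steps is v. *)
Definition Pr_verdict (P : cmd) (eps : R) (m t : nat) (p : {ffun X * Y * Z -> R})
    (v : bool) : R :=
  \sum_(s : m.-tuple (X * Y * Z)) (\prod_(i < m) p (tnth s i)) *
    (#|[pred bs : t.-tuple bool |
        verdict P (input eps) t (map encode s) bs == Some v]|%:R / 2 ^+ t).

(* P, run on #|X|, #|Y|, #|Z| and eps, always halts within t steps having drawn
   at most m samples (whatever the samples and the coins), and is correct with
   probability at least 2/3. *)
Definition is_tester (P : cmd) (eps : R) (m t : nat) : Prop :=
  (forall (s : m.-tuple (X * Y * Z)) (bs : t.-tuple bool),
      verdict P (input eps) t (map encode s) bs <> None) /\
  (forall p : {ffun X * Y * Z -> R}, is_dist p ->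
      (CI R X Y Z p -> 2 / 3 <= Pr_verdict P eps m t p true) /\
      (eps <= dTV_set p (CI R X Y Z) -> 2 / 3 <= Pr_verdict P eps m t p false)).

End Tester.

Definition sample_bound (R : realType) (l1 l2 n : nat) (eps : R) : R :=
  let a : R := l1%:R in
  let b : R := l2%:R in
  let c : R := n%:R in
  Num.max
    (Num.min (c `^ (7 / 8) * a `^ (1 / 4) * b `^ (1 / 4) / eps)
             (c `^ (6 / 7) * a `^ (2 / 7) * b `^ (2 / 7) / eps `^ (8 / 7)))
  (Num.max (c `^ (3 / 4) * a `^ (1 / 2) * b `^ (1 / 2) / eps)
  (Num.max (c `^ (2 / 3) * a `^ (2 / 3) * b `^ (1 / 3) / eps `^ (4 / 3))
           (c `^ (1 / 2) * a `^ (1 / 2) * b `^ (1 / 2) / eps ^+ 2))).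

(* As a function of sample_bound, polynomial time means the same thing, since
   sample_bound is at least sqrt (l1 * l2 * n) / eps ^ 2 and polynomially
   bounded in l1, l2, n and 1 / eps. *)
Definition time_bound (R : realType) (K l1 l2 n : nat) (eps : R) : nat :=
  (K * (l1 * l2 * n * `|Num.ceil eps^-1|) ^ K)%N.

(* Main.v *)
(** Conditioning on z splits the problem into bins, and p is far from conditional
    independence iff, on average over the bins, p_z is far in l1 from the product
    of its marginals.  Samples come in six blocks of m.  In every bin the k-th
    sample of block 0 is paired with the k-th sample of block 1, and likewise for
    blocks 2 and 3.  A pair (x, y), (x', y') gives the matrix
    V = (d_x - d_x') (x) (d_y - d_y'), whose mean is twice the difference between
    p_z and the product of its marginals; hence the inner products of the matrices
    from blocks 0-1 with those from blocks 2-3 estimate a squared l2 distance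
    without bias, and their variance splits into sums over independent pairs.

    The inner products are weighted by the inverse empirical marginals found in
    blocks 4 and 5.  This deterministic form of flattening bounds the collision
    probability of a bin by O(1 / omega^2), where omega^2 is about
    min(N, l1) min(N, l2) for a bin with N samples, while by Cauchy-Schwarz the l2
    distance keeps at least the fraction 1 / (l1 l2) of the squared l1 distance.
    A bin with k pairs enters the sum with the factor omega / k, so that it
    contributes O(1) to the variance under independence; the total is
    O(min(n, m)), and the statistic is compared with a multiple of
    sqrt(min(n, m)).

    If p is far, bins expecting many samples receive at least half of them, and
    Cauchy-Schwarz over these bins yields the last three terms of the bound.  Bins
    expecting few samples count as soon as they are hit in each of blocks 0 to 3,
    which has probability of order alpha^4 for alpha expected samples; distinct
    bins are negatively correlated, and one gets the first term, whose two
    alternatives are the two values of min(n, m).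

    All weights are rounded to integers within a factor 2, which makes the
    decision a term of a small language of bounded sums; the code compiled from
    such a term runs in polynomial time. *)

Require Import Defs.
From mathcomp Require Import all_boot all_order all_algebra.
From mathcomp Require Import all_classical all_reals all_analysis.
From mathcomp Require Import zify ring lra.

Set Implicit Arguments.
Unset Strict Implicit.
Unset Printing Implicit Defensive.

Import Order.TTheory GRing.Theory Num.Theory.
Import Defs.

Local Open Scope ring_scope.

(** * A total language of bounded sums, compiled to the machine *)

(** The number of samples is fixed, so the bin counts are dependent. Conditioning on all
    Z-coordinates separates two sources of error: [typical_signal] concerns the Z-coordinates alone
    and fails with probability at most 1/10, while [alt_error] holds for every fixed choice of them
    that carries enough signal and fails with probability at most 2/15; together they stay below
    1/3. The obstacle in the variance is the mixed term, where one of the two matrices is replaced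
    by its mean: it is cubic in the numbers of pairs. It is bounded by the mean times a square root
    of noise plus mean because omega is at most twice the smaller number of pairs, which is why the
    numbers behind omega are capped by [kmin]. The second moments of a bin involve the joint law,
    which flattening by the marginals does not control; [energy_le] trades the uncontrolled part for
    signal. A machine that only adds and subtracts has no fractional powers: the sample size is a
    multiple of the least integer that satisfies the monomial inequalities obtained by raising the
    terms of the bound to integral powers. *)

Inductive tm : Type :=
  | Lit of int
  | Var of nat
  | Get of tm                (* a cell of the sample array *)
  | Plus of tm & tm
  | Minus of tm & tm
  | Times of tm & tm
  | IfPos of tm & tm & tm
  | LetIn of nat & tm & tm
  | Sum of nat & tm & tm.    (* Sum v b t : the sum of t over 0 <= v < b *)

Definition set_var (e : nat -> int) (v : nat) (x : int) : nat -> int :=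
  fun u => if u == v then x else e u.

Definition truncZ (k : int) : nat := if k is Posz n then n else 0%N.

Fixpoint den (arr e : nat -> int) (t : tm) : int :=
  match t with
  | Lit c => c
  | Var v => e v
  | Get a => if den arr e a is Posz k then arr k else 0
  | Plus a b => den arr e a + den arr e b
  | Minus a b => den arr e a - den arr e b
  | Times a b => den arr e a * den arr e b
  | IfPos c a b => if 0 < den arr e c then den arr e a else den arr e b
  | LetIn v a b => den arr (set_var e v (den arr e a)) b
  | Sum v b f =>
      \sum_(j < truncZ (den arr e b)) den arr (set_var e v j%:Z) f
  end.

(* The sample array occupies the nonnegative addresses; variables and the
   scratch registers of the compiler alternate on the negative ones. *)
Definition var_addr (v : nat) : int := Negz v.*2.+1.
Definition tmp_addr (r : nat) : int := Negz r.*2.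

Definition rvar v := Cell (Cst (var_addr v)).
Definition rtmp r := Cell (Cst (tmp_addr r)).
Definition wvar v e := Assign (Cst (var_addr v)) e.
Definition wtmp r e := Assign (Cst (tmp_addr r)) e.

(** The value ends in register [r], and the registers from [r] on may be overwritten; binders save
    the old value of their variable in a register and put it back. A product costs time linear in
    the absolute value of its first factor, so values must be bounded polynomially as well as
    times. *)
Fixpoint compile (t : tm) (r : nat) : cmd :=
  match t with
  | Lit c => wtmp r (Cst c)
  | Var v => wtmp r (rvar v)
  | Get a => Seq (compile a r)
      (If (Add (rtmp r) (Cst 1)) (wtmp r (Cell (rtmp r))) (wtmp r (Cst 0)))
  | Plus a b => Seq (compile a r) (Seq (compile b r.+1)
      (wtmp r (Add (rtmp r) (rtmp r.+1))))
  | Minus a b => Seq (compile a r) (Seq (compile b r.+1)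
      (wtmp r (Sub (rtmp r) (rtmp r.+1))))
  | Times a b => Seq (compile a r) (Seq (compile b r.+1) (Seq (wtmp r.+2 (Cst 0))
      (Seq (While (rtmp r) (Seq (wtmp r.+2 (Add (rtmp r.+2) (rtmp r.+1)))
                                (wtmp r (Sub (rtmp r) (Cst 1)))))
      (Seq (While (Sub (Cst 0) (rtmp r))
                  (Seq (wtmp r.+2 (Sub (rtmp r.+2) (rtmp r.+1)))
                       (wtmp r (Add (rtmp r) (Cst 1)))))
      (wtmp r (rtmp r.+2))))))
  | IfPos c a b => Seq (compile c r) (If (rtmp r) (compile a r) (compile b r))
  | LetIn v a b => Seq (compile a r) (Seq (wtmp r.+1 (rvar v))
      (Seq (wvar v (rtmp r)) (Seq (compile b r.+2)
      (Seq (wvar v (rtmp r.+1)) (wtmp r (rtmp r.+2))))))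
  | Sum v b f => Seq (compile b r) (Seq (wtmp r.+1 (rvar v)) (Seq (wvar v (Cst 0))
      (Seq (wtmp r.+2 (Cst 0))
      (Seq (While (rtmp r) (Seq (compile f r.+3)
              (Seq (wtmp r.+2 (Add (rtmp r.+2) (rtmp r.+3)))
              (Seq (wvar v (Add (rvar v) (Cst 1)))
                   (wtmp r (Sub (rtmp r) (Cst 1)))))))
      (Seq (wvar v (rtmp r.+1)) (wtmp r (rtmp r.+2)))))))
  end.

(** * Correctness and cost of the compiled code *)

(** Being uniform in the stack and in both tapes lets runs be chained in any context; code with a
    [Run] touches neither samples nor coins. *)
Definition Run (n : nat) (c : cmd) (M M' : memory) : Prop :=
  forall k ss bs, iter n step (Config (c :: k) M ss bs) = Config k M' ss bs.

Lemma Run_seq n1 n2 c1 c2 M M1 M2 :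
  Run n1 c1 M M1 -> Run n2 c2 M1 M2 -> Run (n2 + n1).+1 (Seq c1 c2) M M2.
Proof. by move=> h1 h2 k ss bs; rewrite iterSr iterD h1 h2. Qed.

Lemma Run_assign a e M : Run 1 (Assign a e) M (upd M (eval M a) (eval M e)).
Proof. by []. Qed.

Lemma Run_if n e c1 c2 M M' :
  Run n (if 0 < eval M e then c1 else c2) M M' -> Run n.+1 (If e c1 c2) M M'.
Proof. by move=> h k ss bs; rewrite iterSr h. Qed.

(** [Inv] is indexed by the number of completed rounds, and the guard has to fail exactly at round
    [N]; a round costs its body plus one test. *)
Lemma Run_while (Inv : nat -> memory -> Prop) (N T : nat) e c M :
  (forall j M, Inv j M -> (j <= N)%N -> (0 < eval M e) = (j < N)%N) ->
  (forall j M, (j < N)%N -> Inv j M ->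
     exists n M', [/\ (n <= T)%N, Run n c M M' & Inv j.+1 M']) ->
  Inv 0 M ->
  exists n M', [/\ (n <= (N * T.+1).+1)%N, Run n (While e c) M M' & Inv N M'].
Proof.
move=> guard body inv0.
suff: forall d, (d <= N)%N -> forall M, Inv (N - d)%N M -> exists n M',
    [/\ (n <= (d * T.+1).+1)%N, Run n (While e c) M M' & Inv N M'].
  by move=> /(_ N (leqnn N)); apply; rewrite subnn.
elim=> [|d IH] ledN {inv0} {}M.
  rewrite subn0 => inv; exists 1, M; split=> // k ss bs /=.
  by rewrite (guard _ _ inv) // ltnn.
move=> inv; have ltN : (N - d.+1 < N)%N by lia.
have [n1 [M1 [le1 run1 inv1]]] := body _ _ ltN inv.
have eqd : ((N - d.+1).+1 = N - d)%N by lia.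
rewrite eqd in inv1; have [n2 [M2 [le2 run2 inv2]]] := IH (ltnW ledN) _ inv1.
exists (n2 + n1).+1, M2; split=> //; first by rewrite mulSn; lia.
by move=> k ss bs; rewrite iterSr /= (guard _ _ inv) ?leq_subr // ltN /= iterD run1 run2.
Qed.

Lemma upd_same M a v : upd M a v a = v.
Proof. by rewrite /upd eqxx. Qed.

Lemma upd_diff M a v b : b != a -> upd M a v b = M b.
Proof. by rewrite /upd => /negbTE ->. Qed.

Lemma tmp_tmp r s : (tmp_addr r == tmp_addr s) = (r == s).
Proof. by rewrite /tmp_addr; apply/eqP/eqP=> [[]|->//]; lia. Qed.

Lemma var_var r s : (var_addr r == var_addr s) = (r == s).
Proof. by rewrite /var_addr; apply/eqP/eqP=> [[]|->//]; lia. Qed.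

Lemma var_tmp r s : (var_addr r == tmp_addr s) = false.
Proof. by apply/eqP=> -[]; lia. Qed.

Lemma tmp_var r s : (tmp_addr r == var_addr s) = false.
Proof. by apply/eqP=> -[]; lia. Qed.

Lemma pos_var (k : nat) s : (Posz k == var_addr s) = false. Proof. by []. Qed.
Lemma pos_tmp (k : nat) s : (Posz k == tmp_addr s) = false. Proof. by []. Qed.

Definition addrE := (tmp_tmp, var_var, var_tmp, tmp_var, pos_var, pos_tmp).

Definition holds_env (M : memory) (arr e : nat -> int) : Prop :=
  (forall v, M (var_addr v) = e v) /\ (forall k : nat, M k%:Z = arr k).

(** Variables and the sample array lie outside the exempted registers, so this frame condition also
    says that bound variables are restored. *)
Definition same_but (r : nat) (M M' : memory) : Prop :=
  forall a, (forall s, (r <= s)%N -> a != tmp_addr s) -> M' a = M a.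

Definition bounded (B : nat) (e : nat -> int) : Prop := forall v, (`|e v| <= B)%N.

(** * Bounds of the form [B ^ K], a family closed under sums, products and composition *)

Section PolyBounds.
Variables (B : nat).
Hypothesis B2 : (1 < B)%N.

Lemma polyW K K' a : (a <= B ^ K)%N -> (K <= K')%N -> (a <= B ^ K')%N.
Proof. by move=> h le; apply: leq_trans h _; rewrite leq_exp2l. Qed.

Lemma poly_const c : (c <= B ^ c)%N.
Proof. exact: ltnW (ltn_expl _ B2). Qed.

Lemma polyM a b i j : (a <= B ^ i)%N -> (b <= B ^ j)%N -> (a * b <= B ^ (i + j))%N.
Proof. by move=> h1 h2; rewrite expnD leq_mul. Qed.

Lemma polyD a b i j : (a <= B ^ i)%N -> (b <= B ^ j)%N -> (a + b <= B ^ (i + j).+1)%N.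
Proof.
move=> h1 h2; rewrite expnS; apply: (@leq_trans (2 * B ^ (i + j))); last exact: leq_mul.
rewrite mul2n -addnn leq_add //.
  by apply: polyW h1 _; lia.
by apply: polyW h2 _; lia.
Qed.

Lemma bounded_set_var K e v x : (0 < K)%N -> bounded B e ->
  (`|x| <= B ^ K)%N -> bounded (B ^ K) (set_var e v x).
Proof.
move=> K0 be bx u; rewrite /set_var; case: eqP => // _.
by apply: leq_trans (be u) _; rewrite -{1}(expn1 B) leq_exp2l.
Qed.

Lemma boundedW K e : (0 < K)%N -> bounded B e -> bounded (B ^ K) e.
Proof.
move=> K0 be u; apply: leq_trans (be u) _; rewrite -{1}(expn1 B) leq_exp2l //.
Qed.

Lemma ltn1_exp K : (0 < K)%N -> (1 < B ^ K)%N.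
Proof. by move=> K0; apply: leq_trans B2 _; rewrite -{1}(expn1 B) leq_exp2l. Qed.
End PolyBounds.

Lemma truncZ_le x : (truncZ x <= `|x|)%N. Proof. by case: x. Qed.

(** [K] depends on the term only, while the base is arbitrary. This handles binders: their body is
    evaluated in an environment bounded by a power of [B], and the induction hypothesis is applied
    with that power as its base. *)
Lemma den_bound t : exists K, forall B arr e, (1 < B)%N -> bounded B arr ->
  bounded B e -> (`|den arr e t| <= B ^ K)%N.
Proof.
elim: t => [c|v|a [Ka ha]|a [Ka ha] b [Kb hb]|a [Ka ha] b [Kb hb]|a [Ka ha] b [Kb hb]
  |c [Kc hc] a [Ka ha] b [Kb hb]|v a [Ka ha] b [Kb hb]|v b [Kb hb] f [Kf hf]].
- by exists `|c|%N => B arr e B2 _ _ /=; apply: poly_const.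
- by exists 1%N => B arr e B2 _ be /=; rewrite expn1.
- exists 1%N => B arr e B2 barr be /=; rewrite expn1.
  by case: (den _ _ _) => // k.
- exists (Ka + Kb).+1 => B arr e B2 barr be /=.
  have := polyD B2 (ha _ _ _ B2 barr be) (hb _ _ _ B2 barr be).
  by apply: leq_trans; lia.
- exists (Ka + Kb).+1 => B arr e B2 barr be /=.
  have := polyD B2 (ha _ _ _ B2 barr be) (hb _ _ _ B2 barr be).
  by apply: leq_trans; lia.
- exists (Ka + Kb)%N => B arr e B2 barr be /=.
  by rewrite abszM; exact: polyM (ha _ _ _ B2 barr be) (hb _ _ _ B2 barr be).
- exists (Ka + Kb)%N => B arr e B2 barr be /=; case: ifP => _.
    by apply: (polyW B2 (ha _ _ _ B2 barr be)); lia.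
  by apply: (polyW B2 (hb _ _ _ B2 barr be)); lia.
- exists (Ka.+1 * Kb)%N => B arr e B2 barr be /=; rewrite expnM.
  apply: hb; [exact: ltn1_exp|exact: boundedW|].
  apply: bounded_set_var => //; apply: (polyW B2 (ha _ _ _ B2 barr be)); lia.
- exists (Kb + Kb.+1 * Kf)%N => B arr e B2 barr be /=.
  have hN : (truncZ (den arr e b) <= B ^ Kb)%N.
    exact: leq_trans (truncZ_le _) (hb _ _ _ B2 barr be).
  apply: (@leq_trans (\sum_(j < truncZ (den arr e b)) B ^ (Kb.+1 * Kf))).
    elim/big_ind2: _ => // [x1 x2 y1 y2|j _]; first by lia.
    rewrite expnM; apply: hf; [exact: ltn1_exp|exact: boundedW|].
    apply: bounded_set_var => //; apply: (@polyW _ B2 Kb) => //=.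
    by apply: leq_trans (ltnW (ltn_ord j)) hN.
  by rewrite sum_nat_const card_ord expnD leq_mul2r hN orbT.
Qed.

Lemma same_but_trans r r' M M' M'' :
  (r <= r')%N -> same_but r M M' -> same_but r' M' M'' -> same_but r M M''.
Proof.
move=> le h1 h2 a ha; rewrite h2 ?h1 // => s les; apply: ha; exact: leq_trans les.
Qed.

Lemma same_but_tmp r s M M' : same_but r M M' -> (s < r)%N -> M' (tmp_addr s) = M (tmp_addr s).
Proof. by move=> h lt; apply: h => u; rewrite addrE; lia. Qed.

Lemma same_but_var r v M M' : same_but r M M' -> M' (var_addr v) = M (var_addr v).
Proof. by move=> h; apply: h => u _; rewrite addrE. Qed.

Lemma same_but_pos r (k : nat) M M' : same_but r M M' -> M' k%:Z = M k%:Z.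
Proof. by move=> h; apply: h => u _; rewrite addrE. Qed.

Lemma same_but_upd r s M M' v : same_but r M M' -> (r <= s)%N ->
  same_but r M (upd M' (tmp_addr s) v).
Proof. by move=> h le a ha; rewrite upd_diff ?h // ha. Qed.

Lemma same_but_env r M M' arr e :
  same_but r M M' -> holds_env M arr e -> holds_env M' arr e.
Proof.
by move=> h [h1 h2]; split=> [v|k]; rewrite ?(same_but_var _ h) ?(same_but_pos _ h).
Qed.

Lemma holds_env_upd_tmp r v M arr e :
  holds_env M arr e -> holds_env (upd M (tmp_addr r) v) arr e.
Proof. by apply: same_but_env; apply: (@same_but_upd r). Qed.

Lemma holds_env_upd_var v x M arr e :
  holds_env M arr e -> holds_env (upd M (var_addr v) x) arr (set_var e v x).
Proof.
move=> [h1 h2]; split=> [u|k]; rewrite /upd ?addrE //.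
by rewrite /set_var; case: eqP.
Qed.

Ltac read_mem :=
  repeat first [ rewrite upd_same
               | rewrite upd_diff; [ | by rewrite addrE //; lia ] ].

Lemma Run_times r M : exists n M',
  [/\ (n <= 10 * `|M (tmp_addr r)| + 10)%N,
      Run n (Seq (wtmp r.+2 (Cst 0))
      (Seq (While (rtmp r) (Seq (wtmp r.+2 (Add (rtmp r.+2) (rtmp r.+1)))
                                (wtmp r (Sub (rtmp r) (Cst 1)))))
      (Seq (While (Sub (Cst 0) (rtmp r))
                  (Seq (wtmp r.+2 (Sub (rtmp r.+2) (rtmp r.+1)))
                       (wtmp r (Add (rtmp r) (Cst 1)))))
      (wtmp r (rtmp r.+2))))) M M',
      M' (tmp_addr r) = M (tmp_addr r) * M (tmp_addr r.+1) & same_but r M M'].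
Proof.
set x := M (tmp_addr r); set y := M (tmp_addr r.+1).
pose M0 := upd M (tmp_addr r.+2) 0.
pose Inv1 (j : nat) (M1 : memory) := [/\ M1 (tmp_addr r) = x - j%:Z,
   M1 (tmp_addr r.+1) = y, M1 (tmp_addr r.+2) = j%:Z * y & same_but r M M1].
have [|||n1 [M1 [le1 run1 [h1 h2 h3 h4]]]] := @Run_while Inv1 (truncZ x) 3 (rtmp r)
    (Seq (wtmp r.+2 (Add (rtmp r.+2) (rtmp r.+1))) (wtmp r (Sub (rtmp r) (Cst 1)))) M0.
- move=> j M1 [h1 _ _ _] le /=; rewrite h1; clearbody x; clear -le.
  by case: x le => // k /=; lia.
- move=> j M1 lt [h1 h2 h3 h4].
  exists (1 + 1).+1%N; eexists; split=> //.
  rewrite /=; split; read_mem; rewrite ?h1 ?h2 ?h3 //; try by lia.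
  by do 2?[apply: same_but_upd]; rewrite ?leqnn //; lia.
- rewrite /M0; split; read_mem; rewrite ?mul0r ?subr0 //.
  by apply: same_but_upd => //; lia.
(* The first loop leaves min(x, 0) in the counter, so at most one of the two loops does any work. *)
pose Inv2 (j : nat) (M2 : memory) := [/\ M2 (tmp_addr r) = x - (truncZ x)%:Z + j%:Z,
   M2 (tmp_addr r.+1) = y, M2 (tmp_addr r.+2) = (truncZ x)%:Z * y - j%:Z * y
   & same_but r M M2].
have [|||n2 [M2 [le2 run2 [h5 h6 h7 h8]]]] := @Run_while Inv2 (truncZ (- x)) 3
    (Sub (Cst 0) (rtmp r))
    (Seq (wtmp r.+2 (Sub (rtmp r.+2) (rtmp r.+1))) (wtmp r (Add (rtmp r) (Cst 1)))) M1.
- move=> j M2 [h5 _ _ _] le /=; rewrite h5; clearbody x; clear -le.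
  by case: x le => [[|k]|k] //=; lia.
- move=> j M2 lt [h5 h6 h7 h8].
  exists (1 + 1).+1%N; eexists; split=> //.
  rewrite /=; split; read_mem; rewrite ?h5 ?h6 ?h7 //; try by lia.
  by do 2?[apply: same_but_upd]; rewrite ?leqnn //; lia.
- by split; rewrite ?h1 ?h2 ?h3 ?mul0r ?addr0 ?subr0.
exists (((1 + n2).+1 + n1).+1 + 1).+1%N, (upd M2 (tmp_addr r) (M2 (tmp_addr r.+2))); split.
- have : (truncZ x + truncZ (- x) <= `|x|)%N.
    by clearbody x; clear; case: x => [[|k]|k] //=; lia.
  by rewrite -/x; lia.
- apply: (Run_seq (M1 := M0)); first exact: Run_assign.
  apply: Run_seq; first exact: run1.
  by apply: Run_seq run2 _; exact: Run_assign.
- read_mem; rewrite h7 -mulrBl; congr (_ * _).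
  by clearbody x; clear; case: x => [[|k]|k] //=; lia.
- exact: same_but_upd.
Qed.

Definition compiles_within (K : nat) (t : tm) : Prop :=
  forall B arr e M r, (1 < B)%N -> bounded B arr -> bounded B e ->
  holds_env M arr e -> exists n M', [/\ (n <= B ^ K)%N, Run n (compile t r) M M',
    M' (tmp_addr r) = den arr e t & same_but r M M'].

(** The cost allowed for [op] is linear in the value of the first operand, as repeated addition
    demands; this is where the value bound of [a] enters the time bound. *)
Lemma compiles_binop op (f : int -> int -> int) K Ka Kb a b :
  (forall r M, exists n M', [/\ (n <= 20 * `|M (tmp_addr r)| + 20)%N,
      Run n (op r) M M',
      M' (tmp_addr r) = f (M (tmp_addr r)) (M (tmp_addr r.+1)) & same_but r M M']) ->
  (forall B arr e, (1 < B)%N -> bounded B arr -> bounded B e -> (`|den arr e a| <= B ^ K)%N) ->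
  compiles_within Ka a -> compiles_within Kb b ->
  exists K', forall B arr e M r, (1 < B)%N -> bounded B arr -> bounded B e ->
  holds_env M arr e -> exists n M', [/\ (n <= B ^ K')%N,
     Run n (Seq (compile a r) (Seq (compile b r.+1) (op r))) M M',
    M' (tmp_addr r) = f (den arr e a) (den arr e b) & same_but r M M'].
Proof.
move=> hop hK ha hb; exists ((Ka + (Kb + (20 + K + 20).+1).+1).+1 + 2).+1%N.
move=> B arr e M r B2 barr be hM.
have [n1 [M1 [le1 run1 v1 s1]]] := ha B arr e M r B2 barr be hM.
have hM1 := same_but_env s1 hM.
have [n2 [M2 [le2 run2 v2 s2]]] := hb B arr e M1 r.+1 B2 barr be hM1.
have [n3 [M3 [le3 run3 v3 s3]]] := hop r M2.
have e2 : M2 (tmp_addr r) = den arr e a by rewrite (same_but_tmp s2).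
exists ((n3 + n2).+1 + n1).+1%N, M3; split.
- have bn3 : (n3 <= B ^ (20 + K + 20).+1)%N.
    apply: leq_trans le3 _; apply: polyD => //; last exact: poly_const.
    by apply: polyM => //; [exact: poly_const|rewrite e2; exact: hK].
  have -> : (((n3 + n2).+1 + n1).+1 = n1 + (n2 + n3) + 2)%N by lia.
  by apply: polyD => //; [apply: polyD => //; apply: polyD|exact: poly_const].
- by apply: Run_seq run1 _; apply: Run_seq run2 run3.
- by rewrite v3 e2 v2.
- apply: same_but_trans s3 => //; apply: same_but_trans s1 s2; lia.
Qed.

Lemma compile_ok t : exists K, compiles_within K t.
Proof.
elim: t => [c|v|a [Ka ha]|a [Ka ha] b [Kb hb]|a [Ka ha] b [Kb hb]|a [Ka ha] b [Kb hb]
  |c [Kc hc] a [Ka ha] b [Kb hb]|v a [Ka ha] b [Kb hb]|v b [Kb hb] f [Kf hf]].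
- exists 1%N => B arr e M r B2 barr be hM; exists 1%N; eexists; split.
  + by rewrite expn1 ltnW.
  + exact: Run_assign.
  + by rewrite /=; read_mem.
  + by apply: same_but_upd.
- exists 1%N => B arr e M r B2 barr be hM; exists 1%N; eexists; split.
  + by rewrite expn1 ltnW.
  + exact: Run_assign.
  + by rewrite /=; read_mem; case: hM.
  + by apply: same_but_upd.
- exists (Ka + 4).+1%N => B arr e M r B2 barr be hM.
  have [n1 [M1 [le1 run1 v1 s1]]] := ha B arr e M r B2 barr be hM.
  have hM1 := same_but_env s1 hM.
  pose w := if den arr e a is Posz k then arr k else 0.
  have run2 : Run 2 (If (Add (rtmp r) (Cst 1)) (wtmp r (Cell (rtmp r))) (wtmp r (Cst 0)))
    M1 (upd M1 (tmp_addr r) w).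
    apply: Run_if; rewrite /= v1 /w; case: (den arr e a) v1 => k v1.
      by rewrite ifT; [rewrite -(hM1.2 k) -v1; exact: Run_assign|lia].
    by rewrite ifF; [exact: Run_assign|lia].
  exists (2 + n1).+1%N, (upd M1 (tmp_addr r) w); split.
  + have -> : ((2 + n1).+1 = n1 + 3)%N by lia.
    apply: polyD => //; apply: (@leq_trans 4) => //; exact: poly_const.
  + exact: Run_seq run1 run2.
  + by read_mem.
  + exact: same_but_upd.
- have [K hK] := den_bound a.
  apply: (@compiles_binop (fun r => wtmp r (Add (rtmp r) (rtmp r.+1)))
     (fun x y => x + y) K Ka Kb) => // r M.
  exists 1%N; eexists; split; [by lia|exact: Run_assign|by rewrite /=; read_mem|].
  by apply: same_but_upd.
- have [K hK] := den_bound a.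
  apply: (@compiles_binop (fun r => wtmp r (Sub (rtmp r) (rtmp r.+1)))
     (fun x y => x - y) K Ka Kb) => // r M.
  exists 1%N; eexists; split; [by lia|exact: Run_assign|by rewrite /=; read_mem|].
  by apply: same_but_upd.
- have [K hK] := den_bound a.
  apply: (compiles_binop (f := fun x y => x * y) (K := K) (Ka := Ka) (Kb := Kb) _ hK ha hb) => r M.
  have [n [M' [le run v s]]] := Run_times r M.
  exists n, M'; split; [by lia|exact: run|exact: v|exact: s].
- exists (Kc + (Ka + Kb + 2).+1).+1%N => B arr e M r B2 barr be hM.
  have [n1 [M1 [le1 run1 v1 s1]]] := hc B arr e M r B2 barr be hM.
  have hM1 := same_but_env s1 hM.
  have [na [Ma [lea runa va sa]]] := ha B arr e M1 r B2 barr be hM1.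
  have [nb [Mb [leb runb vb sb]]] := hb B arr e M1 r B2 barr be hM1.
  case: (ltP 0 (den arr e c)) => hpos.
    exists (na.+1 + n1).+1%N, Ma; split.
    + have -> : ((na.+1 + n1).+1 = n1 + (na + 2))%N by lia.
      apply: polyD => //; apply: polyD => //; last exact: poly_const.
      by apply: (polyW B2 lea); lia.
    + by apply: Run_seq run1 _; apply: Run_if; rewrite /= v1 hpos.
    + by rewrite va /= hpos.
    + exact: same_but_trans s1 sa.
  exists (nb.+1 + n1).+1%N, Mb; split.
  + have -> : ((nb.+1 + n1).+1 = n1 + (nb + 2))%N by lia.
    apply: polyD => //; apply: polyD => //; last exact: poly_const.
    by apply: (polyW B2 leb); lia.
  + by apply: Run_seq run1 _; apply: Run_if; rewrite /= v1 ltNge hpos.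
  + by rewrite vb /= ltNge hpos.
  + exact: same_but_trans s1 sb.
- have [K hK] := den_bound a.
  exists (Ka + (K.+1 * Kb + 10).+1).+1%N => B arr e M r B2 barr be hM.
  have [n1 [M1 [le1 run1 v1 s1]]] := ha B arr e M r B2 barr be hM.
  have hM1 := same_but_env s1 hM.
  pose M2 := upd (upd M1 (tmp_addr r.+1) (e v)) (var_addr v) (den arr e a).
  have hM2 : holds_env M2 arr (set_var e v (den arr e a)).
    by apply: holds_env_upd_var; apply: holds_env_upd_tmp.
  have [n2 [M3 [le2 run2 v2 s2]]] := hb (B ^ K.+1)%N arr _ M2 r.+2 (ltn1_exp B2 (ltn0Sn K))
    (boundedW B2 (ltn0Sn K) barr)
    (bounded_set_var B2 v (ltn0Sn K) be (polyW B2 (hK _ _ _ B2 barr be) (leqnSn K))) hM2.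
  have r1 : M3 (tmp_addr r.+1) = e v.
    by rewrite (same_but_tmp s2) // /M2; read_mem.
  pose M5 := upd (upd M3 (var_addr v) (e v)) (tmp_addr r) (den arr e (LetIn v a b)).
  exists ((((((1 + 1).+1 + n2).+1 + 1).+1) + 1).+1 + n1).+1%N, M5; split.
  + rewrite -expnM in le2.
    have -> : (((((((1 + 1).+1 + n2).+1 + 1).+1) + 1).+1 + n1).+1 = n1 + (n2 + 9))%N by lia.
    apply: polyD => //; apply: polyD => //; apply: (@leq_trans 10) => //; exact: poly_const.
  + apply: Run_seq run1 _; apply: (Run_seq (M1 := upd M1 (tmp_addr r.+1) (e v))).
      by rewrite -(proj1 hM1 v); exact: Run_assign.
    apply: (Run_seq (M1 := M2)).
      have := Run_assign (Cst (var_addr v)) (rtmp r) (upd M1 (tmp_addr r.+1) (e v)).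
      by rewrite /=; read_mem; rewrite v1.
    apply: Run_seq run2 _; apply: (Run_seq (M1 := upd M3 (var_addr v) (e v))).
      by rewrite -r1; exact: Run_assign.
    have := Run_assign (Cst (tmp_addr r)) (rtmp r.+2) (upd M3 (var_addr v) (e v)).
    by rewrite /=; read_mem; rewrite v2.
  + by rewrite /M5; read_mem.
  + move=> u hu; have ur : u != tmp_addr r by apply: hu.
    rewrite /M5 upd_diff // {1}/upd; case: eqP => [->|/eqP nu].
      by rewrite (proj1 hM).
    rewrite s2 => [|s les]; last by apply: hu; lia.
    by rewrite /M2; do 2![rewrite upd_diff; [|by [|apply: hu; lia]]]; exact: s1.
- have [K hK] := den_bound b; have [Kd hKd] := den_bound f.
  exists (Kb + ((K + (K.+1 * Kf + 10).+1).+1 + 11).+1).+1%N => B arr e M r B2 barr be hM.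
  have [n1 [M1 [le1 run1 v1 s1]]] := hb B arr e M r B2 barr be hM.
  have hM1 := same_but_env s1 hM.
  set N := truncZ (den arr e b).
  have leN : (N <= B ^ K)%N by apply: leq_trans (truncZ_le _) (hK _ _ _ B2 barr be).
  pose M2 := upd (upd (upd M1 (tmp_addr r.+1) (e v)) (var_addr v) 0) (tmp_addr r.+2) 0.
  pose S j : int := \sum_(i < j) den arr (set_var e v i%:Z) f.
  (* Register [r] counts down to stop the loop while the variable [v] counts up to feed the body.
     The last clause exempts [v], whose old value is restored after the loop. *)
  pose Inv j (M' : memory) := [/\ M' (tmp_addr r) = den arr e b - j%:Z,
     M' (tmp_addr r.+1) = e v, M' (tmp_addr r.+2) = S j,
     holds_env M' arr (set_var e v j%:Z) &
     forall u, (forall s, (r <= s)%N -> u != tmp_addr s) -> u != var_addr v -> M' u = M u].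
  have [|||n2 [M3 [le2 run2 [h1 h2 h3 h4 h5]]]] := @Run_while Inv N (B ^ (K.+1 * Kf) + 6) (rtmp r)
    (Seq (compile f r.+3)
              (Seq (wtmp r.+2 (Add (rtmp r.+2) (rtmp r.+3)))
              (Seq (wvar v (Add (rvar v) (Cst 1)))
                   (wtmp r (Sub (rtmp r) (Cst 1)))))) M2.
  + move=> j M' [h1 _ _ _ _] /=; rewrite h1 /N; case: (den arr e b) => // k /=; lia.
  + move=> j M' ltj [h1 h2 h3 h4 h5].
    have bset : bounded (B ^ K.+1) (set_var e v j%:Z).
      apply: bounded_set_var => //=; apply: leq_trans (ltnW ltj) _.
      apply: (polyW B2 leN (leqnSn K)).
    have [n [M4 [le run v4 s4]]] := hf (B ^ K.+1)%N arr _ M' r.+3 (ltn1_exp B2 (ltn0Sn K))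
      (boundedW B2 (ltn0Sn K) barr) bset h4.
    pose M5 := upd M4 (tmp_addr r.+2) (S j + den arr (set_var e v j%:Z) f).
    pose M6 := upd M5 (var_addr v) j.+1%:Z.
    pose M7 := upd M6 (tmp_addr r) (den arr e b - j.+1%:Z).
    exists (((1 + 1).+1 + 1).+1 + n).+1%N, M7; split.
    * by rewrite -expnM in le; lia.
    * apply: Run_seq run _; apply: (Run_seq (M1 := M5)).
        have := Run_assign (Cst (tmp_addr r.+2)) (Add (rtmp r.+2) (rtmp r.+3)) M4.
        by rewrite /= v4 (same_but_tmp s4) // h3.
      apply: (Run_seq (M1 := M6)).
        have := Run_assign (Cst (var_addr v)) (Add (rvar v) (Cst 1)) M5.
        rewrite /= /M5; read_mem; rewrite (same_but_var _ s4).
        have -> : M' (var_addr v) = j%:Z by rewrite (proj1 h4) /set_var eqxx.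
        by have -> : j%:Z + 1 = j.+1%:Z by lia.
      have := Run_assign (Cst (tmp_addr r)) (Sub (rtmp r) (Cst 1)) M6.
      rewrite /= /M6 /M5; read_mem; rewrite (same_but_tmp s4 (_ : (r < r.+3)%N)) ?h1; last by lia.
      by have -> : den arr e b - j%:Z - 1 = den arr e b - j.+1%:Z by lia.
    * split; rewrite /M7 /M6 /M5; read_mem => //.
      -- by rewrite (same_but_tmp s4).
      -- by rewrite /S big_ord_recr.
      -- apply: holds_env_upd_tmp.
         have -> : set_var e v j.+1%:Z = set_var (set_var e v j%:Z) v j.+1%:Z.
           by apply: funext => u; rewrite /set_var; case: eqP.
         apply: holds_env_upd_var; apply: holds_env_upd_tmp; exact: same_but_env s4 h4.
      -- move=> u hu nu; do 3![rewrite upd_diff; [|by [|apply: hu; lia]]].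
         by rewrite s4 ?h5 // => s les; apply: hu; lia.
  + split; rewrite /M2; read_mem.
    * by rewrite v1 subr0.
    * by [].
    * by rewrite /S big_ord0.
    * apply: holds_env_upd_tmp; apply: holds_env_upd_var; exact: holds_env_upd_tmp.
    * by move=> u hu nu; do 3![rewrite upd_diff; [|by [|apply: hu; lia]]]; exact: s1.
  pose M5 := upd (upd M3 (var_addr v) (e v)) (tmp_addr r) (S N).
  exists ((((((1 + 1).+1 + n2).+1 + 1).+1 + 1).+1 + 1).+1 + n1).+1%N, M5; split.
  + have -> : ((((((((1 + 1).+1 + n2).+1 + 1).+1) + 1).+1 + 1).+1 + n1).+1
        = n1 + (n2 + 11))%N by lia.
    have b2 : (n2 <= B ^ (K + (K.+1 * Kf + 10).+1).+1)%N.
      apply: leq_trans le2 _; rewrite -addn1 expnS.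
      have : (N * (B ^ (K.+1 * Kf) + 6).+1 <= B ^ (K + (K.+1 * Kf + 10).+1))%N.
        apply: polyM => //; rewrite -addnS; apply: polyD => //.
        by apply: leq_trans (poly_const B2 10).
      have : (0 < B ^ (K + (K.+1 * Kf + 10).+1))%N by rewrite expn_gt0 ltnW.
      by move: (B ^ _)%N (N * _)%N => p q; nia.
    by apply: polyD => //; apply: polyD => //; exact: poly_const.
  + apply: Run_seq run1 _; apply: (Run_seq (M1 := upd M1 (tmp_addr r.+1) (e v))).
      by rewrite -(proj1 hM1 v); exact: Run_assign.
    apply: (Run_seq (M1 := upd (upd M1 (tmp_addr r.+1) (e v)) (var_addr v) 0)).
      exact: Run_assign.
    apply: (Run_seq (M1 := M2)); first exact: Run_assign.
    apply: Run_seq run2 _; apply: (Run_seq (M1 := upd M3 (var_addr v) (e v))).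
      by rewrite -h2; exact: Run_assign.
    have := Run_assign (Cst (tmp_addr r)) (rtmp r.+2) (upd M3 (var_addr v) (e v)).
    by rewrite /=; read_mem; rewrite h3.
  + by rewrite /M5; read_mem.
  + move=> u hu; have ur : u != tmp_addr r by apply: hu.
    rewrite /M5 upd_diff // {1}/upd; case: eqP => [->|/eqP nu].
      by rewrite (proj1 hM).
    exact: h5.
Qed.

(** * Expectations under finite product measures *)

Section Expectation.
Variables (R : realType) (I W : finType) (mu : I -> W -> R).

(** A probability is written as the mean of a boolean cast to [R]. Coordinates may have different
    laws, as samples in different bins do. *)
Definition Ex (f : {ffun I -> W} -> R) : R :=
  \sum_(w : {ffun I -> W}) (\prod_i mu i (w i)) * f w.

Lemma eq_Ex f g : f =1 g -> Ex f = Ex g.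
Proof. by move=> fg; apply: eq_bigr => w _; rewrite fg. Qed.

Lemma ExD f g : Ex (fun w => f w + g w) = Ex f + Ex g.
Proof. by rewrite /Ex -big_split; apply: eq_bigr => w _; rewrite mulrDr. Qed.

Lemma ExZ c f : Ex (fun w => c * f w) = c * Ex f.
Proof. by rewrite /Ex mulr_sumr; apply: eq_bigr => w _; rewrite mulrCA. Qed.

Lemma ExZr c f : Ex (fun w => f w * c) = Ex f * c.
Proof. by rewrite mulrC -ExZ; apply: eq_Ex => w; rewrite mulrC. Qed.

Lemma ExN f : Ex (fun w => - f w) = - Ex f.
Proof. by rewrite -mulN1r -ExZ; apply: eq_Ex => w; rewrite mulN1r. Qed.

Lemma ExB f g : Ex (fun w => f w - g w) = Ex f - Ex g.
Proof. by rewrite ExD ExN. Qed.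

Lemma Ex_sum (J : finType) (P : pred J) (f : J -> {ffun I -> W} -> R) :
  Ex (fun w => \sum_(j | P j) f j w) = \sum_(j | P j) Ex (f j).
Proof. by rewrite /Ex exchange_big; apply: eq_bigr => w _; rewrite mulr_sumr. Qed.

Lemma Ex_prod (h : I -> W -> R) :
  Ex (fun w => \prod_i h i (w i)) = \prod_i \sum_v mu i v * h i v.
Proof.
by rewrite bigA_distr_bigA; apply: eq_bigr => w _; rewrite big_split.
Qed.

Hypothesis mu_ge0 : forall i v, 0 <= mu i v.
Hypothesis mu_sum1 : forall i, \sum_v mu i v = 1.

Lemma Ex_cst c : Ex (fun _ => c) = c.
Proof.
rewrite -[RHS]mulr1 -[in LHS](mulr1 c) ExZ; congr (_ * _).
have := Ex_prod (fun _ _ => 1); rewrite (eq_Ex (g := fun=> 1)) => [->|w].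
  by rewrite big1 // => i _; under eq_bigr do rewrite mulr1.
by rewrite big1.
Qed.

Lemma Ex_ge0 f : (forall w, 0 <= f w) -> 0 <= Ex f.
Proof. by move=> h; apply: sumr_ge0 => w _; rewrite mulr_ge0 // prodr_ge0. Qed.

Lemma le_Ex f g : (forall w, f w <= g w) -> Ex f <= Ex g.
Proof. by move=> h; rewrite -subr_ge0 -ExB; apply: Ex_ge0 => w; rewrite subr_ge0. Qed.

Lemma Ex_le_cst f c : (forall w, f w <= c) -> Ex f <= c.
Proof. by move=> h; rewrite -[leRHS]Ex_cst; apply: le_Ex. Qed.

Lemma Ex_fst (S : pred I) (h : I -> W -> R) :
  Ex (fun w => \prod_(i | S i) h i (w i)) = \prod_(i | S i) \sum_v mu i v * h i v.
Proof.
transitivity (Ex (fun w => \prod_i (if S i then h i (w i) else 1))).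
  by apply: eq_Ex => w; rewrite big_mkcond.
rewrite (Ex_prod (fun i v => if S i then h i v else 1)) [RHS]big_mkcond.
apply: eq_bigr => i _; case: ifP => // _.
by under eq_bigr do rewrite mulr1.
Qed.

Lemma Ex_coord i (h : W -> R) : Ex (fun w => h (w i)) = \sum_v mu i v * h v.
Proof.
by have := Ex_fst (pred1 i) (fun _ => h); rewrite big_pred1_eq => <-;
   apply: eq_Ex => w; rewrite big_pred1_eq.
Qed.

Definition depends_on (A : Type) (S : pred I) (f : {ffun I -> W} -> A) : Prop :=
  forall w w' : {ffun I -> W}, (forall i, S i -> w i = w' i) -> f w = f w'.

Definition glue (S : pred I) (w w' : {ffun I -> W}) : {ffun I -> W} :=
  [ffun i => if S i then w i else w' i].

(* Exchanging the coordinates outside [S] of two independent copies is an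
   involution that preserves their joint law. *)
Lemma Ex_glue S h : Ex (fun w => Ex (fun w' => h (glue S w w'))) = Ex h.
Proof.
rewrite -[RHS](Ex_cst (Ex h)) [RHS]/Ex; under [RHS]eq_bigr do rewrite mulr_sumr.
under [LHS]eq_bigr do rewrite mulr_sumr.
rewrite (pair_bigA _ (fun w w' => _ * (_ * h (glue S w w')))) [RHS]pair_bigA /=.
pose sw (u : {ffun I -> W} * {ffun I -> W}) := (glue S u.2 u.1, glue S u.1 u.2).
have swK : involutive sw.
  by move=> [w w0]; rewrite /sw /=; congr pair; apply/ffunP => i; rewrite !ffunE; case: ifP => hi; rewrite ?ffunE ?hi.
rewrite [RHS](reindex_inj (inv_inj swK)) /=; apply: eq_bigr => -[w w'] _ /=.
rewrite !mulrA -!big_split /=.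
congr (_ * _); apply: eq_bigr => i _; rewrite !ffunE.
by case: ifP => // _; rewrite mulrC.
Qed.

Lemma indep S f g : depends_on S f -> depends_on (predC S) g ->
  Ex (fun w => f w * g w) = Ex f * Ex g.
Proof.
move=> hf hg; rewrite -(Ex_glue S).
transitivity (Ex (fun w => f w * Ex g)); last exact: ExZr.
apply: eq_Ex => w; rewrite -ExZ; apply: eq_Ex => w'; congr (_ * _).
  by apply: hf => i Si; rewrite ffunE Si.
by apply: hg => i; rewrite inE ffunE => /negbTE ->.
Qed.

Lemma depends_onW (A : Type) (S S' : pred I) (f : {ffun I -> W} -> A) :
  (forall i, S i -> S' i) -> depends_on S f -> depends_on S' f.
Proof. by move=> le h w w' hw; apply: h => i /le; exact: hw. Qed.

Lemma indep_disjoint S S' f g : depends_on S f -> depends_on S' g ->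
  (forall i, S i -> ~~ S' i) -> Ex (fun w => f w * g w) = Ex f * Ex g.
Proof.
move=> hf hg dis; apply: (indep hf); apply: depends_onW hg => i.
by rewrite inE; apply: contraL => /dis.
Qed.

Lemma Ex_coord2 i j (h : W -> W -> R) : i != j ->
  Ex (fun w => h (w i) (w j)) = \sum_v \sum_v' mu i v * mu j v' * h v v'.
Proof.
move=> ij.
transitivity (Ex (fun w => \sum_v \sum_v' ((w i == v)%:R * ((w j == v')%:R * h v v')))).
  apply: eq_Ex => w; rewrite (bigD1 (w i)) //= (bigD1 (w j)) //= !eqxx !mul1r.
  rewrite big1 => [|v' nv']; last by rewrite eq_sym (negbTE nv') !mul0r mulr0.
  rewrite big1 ?addr0 // => v nv; rewrite big1 // => v' _.
  by rewrite eq_sym (negbTE nv) mul0r.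
rewrite Ex_sum; apply: eq_bigr => v _; rewrite Ex_sum; apply: eq_bigr => v' _.
have H k u : Ex (fun w => (w k == u)%:R) = mu k u.
  rewrite (Ex_coord k (fun x => (x == u)%:R)) (bigD1 u) //= eqxx mulr1 big1 ?addr0 //.
  by move=> x /negbTE ->; rewrite mulr0.
rewrite (@indep_disjoint (pred1 i) (pred1 j)) ?ExZr ?H ?mulrA //.
- by move=> w w' hw; rewrite hw //= eqxx.
- by move=> w w' hw; rewrite hw //= eqxx.
- by move=> k /= /eqP ->.
Qed.

Lemma Ex_markov (f : {ffun I -> W} -> R) (c : R) : 0 < c -> (forall w, 0 <= f w) -> 
  Ex (fun w => (c <= f w)%R%:R) <= Ex f / c.
Proof.
move=> c0 f0; rewrite mulrC -ExZ; apply: le_Ex => w.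
rewrite mulrC ler_pdivlMr //; case: (boolP (c <= f w)) => h; rewrite ?mul1r ?mul0r //.
Qed.

Lemma variance_indep_sum (J : finType) (P : pred J) (S : J -> pred I)
    (f : J -> {ffun I -> W} -> R) :
  (forall j, P j -> depends_on (S j) (f j)) ->
  (forall j k i, P j -> P k -> j != k -> S j i -> ~~ S k i) ->
  Ex (fun w => (\sum_(j | P j) f j w - \sum_(j | P j) Ex (f j)) ^+ 2)
    <= \sum_(j | P j) Ex (fun w => f j w ^+ 2).
Proof.
move=> dep dis; pose g j w := f j w - Ex (f j).
have Eg j : Ex (g j) = 0 by rewrite /g ExB Ex_cst subrr.
have -> : Ex (fun w => (\sum_(j | P j) f j w - \sum_(j | P j) Ex (f j)) ^+ 2) =
    \sum_(j | P j) \sum_(k | P k) Ex (fun w => g j w * g k w).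
  rewrite -[LHS](eq_Ex (f := fun w => \sum_(j | P j) \sum_(k | P k) g j w * g k w)).
    by rewrite Ex_sum; apply: eq_bigr => j _; rewrite Ex_sum.
  by move=> w; rewrite -sumrB expr2 mulr_suml; apply: eq_bigr => j _; rewrite mulr_sumr.
apply: ler_sum => j Pj; rewrite (bigD1 j) //= big1 ?addr0 => [|k /andP[Pk kj]].
  have -> : Ex (fun w => g j w * g j w) = Ex (fun w => f j w ^+ 2) - Ex (f j) ^+ 2.
    have -> : Ex (fun w => g j w * g j w) =
        Ex (fun w => f j w ^+ 2 - (2 * Ex (f j)) * f j w + Ex (f j) ^+ 2).
      by apply: eq_Ex => w; rewrite /g; ring.
    by rewrite ExD ExB ExZ Ex_cst; ring.
  by rewrite lerBlDr lerDl sqr_ge0.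
rewrite (@indep_disjoint (S j) (S k)) ?Eg ?mul0r //.
- by move=> w w' h; rewrite /g (dep _ Pj w w' h).
- by move=> w w' h; rewrite /g (dep _ Pk w w' h).
- by move=> i Sji; apply: (dis _ _ _ Pj Pk _ Sji); rewrite eq_sym.
Qed.

Lemma second_moment_indep_sum (J : finType) (P : pred J) (S : J -> pred I)
    (f : J -> {ffun I -> W} -> R) (M : R) :
  (forall j, P j -> depends_on (S j) (f j)) ->
  (forall j k i, P j -> P k -> j != k -> S j i -> ~~ S k i) ->
  Ex (fun w => (\sum_(j | P j) f j w - M) ^+ 2)
    <= \sum_(j | P j) Ex (fun w => f j w ^+ 2) + (\sum_(j | P j) Ex (f j) - M) ^+ 2.
Proof.
move=> dep dis; set e := \sum_(j | P j) Ex (f j).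
have -> : Ex (fun w => (\sum_(j | P j) f j w - M) ^+ 2) =
   Ex (fun w => (\sum_(j | P j) f j w - e) ^+ 2) + (e - M) ^+ 2.
  have -> : Ex (fun w => (\sum_(j | P j) f j w - M) ^+ 2) =
      Ex (fun w => (\sum_(j | P j) f j w - e) ^+ 2 +
          (2 * (e - M) * (\sum_(j | P j) f j w) + (M ^+ 2 - e ^+ 2))).
    by apply: eq_Ex => w; ring.
  rewrite ExD; congr (_ + _); rewrite ExD ExZ Ex_cst Ex_sum -/e; ring.
by rewrite lerD2r; exact: (variance_indep_sum dep dis).
Qed.

(* The three arguments of [f] read disjoint sets of coordinates, so they may be
   replaced by independent copies. *)
Lemma Ex_decouple3 (A B : pred I) (f : {ffun I -> W} -> {ffun I -> W} -> {ffun I -> W} -> R) :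
  (forall i, A i -> ~~ B i) ->
  (forall w2 w3, depends_on A (fun w => f w w2 w3)) ->
  (forall w1 w3, depends_on B (fun w => f w1 w w3)) ->
  (forall w1 w2, depends_on (fun i => ~~ A i && ~~ B i) (fun w => f w1 w2 w)) ->
  Ex (fun w => f w w w) = Ex (fun w3 => Ex (fun w2 => Ex (fun w1 => f w1 w2 w3))).
Proof.
move=> dis d1 d2 d3.
transitivity (Ex (fun w3 => Ex (fun w1 => f w1 w3 w3))).
  rewrite -(Ex_glue (predC A)); apply: eq_Ex => w3; apply: eq_Ex => w1.
  set g := glue _ _ _.
  rewrite (d1 _ _ g w1) => [|i Ai]; last by rewrite ffunE inE Ai.
  rewrite (d2 _ _ g w3) => [|i Bi]; last first.
    by rewrite ffunE inE ifT //; apply: contraL Bi => /dis.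
  by apply: d3 => i /andP[Ai _]; rewrite ffunE inE Ai.
rewrite -(Ex_glue (predC B)); apply: eq_Ex => w3; apply: eq_Ex => w2.
apply: eq_Ex => w1; set g := glue _ _ _.
rewrite (d2 _ _ g w2) => [|i Bi]; last by rewrite ffunE inE Bi.
by apply: d3 => i /andP[_ Bi]; rewrite ffunE inE Bi.
Qed.

(** Chebyshev: a sum of independent indicators has variance at most its mean, and the mean divided
    by the square of half the mean is 4 over the mean. *)
Lemma count_lower_tail (J : pred I) (P : I -> pred W) (q : R) :
  (forall i, J i -> \sum_(v | P i v) mu i v = q) -> 0 < #|J|%:R * q ->
  Ex (fun w => (\sum_(i | J i) (P i (w i))%:R < #|J|%:R * q / 2)%R%:R)
    <= 4 / (#|J|%:R * q).
Proof.
move=> hq pos; set al := #|J|%:R * q.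
have Ei i : J i -> Ex (fun w => (P i (w i))%:R) = q.
  move=> Ji; rewrite (Ex_coord i (fun v => (P i v)%:R)) -(hq i Ji) [RHS]big_mkcond.
  by apply: eq_bigr => v _; case: (P i v); rewrite ?mulr1 ?mulr0.
have sumE : \sum_(i | J i) Ex (fun w => (P i (w i))%:R) = al.
  by rewrite (eq_bigr _ Ei) sumr_const /al mulr_natl.
have V : Ex (fun w => (\sum_(i | J i) (P i (w i))%:R - al) ^+ 2) <= al.
  rewrite -{1}sumE; apply: le_trans (variance_indep_sum (S := fun i => pred1 i) _ _) _.
  - by move=> i _ w w' h; rewrite h //= eqxx.
  - by move=> i k l _ _ ik /= /eqP ->.
  rewrite le_eqVlt -sumE; apply/orP; left; apply/eqP; apply: eq_bigr => i _; apply: eq_Ex => w.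
  by case: (P i (w i)); rewrite ?expr1n ?expr0n.
have al0 : 0 < al by [].
have c0 : 0 < al ^+ 2 / 4 by rewrite divr_gt0 ?exprn_gt0.
apply: (@le_trans _ _ (al / (al ^+ 2 / 4))); last first.
  by rewrite le_eqVlt; apply/orP; left; apply/eqP; field; rewrite gt_eqF.
apply: le_trans (le_trans (Ex_markov c0 (fun w => sqr_ge0 (\sum_(i | J i) (P i (w i))%:R - al))) _).
  apply: le_Ex => w; rewrite ler_nat; case: ltP => //= h.
  rewrite lt0b; nra.
by rewrite ler_pM2r // invr_gt0.
Qed.

End Expectation.

(** * Squared distance to independence from two pairs of samples *)

Lemma sum_pair (R : realType) (X Y : finType) (f : X * Y -> R) :
  \sum_u f u = \sum_x \sum_y f (x, y).
Proof. by rewrite pair_bigA; apply: eq_bigr => -[]. Qed.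

Section PairKernel.
Variables (R : realType) (X Y : finType) (r : X * Y -> R).
Hypothesis r_ge0 : forall s, 0 <= r s.
Hypothesis r_sum1 : \sum_s r s = 1.

Definition marg1 (x : X) : R := \sum_y r (x, y).
Definition marg2 (y : Y) : R := \sum_x r (x, y).
Definition indep_law (u : X * Y) : R := marg1 u.1 * marg2 u.2.
(** Of the four signed corners in [cross], two have law [r] and two have law [indep_law]; hence the
    factor 2 here, and hence [rho], which governs second moments. *)
Definition nu (u : X * Y) : R := 2 * (r u - indep_law u).
Definition rho (u : X * Y) : R := r u + indep_law u.

Definition mean2 (h : X * Y -> X * Y -> R) : R :=
  \sum_s \sum_s' r s * r s' * h s s'.

Definition cross (s s' u : X * Y) : R :=
  ((s.1 == u.1)%:R - (s'.1 == u.1)%:R) * ((s.2 == u.2)%:R - (s'.2 == u.2)%:R).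

Definition ip (w f g : X * Y -> R) : R := \sum_u w u * f u * g u.

Lemma ipC w f g : ip w f g = ip w g f.
Proof. by apply: eq_bigr => u _; rewrite mulrAC. Qed.

Lemma indep_law_ge0 u : 0 <= indep_law u.
Proof. by apply: mulr_ge0; apply: sumr_ge0. Qed.

Lemma rho_ge0 u : 0 <= rho u.
Proof. by rewrite addr_ge0 ?indep_law_ge0. Qed.

Lemma eq_mean2 h h' : (forall s s', h s s' = h' s s') -> mean2 h = mean2 h'.
Proof. by move=> e; apply: eq_bigr => s _; apply: eq_bigr => s' _; rewrite e. Qed.

Lemma mean2D h h' : mean2 (fun s s' => h s s' + h' s s') = mean2 h + mean2 h'.
Proof.
rewrite /mean2 -big_split; apply: eq_bigr => s _; rewrite -big_split.
by apply: eq_bigr => s' _; rewrite mulrDr.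
Qed.

Lemma mean2Z c h : mean2 (fun s s' => c * h s s') = c * mean2 h.
Proof.
rewrite /mean2 mulr_sumr; apply: eq_bigr => s _; rewrite mulr_sumr.
by apply: eq_bigr => s' _; rewrite mulrCA.
Qed.

Lemma mean2_sum (J : finType) (P : pred J) (h : J -> X * Y -> X * Y -> R) :
  mean2 (fun s s' => \sum_(j | P j) h j s s') = \sum_(j | P j) mean2 (h j).
Proof.
rewrite /mean2 [RHS]exchange_big; apply: eq_bigr => s _; rewrite [RHS]exchange_big.
by apply: eq_bigr => s' _; rewrite mulr_sumr.
Qed.

Lemma le_mean2 h h' : (forall s s', h s s' <= h' s s') -> mean2 h <= mean2 h'.
Proof.
move=> le; apply: ler_sum => s _; apply: ler_sum => s' _.
by rewrite ler_wpM2l ?mulr_ge0.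
Qed.

Lemma mean2_fst (f : X * Y -> R) : mean2 (fun s _ => f s) = \sum_s r s * f s.
Proof.
apply: eq_bigr => s _; rewrite -[RHS]mulr1 -r_sum1 mulr_sumr.
by apply: eq_bigr => s' _; ring.
Qed.

Lemma mean2_snd (f : X * Y -> R) : mean2 (fun _ s => f s) = \sum_s r s * f s.
Proof.
rewrite /mean2 exchange_big; apply: eq_bigr => s _; rewrite -[RHS]mulr1 -r_sum1 mulr_sumr.
by apply: eq_bigr => s' _; ring.
Qed.

(** The first coordinate of one draw and the second of an independent one form a point with the
    product law of the marginals. *)
Lemma mean2_cross12 (f : X * Y -> R) :
  mean2 (fun s s' => f (s.1, s'.2)) = \sum_u indep_law u * f u.
Proof.
rewrite /mean2 sum_pair [RHS]sum_pair /=.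
apply: eq_bigr => x _.
transitivity (\sum_(s' : X * Y) marg1 x * r s' * f (x, s'.2)).
  by rewrite exchange_big; apply: eq_bigr => s' _; rewrite -!mulr_suml.
rewrite sum_pair exchange_big /=.
by apply: eq_bigr => y _; rewrite -mulr_suml -mulr_sumr.
Qed.

Lemma mean2_cross21 (f : X * Y -> R) :
  mean2 (fun s s' => f (s'.1, s.2)) = \sum_u indep_law u * f u.
Proof.
rewrite -mean2_cross12 /mean2 exchange_big; apply: eq_bigr => s _.
by apply: eq_bigr => s' _; rewrite (mulrC (r s)).
Qed.

Lemma sum_delta (f : X * Y -> R) s : \sum_u (s == u)%:R * f u = f s.
Proof.
rewrite (bigD1 s) //= eqxx mul1r big1 ?addr0 // => u /negbTE.
by rewrite eq_sym => ->; rewrite mul0r.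
Qed.

Lemma sum_cross (f : X * Y -> R) s s' : \sum_u f u * cross s s' u =
  f s - f (s.1, s'.2) - f (s'.1, s.2) + f s'.
Proof.
rewrite -[f s]sum_delta -[f (s.1, _)]sum_delta -[f (s'.1, _)]sum_delta -[f s' in RHS]sum_delta.
rewrite -!sumrB -big_split; apply: eq_bigr => u _ /=; rewrite /cross.
case: s s' u => [x y] [x' y'] [u v] /=; rewrite !xpair_eqE /=.
by do 4![case: (_ == _)]; rewrite ?mulr0 ?mulr1 /=; ring.
Qed.

Lemma mean2_crossE (f : X * Y -> R) :
  mean2 (fun s s' => \sum_u f u * cross s s' u) = \sum_u f u * nu u.
Proof.
rewrite (eq_mean2 (h' := fun s s' => f s + (-1) * f (s.1, s'.2) + (-1) * f (s'.1, s.2) + f s')).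
  rewrite !mean2D !mean2Z mean2_fst mean2_snd mean2_cross12 mean2_cross21.
  rewrite !mulr_sumr -!big_split; apply: eq_bigr => u _ /=; rewrite /nu; ring.
by move=> s s'; rewrite sum_cross; ring.
Qed.

Lemma mean2_cross_sqr (f : X * Y -> R) :
  mean2 (fun s s' => (\sum_u f u * cross s s' u) ^+ 2) <= 8 * \sum_u rho u * f u ^+ 2.
Proof.
apply: (@le_trans _ _ (mean2 (fun s s' => 4 * (f s ^+ 2 + f (s.1, s'.2) ^+ 2 +
   f (s'.1, s.2) ^+ 2 + f s' ^+ 2)))).
  apply: le_mean2 => s s'; rewrite sum_cross.
  move: (f s) (f (s.1, s'.2)) (f (s'.1, s.2)) (f s') => a b c d.
  (* Four times the sum of the squares minus the square of the signed sum is this sum of six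
     squares. *)
  rewrite -subr_ge0 (_ : _ - _ = (a + b) ^+ 2 + (a + c) ^+ 2 + (a - d) ^+ 2 +
    (b - c) ^+ 2 + (b + d) ^+ 2 + (c + d) ^+ 2); last by ring.
  by rewrite !addr_ge0 ?sqr_ge0.
rewrite mean2Z !mean2D (mean2_fst (fun s => f s ^+ 2)) (mean2_snd (fun s => f s ^+ 2)).
rewrite (mean2_cross12 (fun s => f s ^+ 2)) (mean2_cross21 (fun s => f s ^+ 2)).
rewrite -!big_split !mulr_sumr le_eqVlt; apply/orP; left; apply/eqP.
by apply: eq_bigr => u _ /=; rewrite /rho; ring.
Qed.

Lemma mean2_cross_entry_sqr u : mean2 (fun s s' => cross s s' u ^+ 2) <= 8 * rho u.
Proof.
have := mean2_cross_sqr (fun v => (u == v)%:R).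
under eq_mean2 do rewrite sum_delta.
congr (_ <= 8 * _); rewrite -[RHS](sum_delta rho); apply: eq_bigr => v _.
by case: (u == v) => /=; rewrite ?expr0n ?expr1n ?mul1r ?mul0r ?mulr1 ?mulr0.
Qed.

Variable w : X * Y -> R.
Hypothesis w_ge0 : forall u, 0 <= w u.

Definition energy : R := \sum_u (w u * rho u) ^+ 2.

Lemma mean2_ip_cross (f : X * Y -> R) : mean2 (fun s s' => ip w f (cross s s')) = ip w f nu.
Proof. exact: (mean2_crossE (fun u => w u * f u)). Qed.

(** The bound of [mean2_cross_sqr] is used twice, over the second pair with the first one frozen and
    then entrywise over the first pair; this gives 8 * 8. *)
Lemma mean2_ip_cross_cross :
  mean2 (fun s s' => mean2 (fun t t' => ip w (cross s s') (cross t t') ^+ 2)) <= 64 * energy.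
Proof.
apply: (@le_trans _ _ (mean2 (fun s s' => 8 * \sum_u (rho u * w u ^+ 2) * cross s s' u ^+ 2))).
  apply: le_mean2 => s s'; apply: le_trans (mean2_cross_sqr (fun u => w u * cross s s' u)) _.
  by rewrite ler_pM2l // le_eqVlt; apply/orP; left; apply/eqP; apply: eq_bigr => u _; ring.
rewrite mean2Z mean2_sum /energy mulr_sumr mulr_sumr; apply: ler_sum => u _.
rewrite mean2Z.
have := mean2_cross_entry_sqr u; have := rho_ge0 u; have := sqr_ge0 (w u).
set e := mean2 _; set p := rho u; set q := w u ^+ 2 => q0 p0 le.
have : (p * q) * e <= (p * q) * (8 * p) by apply: ler_wpM2l => //; apply: mulr_ge0.
by rewrite exprMn -/q; nra.
Qed.

(** The largest value of [w u * rho u] is at most the l2 norm [Num.sqrt energy], which can be taken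
    out of the second moment. *)
Lemma mean2_ip_cross_nu :
  mean2 (fun s s' => ip w nu (cross s s') ^+ 2) <= 8 * (Num.sqrt energy * ip w nu nu).
Proof.
apply: le_trans (mean2_cross_sqr (fun u => w u * nu u)) _; rewrite ler_pM2l //.
rewrite /ip mulr_sumr; apply: ler_sum => u _.
have h : w u * rho u <= Num.sqrt energy.
  rewrite -[leLHS]ger0_norm ?mulr_ge0 ?rho_ge0 // -sqrtr_sqr ler_wsqrtr //.
  rewrite /energy (bigD1 u) //= lerDl; apply: sumr_ge0 => v _; exact: sqr_ge0.
have : (w u * rho u) * (w u * nu u ^+ 2) <= Num.sqrt energy * (w u * nu u ^+ 2).
  by apply: ler_wpM2r => //; rewrite mulr_ge0 ?sqr_ge0.
by congr (_ <= _); ring.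
Qed.

(** Flattening controls the product of the marginals but not the joint law. Writing [rho] as twice
    [indep_law] plus half of [nu] splits the energy by (a + b)^2 <= 2 a^2 + 2 b^2, and weights at
    most 1 turn the [nu] part into signal. *)
Lemma energy_le : (forall u, w u <= 1) ->
  energy <= 8 * \sum_u (w u * indep_law u) ^+ 2 + 2^-1 * ip w nu nu.
Proof.
move=> w1; rewrite /energy /ip !mulr_sumr -big_split; apply: ler_sum => u _ /=.
have -> : rho u = 2 * indep_law u + nu u / 2 by rewrite /rho /nu; field.
have h : w u ^+ 2 * nu u ^+ 2 <= w u * nu u ^+ 2.
  by apply: ler_wpM2r; rewrite ?sqr_ge0 // expr2 ler_piMl.
rewrite -subr_ge0 (_ : _ - _ = (w u * (2 * indep_law u - nu u / 2)) ^+ 2 +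
  2^-1 * (w u * nu u ^+ 2 - w u ^+ 2 * nu u ^+ 2)); last by field.
by rewrite addr_ge0 ?sqr_ge0 // mulr_ge0 // subr_ge0.
Qed.

End PairKernel.

(** * The test statistic, conditionally on the Z-coordinates *)

Local Notation block k := (@Ordinal 6 k isT).

Section Matching.
Variables (Z : finType) (m : nat) (zs : {ffun 'I_6 * 'I_m -> Z}).

Definition occ (b : 'I_6) (z : Z) : nat := #|[pred i | zs (b, i) == z]|.

Definition rank (b : 'I_6) (i : 'I_m) : nat :=
  #|[pred i' : 'I_m | (i' < i)%N && (zs (b, i') == zs (b, i))]|.

(* The k-th sample of block [a] falling in a bin is paired with the k-th sample
   of block [b] falling in the same bin. *)
Definition matched (a b : 'I_6) (ij : 'I_m * 'I_m) : bool :=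
  (zs (a, ij.1) == zs (b, ij.2)) && (rank a ij.1 == rank b ij.2).

Definition npairs (a b : 'I_6) (z : Z) : nat :=
  #|[pred ij | matched a b ij && (zs (a, ij.1) == z)]|.

Lemma rank_lt b i j : zs (b, i) = zs (b, j) -> (i < j)%N -> (rank b i < rank b j)%N.
Proof.
move=> e lt; apply: proper_card; apply/properP; split.
  by apply/fintype.subsetP => k; rewrite !inE e => /andP[/ltn_trans /(_ lt) -> ->].
by exists i; rewrite !inE ?ltnn // lt e /=.
Qed.

Lemma rank_inj b i j : zs (b, i) = zs (b, j) -> rank b i = rank b j -> i = j.
Proof.
move=> e r; apply: val_inj; case: (ltngtP i j) => // lt.
  by have := rank_lt e lt; rewrite r ltnn.
by have := rank_lt (esym e) lt; rewrite r ltnn.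
Qed.

(** With [matched_inj2]: no sample belongs to two pairs, so the pairs are independent given the
    Z-coordinates. *)
Lemma matched_inj1 a b p q : matched a b p -> matched a b q -> p.1 = q.1 -> p = q.
Proof.
case: p q => [i j] [i' j'] /andP[/eqP /= e /eqP f] /andP[/eqP /= e' /eqP f'] h.
by move: e' f'; rewrite -h {}e {}f => e' f'; congr pair => //; exact: rank_inj e' f'.
Qed.

Lemma matched_inj2 a b p q : matched a b p -> matched a b q -> p.2 = q.2 -> p = q.
Proof.
case: p q => [i j] [i' j'] /andP[/eqP /= e /eqP f] /andP[/eqP /= e' /eqP f'] h.
by move: e' f'; rewrite -h -{}e -{}f => e' f'; congr pair => //; rewrite (rank_inj e' f').
Qed.

Lemma sum_matched (R : realType) (a b : 'I_6) (D : pred Z) (F : Z -> R) :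
  \sum_(p | matched a b p && D (zs (a, p.1))) F (zs (a, p.1)) =
  \sum_(z | D z) (npairs a b z)%:R * F z.
Proof.
rewrite (partition_big (fun p => zs (a, p.1)) D) /= => [|p /andP[]//].
apply: eq_bigr => z Dz; rewrite mulr_natl -sumr_const; apply: eq_big => p.
  by rewrite !inE; case: eqP => [->|]; rewrite ?andbF // Dz andbT.
by case/andP => _ /eqP ->.
Qed.

End Matching.

(** * Variance of the statistic for fixed Z-coordinates and fixed weights *)

Section Statistic.
Variables (R : realType) (X Y Z : finType) (m : nat).
Variables (r : Z -> X * Y -> R).
Hypothesis r_ge0 : forall z s, 0 <= r z s.
Hypothesis r_sum1 : forall z, \sum_s r z s = 1.
Variable zs : {ffun 'I_6 * 'I_m -> Z}.

Let I : finType := ('I_6 * 'I_m)%type.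
Let Om := {ffun I -> X * Y}.
Let mu (i : I) : X * Y -> R := r (zs i).
Let mu_ge0 i v : 0 <= mu i v. Proof. exact: r_ge0. Qed.
Let mu_sum1 i : \sum_v mu i v = 1. Proof. exact: r_sum1. Qed.

Lemma pairs_second_moment (a b : 'I_6) (D : pred Z)
    (h : Z -> X * Y -> X * Y -> R) (M : R) : a != b ->
  Ex mu (fun om => (\sum_(p | matched zs a b p && D (zs (a, p.1)))
       h (zs (a, p.1)) (om (a, p.1)) (om (b, p.2)) - M) ^+ 2)
  <= \sum_(z | D z) (npairs zs a b z)%:R * mean2 (r z) (fun s s' => h z s s' ^+ 2)
     + (\sum_(z | D z) (npairs zs a b z)%:R * mean2 (r z) (h z) - M) ^+ 2.
Proof.
move=> ab.
have neab p : (a, p.1) != (b, p.2) :> I by rewrite xpair_eqE negb_and ab.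
have E2 h' p : matched zs a b p && D (zs (a, p.1)) ->
    Ex mu (fun om => h' (zs (a, p.1)) (om (a, p.1)) (om (b, p.2))) =
    mean2 (r (zs (a, p.1))) (h' (zs (a, p.1))).
  move=> /andP[/andP[/eqP e _] _].
  rewrite (Ex_coord2 mu_sum1 (h' (zs (a, p.1))) (neab p)) /mu -e //.
rewrite -!sum_matched.
rewrite -(eq_bigr _ (E2 (fun z s s' => h z s s' ^+ 2))) -(eq_bigr _ (E2 h)).
apply: (second_moment_indep_sum mu_sum1
  (S := fun p i => (i == (a, p.1)) || (i == (b, p.2)))).
  move=> p _ om om' e; rewrite !e ?eqxx ?orbT //.
move=> p q i /andP[mp _] /andP[mq _] pq /orP[]/eqP ->; rewrite negb_or !xpair_eqE ?eqxx
  ?(negbTE ab) ?(eq_sym b a) ?(negbTE ab) /= ?andbT; apply: contraNN pq => /eqP epq.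
  by apply/eqP/(matched_inj1 mp mq).
by apply/eqP/(matched_inj2 mp mq).
Qed.

Variables (lam : Z -> R) (w : Z -> X * Y -> R).
Hypothesis w_ge0 : forall z u, 0 <= w z u.

(** Blocks 0 and 1 are read from [om1], blocks 2 and 3 from [om2], and the weights are parameters,
    so that the three sources of randomness can be averaged one after the other. *)
Definition Astat (om1 om2 : Om) : R :=
  \sum_(p | matched zs (block 0) (block 1) p)
   \sum_(q | matched zs (block 2) (block 3) q && (zs (block 2, q.1) == zs (block 0, p.1)))
    lam (zs (block 0, p.1)) * ip (w (zs (block 0, p.1)))
      (cross R (om1 (block 0, p.1)) (om1 (block 1, p.2)))
      (cross R (om2 (block 2, q.1)) (om2 (block 3, q.2))).

Local Notation kV z := (npairs zs (block 0) (block 1) z).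
Local Notation kW z := (npairs zs (block 2) (block 3) z).

Definition signal (z : Z) : R := ip (w z) (nu (r z)) (nu (r z)).

Definition Amean : R := \sum_z lam z * (kV z)%:R * (kW z)%:R * signal z.

Lemma ip_sumr (T : finType) (P : pred T) (v f : X * Y -> R) (g : T -> X * Y -> R) :
  \sum_(t | P t) ip v f (g t) = ip v f (fun u => \sum_(t | P t) g t u).
Proof.
rewrite /ip exchange_big; apply: eq_bigr => u _; rewrite mulr_sumr //.
Qed.

(** Conditionally on [om2] the statistic is a sum over the independent pairs of blocks 0 and 1. Its
    second moment around [Amean] consists of single-pair moments, bounded in [part1], and the
    squared bias of the conditional mean, bounded in [part2]; both reduce to sums over the
    independent pairs of blocks 2 and 3. *)
Lemma Astat_variance :
  Ex mu (fun om2 => Ex mu (fun om1 => (Astat om1 om2 - Amean) ^+ 2)) <=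
  \sum_z lam z ^+ 2 * ((kV z)%:R * (kW z)%:R * (64 * energy (r z) (w z)) +
    ((kV z)%:R * (kW z)%:R ^+ 2 + (kV z)%:R ^+ 2 * (kW z)%:R) *
      (8 * (Num.sqrt (energy (r z) (w z)) * signal z))).
Proof.
pose U (om2 : Om) z u := \sum_(q | matched zs (block 2) (block 3) q && (zs (block 2, q.1) == z))
   cross R (om2 (block 2, q.1)) (om2 (block 3, q.2)) u.
have AE om1 om2 : Astat om1 om2 = \sum_(p | matched zs (block 0) (block 1) p && predT (zs (block 0, p.1)))
    lam (zs (block 0, p.1)) * ip (w (zs (block 0, p.1)))
      (cross R (om1 (block 0, p.1)) (om1 (block 1, p.2))) (U om2 (zs (block 0, p.1))).
  by apply: eq_big => [p|p _]; rewrite ?andbT // -mulr_sumr ip_sumr.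
pose h om2 z s s' := lam z * ip (w z) (cross R s s') (U om2 z).
have step1 om2 : Ex mu (fun om1 => (Astat om1 om2 - Amean) ^+ 2) <=
   \sum_z (kV z)%:R * mean2 (r z) (fun s s' => h om2 z s s' ^+ 2)
     + (\sum_z (kV z)%:R * mean2 (r z) (h om2 z) - Amean) ^+ 2.
  apply: le_trans (pairs_second_moment predT (h om2) Amean (isT : block 0 != block 1)).
  by apply: le_Ex => // om1; rewrite AE.
apply: le_trans (le_Ex mu_ge0 step1) _.
rewrite ExD Ex_sum.
have part1 z : Ex mu (fun om2 => (kV z)%:R * mean2 (r z) (fun s s' => h om2 z s s' ^+ 2)) <=
  lam z ^+ 2 * ((kV z)%:R * (kW z)%:R * (64 * energy (r z) (w z)) +
     (kV z)%:R * (kW z)%:R ^+ 2 * (8 * (Num.sqrt (energy (r z) (w z)) * signal z))).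
  rewrite ExZ.
  have -> : Ex mu (fun om2 => mean2 (r z) (fun s s' => h om2 z s s' ^+ 2)) =
     lam z ^+ 2 * mean2 (r z) (fun s s' => Ex mu (fun om2 => ip (w z) (cross R s s') (U om2 z) ^+ 2)).
    rewrite -mean2Z /mean2 Ex_sum; apply: eq_bigr => s _; rewrite Ex_sum; apply: eq_bigr => s' _.
    by rewrite -!ExZ; apply: eq_Ex => om2; rewrite /h exprMn.
  rewrite mulrCA ler_wpM2l ?sqr_ge0 //.
  rewrite [leRHS](_ : _ = (kV z)%:R * ((kW z)%:R * (64 * energy (r z) (w z)) +
     (kW z)%:R ^+ 2 * (8 * (Num.sqrt (energy (r z) (w z)) * signal z)))); last by ring.
  rewrite ler_wpM2l //.
  apply: (@le_trans _ _ (mean2 (r z) (fun s s' =>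
    (kW z)%:R * mean2 (r z) (fun t t' => ip (w z) (cross R s s') (cross R t t') ^+ 2) +
    (kW z)%:R ^+ 2 * (ip (w z) (nu (r z)) (cross R s s')) ^+ 2))).
    apply: le_mean2 => // s s'.
    have := pairs_second_moment (pred1 z) (fun _ t t' => ip (w z) (cross R s s') (cross R t t')) 0
      (isT : block 2 != block 3).
    rewrite !big_pred1_eq subr0 mean2_ip_cross // ipC exprMn; apply: le_trans.
    by apply: le_Ex => // om2; rewrite subr0 ip_sumr.
  rewrite mean2D !mean2Z lerD //; rewrite ler_wpM2l ?exprn_ge0 //.
    exact: mean2_ip_cross_cross.
  exact: mean2_ip_cross_nu.
have part2 : Ex mu (fun om2 => (\sum_z (kV z)%:R * mean2 (r z) (h om2 z) - Amean) ^+ 2) <=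
  \sum_z lam z ^+ 2 * ((kV z)%:R ^+ 2 * (kW z)%:R * (8 * (Num.sqrt (energy (r z) (w z)) * signal z))).
  pose h' z t t' := lam z * (kV z)%:R * ip (w z) (nu (r z)) (cross R t t').
  have := pairs_second_moment predT h' Amean (isT : block 2 != block 3).
  set S := (\sum_(z | predT z) _ - _).
  (* The conditional mean is unbiased for [Amean], so this second application leaves no bias. *)
  have -> : S = 0.
    rewrite /S /Amean; apply/eqP; rewrite subr_eq0; apply/eqP; apply: eq_bigr => z _.
    rewrite /h' mean2Z mean2_ip_cross // /signal; ring.
  rewrite expr0n addr0 => le; apply: (@le_trans _ _ (\sum_(z | predT z) (kW z)%:R *
     mean2 (r z) (fun s s' => h' z s s' ^+ 2))).
    apply: le_trans le; apply: le_Ex => // om2; rewrite le_eqVlt; apply/orP; left; apply/eqP.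
    congr ((_ - _) ^+ 2); rewrite [RHS](partition_big (fun q => zs (block 2, q.1)) predT) //=.
    apply: eq_bigr => z _; rewrite /h mean2Z.
    under eq_mean2 do rewrite ipC.
    rewrite mean2_ip_cross // ipC /U -ip_sumr mulrCA mulr_sumr mulr_sumr.
    by apply: eq_big => q; rewrite ?andbT // => /andP[_ /eqP ->]; rewrite /h'; ring.
  apply: ler_sum => z _.
  have -> : mean2 (r z) (fun s s' => h' z s s' ^+ 2) = lam z ^+ 2 * (kV z)%:R ^+ 2 *
      mean2 (r z) (fun s s' => ip (w z) (nu (r z)) (cross R s s') ^+ 2).
    by rewrite -mean2Z; apply: eq_mean2 => s s'; rewrite /h' !exprMn.
  have := mean2_ip_cross_nu (r_ge0 z) (r_sum1 z) (w_ge0 z).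
  set e := mean2 _ _; set f := 8 * _ => le1.
  rewrite (_ : _ * _ = (lam z ^+ 2 * ((kV z)%:R ^+ 2 * (kW z)%:R)) * e); last by ring.
  rewrite [leRHS]mulrA; apply: ler_wpM2l le1; rewrite mulr_ge0 ?sqr_ge0 ?mulr_ge0 ?exprn_ge0 //.
apply: le_trans (lerD (ler_sum _ (fun z _ => part1 z)) part2) _.
rewrite -big_split /= le_eqVlt; apply/orP; left; apply/eqP; apply: eq_bigr => z _; ring.
Qed.

End Statistic.

(** * The weights of the statistic *)

(** The integer square root as a bounded sum of truth values, the form that the term language can
    express; the counted [j] are an initial segment. *)
Definition isqrt (n : nat) : nat := (\sum_(j < n) (j.+1 * j.+1 <= n))%N.

Lemma isqrt_count n k : let s := (\sum_(j < k) (j.+1 * j.+1 <= n))%N in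
  (s ^ 2 <= n)%N /\ (s = k \/ (n < s.+1 ^ 2)%N).
Proof.
elim: k => [|k [IH1 IH2]] s; first by rewrite /s big_ord0; split => //; left.
rewrite /s {s} big_ord_recr /=; move: IH1 IH2; set s := (\sum_(j < k) _)%N => IH1 IH2.
case: (leqP (k.+1 * k.+1) n) => h; rewrite /= ?addn0 ?addn1.
  case: IH2 => [->|]; first by split; [rewrite -mulnn|left].
  move=> lt; have le : (s <= k)%N.
    apply: (@leq_trans (\sum_(j < k) 1)); first by apply: leq_sum => j _; exact: leq_b1.
    by rewrite sum_nat_const card_ord muln1.
  have : (s.+1 ^ 2 <= n)%N by rewrite -mulnn; apply: leq_trans h; rewrite leq_mul // ltnS.
  by rewrite leqNgt lt.
split=> //; case: IH2 => [e|]; last by right.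
by right; rewrite e -mulnn.
Qed.

Lemma isqrt_le n : (isqrt n ^ 2 <= n)%N.
Proof. by case: (isqrt_count n n). Qed.

Lemma isqrt_gt n : (n < (isqrt n).+1 ^ 2)%N.
Proof. by case: (isqrt_count n n) => _ []; rewrite -/(isqrt n) // => ->; nia. Qed.

Lemma isqrt_gt0 n : (0 < n)%N -> (0 < isqrt n)%N.
Proof. by move=> n0; have := isqrt_gt n; case: (isqrt n) => //; lia. Qed.

Lemma isqrt_ge n : (n <= 4 * isqrt n ^ 2)%N.
Proof.
case: (posnP n) => [->//|n0]; have := isqrt_gt n; have := isqrt_gt0 n0.
by rewrite -!mulnn; nia.
Qed.

Section FloorQuotient.
Variable R : realType.
Implicit Types L A B : nat.

Lemma floor_quot_le L A B : (0 < L)%N -> (0 < B)%N ->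
  ((L * A) %/ B)%:R / L%:R <= A%:R / B%:R :> R.
Proof.
move=> L0 B0; rewrite ler_pdivrMr ?ltr0n // mulrAC ler_pdivlMr ?ltr0n //.
by rewrite -!natrM ler_nat (mulnC A) leq_trunc_div.
Qed.

(** A floor that is at least 1 is at least half of its quotient. *)
Lemma floor_quot_ge L A B : (0 < L)%N -> (0 < B)%N -> (B <= L * A)%N ->
  A%:R / B%:R <= 2 * (((L * A) %/ B)%:R / L%:R) :> R.
Proof.
move=> L0 B0 le; rewrite mulrA ler_pdivlMr ?ltr0n // mulrAC ler_pdivrMr ?ltr0n //.
rewrite -!natrM ler_nat.
have q0 : (0 < (L * A) %/ B)%N by rewrite divn_gt0.
have := ltn_pmod (L * A) B0; have := divn_eq (L * A) B; nia.
Qed.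
End FloorQuotient.

(* [k] and [K] are the smaller and the larger of the two numbers of pairs of a
   bin, [H] its energy, [F] its flattened collision probability and [N] its signal:
   the left-hand side is the contribution of the bin to [Astat_variance]. *)
Lemma bin_variance_bound (R : realType) (kV kW k K om lam H F N M G : R) :
  1 <= k -> 0 <= om -> om <= 2 * k -> kV * kW = k * K -> kV + kW = k + K -> k <= K ->
  lam <= om / K -> om / K <= 2 * lam -> 0 <= H -> 0 <= F -> 0 <= N ->
  H <= 8 * F + 2^-1 * N ->
  M = lam * kV * kW * N -> G = om ^+ 2 * F ->
  lam ^+ 2 * (kV * kW * (64 * H) + (kV * kW ^+ 2 + kV ^+ 2 * kW) * (8 * (Num.sqrt H * N)))
  <= 512 * G + 128 * M + 16 * Num.sqrt (8 * G + 2 * M) * M.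
Proof.
move=> k1 om0 omk prodk sumk leK lamU lamL H0 F0 N0 leH ME0 GE.
have K0 : 0 < K by lra.
have lam0 : 0 <= lam.
  have : 0 <= om / K by rewrite divr_ge0 // ltW.
  by lra.
have lamK : lam * K <= om by rewrite -ler_pdivlMr.
have lamK2 : om <= 2 * (lam * K) by rewrite mulrA -ler_pdivrMr.
have ME : M = lam * K * k * N by rewrite ME0 -mulrA -mulrA -mulrA (mulrA kV) prodk; ring.
have M0 : 0 <= M by rewrite ME !mulr_ge0 // ?ltW //; lra.
(* The cap [om <= 2 * k] acts here: it turns the [nu] part of the energy into a multiple of the mean
   [M] of the bin. *)
have omN : om ^+ 2 * N <= 4 * M.
  rewrite ME; have : om * om <= (2 * (lam * K)) * (2 * k) by apply: ler_pM.
  by move=> /(ler_wpM2r N0); rewrite expr2; nra.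
have om2H : om ^+ 2 * H <= 8 * G + 2 * M.
  have := ler_wpM2l (sqr_ge0 om) leH; rewrite GE; nra.
have first : lam ^+ 2 * (kV * kW * (64 * H)) <= 64 * (om ^+ 2 * H).
  have : lam ^+ 2 * (k * K) <= om ^+ 2.
    apply: (@le_trans _ _ ((lam * K) ^+ 2)); last by rewrite ler_pXn2r // nnegrE // mulr_ge0 // ltW.
    by rewrite exprMn ler_wpM2l ?sqr_ge0 // expr2 ler_wpM2r // ltW.
  by move=> /(ler_wpM2r H0); rewrite prodk; nra.
(* The mixed term equals [8 * (lam * (kV + kW)) * Num.sqrt H * M], and [lam * (kV + kW)] is at most
   [2 * om] because [k <= K]. *)
have second : lam ^+ 2 * ((kV * kW ^+ 2 + kV ^+ 2 * kW) * (8 * (Num.sqrt H * N))) <=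
    16 * Num.sqrt (8 * G + 2 * M) * M.
  have sH : om * Num.sqrt H <= Num.sqrt (8 * G + 2 * M).
    by rewrite -{1}[om]ger0_norm // -sqrtr_sqr -sqrtrM ?sqr_ge0 // ler_wsqrtr.
  have -> : lam ^+ 2 * ((kV * kW ^+ 2 + kV ^+ 2 * kW) * (8 * (Num.sqrt H * N))) =
     8 * (lam * (kV + kW)) * Num.sqrt H * M by rewrite ME0; ring.
  rewrite sumk; apply: ler_wpM2r => //.
  have : lam * (k + K) <= 2 * om by nra.
  by move=> /(ler_wpM2r (sqrtr_ge0 H)); nra.
rewrite mulrDr; have := lerD first second; lra.
Qed.

(** * Flattening *)

Section Flattening.
Variables (R : realType) (W Z T : finType) (m : nat).
Variables (r : Z -> W -> R).
Hypothesis r_ge0 : forall z s, 0 <= r z s.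
Hypothesis r_sum1 : forall z, \sum_s r z s = 1.
Variable zs : {ffun 'I_6 * 'I_m -> Z}.
Let I : finType := ('I_6 * 'I_m)%type.
Let mu (i : I) : W -> R := r (zs i).
Let mu_ge0 i v : 0 <= mu i v. Proof. exact: r_ge0. Qed.
Let mu_sum1 i : \sum_v mu i v = 1. Proof. exact: r_sum1. Qed.
Variables (b : 'I_6) (z : Z) (pr : W -> T).

Definition hits (om : {ffun I -> W}) (t : T) : nat :=
  #|[pred i | (zs (b, i) == z) && (pr (om (b, i)) == t)]|.

Let law (t : T) : R := \sum_(s | pr s == t) r z s.

Lemma law_ge0 t : 0 <= law t. Proof. by apply: sumr_ge0. Qed.

Lemma law_sum1 : \sum_t law t = 1.
Proof. by rewrite -(r_sum1 z) [RHS](partition_big pr predT). Qed.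

Let J (i : I) := (i.1 == b) && (zs i == z).

Lemma sum_block (V : nmodType) (P : pred 'I_m) (F : I -> V) :
  \sum_(i : I | (i.1 == b) && P i.2) F i = \sum_(i | P i) F (b, i).
Proof.
transitivity (\sum_(b' | b' == b) \sum_(i | P i) F (b', i)); last by rewrite big_pred1_eq.
by rewrite pair_big_dep /=; apply: eq_big => [[]|[]].
Qed.

Lemma card_block : #|J| = occ zs b z.
Proof.
rewrite -sum1_card /occ -sum1_card.
have := sum_block (fun i => zs (b, i) == z) (fun _ => 1%N) => /= <-.
by apply: eq_bigl => -[b' i]; rewrite unfold_in /J /=; case: eqP => //= ->.
Qed.

Lemma hits_tail t : 0 < (occ zs b z)%:R * law t ->
  Ex mu (fun om => ((hits om t)%:R < (occ zs b z)%:R * law t / 2)%R%:R)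
  <= 4 / ((occ zs b z)%:R * law t).
Proof.
rewrite -card_block => pos.
have hq i : J i -> \sum_(v | pr v == t) mu i v = law t.
  by case/andP => _ /eqP e; rewrite /mu e.
apply: le_trans (count_lower_tail mu_ge0 mu_sum1 (P := fun _ v => pr v == t) hq pos).
rewrite le_eqVlt; apply/orP; left; apply/eqP; apply: eq_Ex => om.
congr ((_ < _)%R%:R); rewrite /hits -sum1_card natr_sum.
have := sum_block (fun i => zs (b, i) == z) (fun i => (pr (om i) == t)%:R : R) => /= e.
transitivity (\sum_(i | zs (b, i) == z) (pr (om (b, i)) == t)%:R : R).
  rewrite (eq_bigl (fun i => (zs (b, i) == z) && (pr (om (b, i)) == t))) //.
  by rewrite big_mkcondr; apply: eq_bigr => i _; case: eqP.
rewrite -e; apply: eq_bigl => -[b' i]; rewrite /J /=; case: eqP => //= ->//.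
Qed.

Variable l : nat.
Hypothesis l_gt0 : (0 < l)%N.

(* Scaling the number of hits by [l / max l N] makes the total mass
   [\sum_t (1 + l * hits t / max l N)] at most [2 l]. *)
Definition shrink (om : {ffun I -> W}) (t : T) : R :=
  (maxn (occ zs b z) l)%:R / (maxn (occ zs b z) l + l * hits om t)%:R.

Lemma shrink_ge0 om t : 0 <= shrink om t.
Proof. exact: divr_ge0. Qed.

Lemma shrink_le1 om t : shrink om t <= 1.
Proof.
rewrite /shrink ler_pdivrMr ?mul1r ?ler_nat ?leq_addr // ltr0n.
by rewrite addn_gt0 leq_max l_gt0 orbT.
Qed.

(** If [t] receives half of its expected hits, [shrink] is at most 2 / (min N l * law t), by max N l
    * min N l = N * l; otherwise it is at most 1, with probability at most 4 / (N * law t). So [t]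
    contributes at most 6 * law t / min N l, and the laws add up to 1. The successor in the
    conclusion covers empty bins, where the trivial bound 1 suffices. *)
Lemma flattened_collision (wt : {ffun I -> W} -> T -> R) :
  (forall om t, 0 <= wt om t <= shrink om t) ->
  Ex mu (fun om => \sum_t (wt om t * law t) ^+ 2) <= 12 / (minn (occ zs b z) l).+1%:R.
Proof.
move=> hw; set N := occ zs b z; set t0 := minn N l.
have wt2 om t : (wt om t * law t) ^+ 2 <= law t ^+ 2 * shrink om t.
  case/andP: (hw om t) => w0 w1; have := law_ge0 t; have := shrink_le1 om t => s1 l0.
  rewrite exprMn mulrC ler_wpM2l ?sqr_ge0 // expr2.
  apply: le_trans w1; rewrite ler_piMr //; exact: le_trans (andP (hw om t)).2 s1.
have law1 t : law t <= 1.
  by rewrite -law_sum1 (bigD1 t) //= lerDl; apply: sumr_ge0 => *; exact: law_ge0.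
case: (posnP N) => N0.
  apply: (@le_trans _ _ 1); last by rewrite /t0 N0 min0n divr1 ler1n.
  apply: Ex_le_cst => // om; rewrite -law_sum1; apply: ler_sum => t _.
  apply: le_trans (wt2 om t) _; have := law_ge0 t; have := law1 t.
  have := shrink_le1 om t; have := shrink_ge0 om t => s0 s1 l1 l0.
  rewrite expr2 -mulrA ler_piMr // mulr_ile1 //.
have t00 : (0 < t0)%N by rewrite leq_min N0 l_gt0.
apply: (@le_trans _ _ (6 / t0%:R)); last first.
  rewrite ler_pdivrMr ?ltr0n // mulrAC ler_pdivlMr ?ltr0n //.
  by rewrite -!natrM ler_nat; lia.
rewrite (_ : 6 / t0%:R = \sum_t 6 * law t / t0%:R); last first.
  by rewrite -mulr_suml -mulr_sumr law_sum1 mulr1.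
rewrite Ex_sum; apply: ler_sum => t _.
have [l0|l0] := eqVneq (law t) 0.
  rewrite l0 mulr0 mul0r; under eq_Ex do rewrite mulr0 expr0n /=.
  by rewrite Ex_cst.
have lp : 0 < law t by rewrite lt_neqAle eq_sym l0 law_ge0.
apply: (@le_trans _ _ (law t ^+ 2 * (4 / (N%:R * law t) + 2 / (t0%:R * law t)))); last first.
  have tN : 4 / (N%:R * law t) <= 4 / (t0%:R * law t).
    rewrite ler_pM2l // lef_pV2 ?posrE ?mulr_gt0 ?ltr0n //.
    by rewrite ler_pM2r // ler_nat geq_minl.
  apply: (@le_trans _ _ (law t ^+ 2 * (4 / (t0%:R * law t) + 2 / (t0%:R * law t)))).
    by rewrite ler_wpM2l ?sqr_ge0 // lerD2r.
  rewrite le_eqVlt; apply/orP; left; apply/eqP; field.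
  by rewrite l0 andbT pnatr_eq0 -lt0n.
apply: (@le_trans _ _ (Ex mu (fun om => law t ^+ 2 *
   (((hits om t)%:R < N%:R * law t / 2)%R%:R + 2 / (t0%:R * law t))))).
  apply: le_Ex => // om; apply: le_trans (wt2 om t) _; rewrite ler_wpM2l ?sqr_ge0 //.
  have p2 : 0 <= 2 / (t0%:R * law t) by rewrite divr_ge0 // mulr_ge0 // ltW.
  case: ltP => /= h; first by have := shrink_le1 om t; lra.
  rewrite add0r /shrink -/N; set D := maxn N l.
  have D0 : (0 < D)%N by rewrite leq_max N0.
  rewrite ler_pdivrMr ?ltr0n ?addn_gt0 ?D0 // mulrAC ler_pdivlMr ?mulr_gt0 ?ltr0n //.
  have e : D%:R * t0%:R = N%:R * l%:R :> R.
    rewrite -!natrM /D /t0; congr (_%:R); case: (leqP N l) => hl.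
      by rewrite mulnC.
    by [].
  rewrite natrD natrM mulrA e.
  have hl : (N%:R * law t / 2) * l%:R <= (hits om t)%:R * l%:R by apply: ler_wpM2r.
  have : 0 <= D%:R :> R by [].
  lra.
rewrite ExZ ler_wpM2l ?sqr_ge0 // ExD Ex_cst // lerD2r; apply: hits_tail.
by rewrite mulr_gt0 // ltr0n.
Qed.

Lemma hits_sum om : (\sum_t hits om t = occ zs b z)%N.
Proof.
rewrite /occ -sum1_card [RHS](partition_big (fun i => pr (om (b, i))) predT) //=.
by apply: eq_bigr => t _; rewrite /hits -sum1_card; apply: eq_bigl => i; rewrite !inE.
Qed.

Lemma shrink_inv_sum om : #|T| = l -> \sum_t (shrink om t)^-1 <= 2 * l%:R.
Proof.
move=> cT; set D := maxn (occ zs b z) l.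
have D0 : 0 < D%:R :> R by rewrite ltr0n leq_max l_gt0 orbT.
have -> : \sum_t (shrink om t)^-1 = \sum_t (1 + l%:R * (hits om t)%:R / D%:R).
  apply: eq_bigr => t _; rewrite /shrink -/D natrD natrM invf_div mulrDl divff //.
  by rewrite gt_eqF.
rewrite big_split /= sumr_const cT -mulr_suml -mulr_sumr -natr_sum hits_sum.
rewrite (_ : 2 * l%:R = l%:R + l%:R); last by ring.
rewrite lerD2l -mulrA ler_piMr // ler_pdivrMr // mul1r ler_nat leq_maxl //.
Qed.

End Flattening.

(** * Bounds conditional on the Z-coordinates *)

(** Doubling the sum reduces this to a_i b_j + a_j b_i >= 2 c_i c_j, an inequality between
    arithmetic and geometric means; nothing is divided by the weights. *)
Lemma weighted_cauchy_schwarz (R : realType) (J : finType) (P : pred J) (a b c : J -> R) :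
  (forall i, P i -> 0 <= a i) -> (forall i, P i -> 0 <= b i) ->
  (forall i, P i -> c i ^+ 2 <= a i * b i) ->
  (\sum_(i | P i) c i) ^+ 2 <= (\sum_(i | P i) a i) * (\sum_(i | P i) b i).
Proof.
move=> a0 b0 cab.
have ge0 : 0 <= \sum_(i | P i) \sum_(j | P j) (a i * b j + a j * b i - 2 * (c i * c j)).
  apply: sumr_ge0 => i Pi; apply: sumr_ge0 => j Pj.
  have ai := a0 i Pi; have aj := a0 j Pj; have bi := b0 i Pi; have bj := b0 j Pj.
  set p := a i * b j; set q := a j * b i.
  have p0 : 0 <= p + q by rewrite addr_ge0 // mulr_ge0.
  have le : (2 * (c i * c j)) ^+ 2 <= (p + q) ^+ 2.
    have : (c i * c j) ^+ 2 <= p * q.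
      have -> : p * q = (a i * b i) * (a j * b j) by rewrite /p /q; ring.
      by rewrite exprMn ler_pM ?sqr_ge0 ?cab.
    have := sqr_ge0 (p - q); nra.
  have : `|2 * (c i * c j)| <= `|p + q| by rewrite -ler_sqr ?nnegrE // !real_normK ?num_real.
  by rewrite (ger0_norm p0) => /(le_trans (ler_norm _)); rewrite subr_ge0.
have e : \sum_(i | P i) \sum_(j | P j) (a i * b j + a j * b i - 2 * (c i * c j)) =
   2 * ((\sum_(i | P i) a i) * (\sum_(i | P i) b i) - (\sum_(i | P i) c i) ^+ 2).
  have e1 : \sum_(i | P i) \sum_(j | P j) a i * b j = (\sum_(i | P i) a i) * (\sum_(i | P i) b i).
    by rewrite big_distrlr.
  have e2 : \sum_(i | P i) \sum_(j | P j) a j * b i = (\sum_(i | P i) a i) * (\sum_(i | P i) b i).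
    by rewrite exchange_big big_distrlr.
  have e3 : \sum_(i | P i) \sum_(j | P j) 2 * (c i * c j) = 2 * (\sum_(i | P i) c i) ^+ 2.
    by rewrite expr2 big_distrlr mulr_sumr; apply: eq_bigr => i _; rewrite mulr_sumr.
  under eq_bigr do rewrite sumrB big_split /=.
  by rewrite sumrB big_split /= e1 e2 e3; ring.
by move: ge0; rewrite e pmulr_rge0 // subr_ge0.
Qed.

Section BinWeights.
Variables (X Y Z : finType) (m : nat) (zs : {ffun 'I_6 * 'I_m -> Z}).
Let Om := {ffun 'I_6 * 'I_m -> X * Y}.

Definition kmin z : nat :=
  minn (npairs zs (block 0) (block 1) z) (npairs zs (block 2) (block 3) z).
Definition kmax z : nat :=
  maxn (npairs zs (block 0) (block 1) z) (npairs zs (block 2) (block 3) z).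
Definition flat1 z : nat := minn (minn (occ zs (block 4) z) #|X|) (kmin z).
Definition flat2 z : nat := minn (minn (occ zs (block 5) z) #|Y|) (kmin z).
Definition omega z : nat := isqrt ((flat1 z).+1 * (flat2 z).+1).

(** [m * m] dominates [kmax], and [#|X| + 1] dominates the quotient (D + #|X| * h) / D of the
    flattening, as the hits h never exceed D; likewise for [Y]. All scaled quotients are thus at
    least 1 before rounding. *)
Definition scaleL : nat := (m * m + #|X| + #|Y|).+1.

(* [lamN], [wN1] and [wN2] are real weights scaled by [scaleL] and rounded down;
   [scaleL] is so large that rounding costs at most a factor 2. *)
Definition lamN z : nat := (scaleL * omega z) %/ kmax z.

Definition wN1 (om : Om) z x : nat :=
  (scaleL * maxn (occ zs (block 4) z) #|X|) %/
  (maxn (occ zs (block 4) z) #|X| + #|X| * hits zs (block 4) z (@fst X Y) om x).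

Definition wN2 (om : Om) z y : nat :=
  (scaleL * maxn (occ zs (block 5) z) #|Y|) %/
  (maxn (occ zs (block 5) z) #|Y| + #|Y| * hits zs (block 5) z (@snd X Y) om y).

Lemma npairs_le a b z : (npairs zs a b z <= m * m)%N.
Proof. by apply: leq_trans (max_card _) _; rewrite card_prod card_ord. Qed.

Lemma npairs_witness a b z : (0 < npairs zs a b z)%N -> exists i, zs (a, i) = z.
Proof. by case/card_gt0P => -[i j] /andP[_ /eqP e]; exists i. Qed.

Lemma omega_gt0 z : (0 < omega z)%N.
Proof. exact: isqrt_gt0. Qed.

Lemma omega_le z : (0 < kmin z)%N -> (omega z <= 2 * kmin z)%N.
Proof.
move=> k0; have := isqrt_le ((flat1 z).+1 * (flat2 z).+1); rewrite -/(omega z).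
have h1 : (flat1 z <= kmin z)%N by exact: geq_minr.
have h2 : (flat2 z <= kmin z)%N by exact: geq_minr.
rewrite -mulnn => h; rewrite leqNgt; apply/negP => lt.
have : ((2 * kmin z).+1 * (2 * kmin z).+1 <= (flat1 z).+1 * (flat2 z).+1)%N.
  by apply: leq_trans h; exact: leq_mul.
have : ((flat1 z).+1 * (flat2 z).+1 <= (kmin z).+1 * (kmin z).+1)%N by exact: leq_mul.
nia.
Qed.

Lemma card_active : (#|[pred z | (0 < kmin z)%N]| <= minn #|Z| m)%N.
Proof.
rewrite leq_min max_card /=.
apply: (@leq_trans #|[seq zs (block 0, i) | i : 'I_m]|).
  apply: subset_leq_card; apply/fintype.subsetP => z; rewrite inE /kmin leq_min.
  by case/andP => /npairs_witness [i <-] _; apply/mapP; exists i => //; rewrite mem_enum.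
by rewrite (leq_trans (leq_image_card _ _)) // card_ord.
Qed.

Variable R : realType.

Definition lamR z : R := (lamN z)%:R / scaleL%:R.
Definition w1 om z x : R := (wN1 om z x)%:R / scaleL%:R.
Definition w2 om z y : R := (wN2 om z y)%:R / scaleL%:R.
Definition wR om z (u : X * Y) : R := w1 om z u.1 * w2 om z u.2.

Variables (r : Z -> X * Y -> R).
Hypothesis r_ge0 : forall z s, 0 <= r z s.
Hypothesis r_sum1 : forall z, \sum_s r z s = 1.
Hypotheses (X0 : (0 < #|X|)%N) (Y0 : (0 < #|Y|)%N).
Let mu (i : 'I_6 * 'I_m) : X * Y -> R := r (zs i).

Lemma w1_bounds om z x : 0 <= w1 om z x <= shrink R zs (block 4) z (@fst X Y) #|X| om x
  /\ shrink R zs (block 4) z (@fst X Y) #|X| om x <= 2 * w1 om z x.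
Proof.
rewrite divr_ge0 //=; rewrite /w1 /wN1 /shrink.
have h : (hits zs (block 4) z (@fst X Y) om x <= maxn (occ zs (block 4) z) #|X|)%N.
  by rewrite leq_max -(hits_sum zs (block 4) z (@fst X Y) om) (bigD1 x) //= leq_addr.
have D0 : (0 < maxn (occ zs (block 4) z) #|X|)%N by rewrite leq_max X0 orbT.
split; [apply: floor_quot_le|apply: floor_quot_ge] => //; rewrite ?addn_gt0 ?D0 //.
rewrite /scaleL; move: (maxn _ _) (hits _ _ _ _ _ _) h D0 => D h le D0.
rewrite mulSn leq_add2l !mulnDl; apply: (@leq_trans (#|X| * D)); first exact: leq_mul.
lia.
Qed.

Lemma w2_bounds om z y : 0 <= w2 om z y <= shrink R zs (block 5) z (@snd X Y) #|Y| om y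
  /\ shrink R zs (block 5) z (@snd X Y) #|Y| om y <= 2 * w2 om z y.
Proof.
rewrite divr_ge0 //=; rewrite /w2 /wN2 /shrink.
have h : (hits zs (block 5) z (@snd X Y) om y <= maxn (occ zs (block 5) z) #|Y|)%N.
  by rewrite leq_max -(hits_sum zs (block 5) z (@snd X Y) om) (bigD1 y) //= leq_addr.
have D0 : (0 < maxn (occ zs (block 5) z) #|Y|)%N by rewrite leq_max Y0 orbT.
split; [apply: floor_quot_le|apply: floor_quot_ge] => //; rewrite ?addn_gt0 ?D0 //.
rewrite /scaleL; move: (maxn _ _) (hits _ _ _ _ _ _) h D0 => D h le D0.
rewrite mulSn leq_add2l !mulnDl; apply: (@leq_trans (#|Y| * D)); first exact: leq_mul.
lia.
Qed.

Lemma w1_le1 om z x : 0 <= w1 om z x <= 1.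
Proof.
have [/andP[-> /= h] _] := w1_bounds om z x.
by apply: le_trans h _; apply: shrink_le1.
Qed.

Lemma w2_le1 om z y : 0 <= w2 om z y <= 1.
Proof.
have [/andP[-> /= h] _] := w2_bounds om z y.
by apply: le_trans h _; apply: shrink_le1.
Qed.

Lemma wR_ge0 om z u : 0 <= wR om z u.
Proof.
have /andP[h _] := w1_le1 om z u.1; have /andP[h' _] := w2_le1 om z u.2.
exact: mulr_ge0.
Qed.

Lemma wR_le1 om z u : wR om z u <= 1.
Proof.
have /andP[h1 h2] := w1_le1 om z u.1; have /andP[h3 h4] := w2_le1 om z u.2.
exact: mulr_ile1.
Qed.

Definition collision om z : R := \sum_u (wR om z u * indep_law (r z) u) ^+ 2.

(** Up to a constant, the part of the variance that survives under independence; given [zs] it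
    depends on blocks 4 and 5 only. *)
Definition noise om : R :=
  \sum_(z | (0 < kmin z)%N) (omega z)%:R ^+ 2 * collision om z.

Local Notation M om := (Amean r zs lamR (wR om)).

Lemma collision_ge0 om z : 0 <= collision om z.
Proof. by apply: sumr_ge0 => u _; exact: sqr_ge0. Qed.

Lemma noise_ge0 om : 0 <= noise om.
Proof. by apply: sumr_ge0 => z _; rewrite mulr_ge0 ?sqr_ge0 ?collision_ge0. Qed.

Lemma signal_ge0 om z : 0 <= signal r (wR om) z.
Proof. by apply: sumr_ge0 => u _; rewrite -mulrA -expr2 mulr_ge0 ?sqr_ge0 ?wR_ge0. Qed.

Lemma kmin_kmaxM z : (npairs zs (block 0) (block 1) z)%:R *
  (npairs zs (block 2) (block 3) z)%:R = (kmin z)%:R * (kmax z)%:R :> R.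
Proof. by rewrite -!natrM /kmin /kmax; congr (_%:R); case: leqP => //; rewrite mulnC. Qed.

Lemma kmin_kmaxD z : (npairs zs (block 0) (block 1) z)%:R +
  (npairs zs (block 2) (block 3) z)%:R = (kmin z)%:R + (kmax z)%:R :> R.
Proof. by rewrite -!natrD /kmin /kmax; congr (_%:R); case: leqP => //; rewrite addnC. Qed.

Lemma kmin_le_kmax z : (kmin z <= kmax z)%N.
Proof. by rewrite geq_min leq_max leqnn. Qed.

Lemma lamR_bounds z : (0 < kmin z)%N ->
  lamR z <= (omega z)%:R / (kmax z)%:R /\ (omega z)%:R / (kmax z)%:R <= 2 * lamR z.
Proof.
move=> k0; have K0 := leq_trans k0 (kmin_le_kmax z); have o0 := omega_gt0 z.
split; [apply: floor_quot_le|apply: floor_quot_ge] => //.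
have : (kmax z <= m * m)%N by rewrite geq_max !npairs_le.
by rewrite /scaleL; nia.
Qed.

Lemma lamR_ge0 z : 0 <= lamR z.
Proof. exact: divr_ge0. Qed.

Definition bin_signal om z : R := lamR z * (npairs zs (block 0) (block 1) z)%:R *
  (npairs zs (block 2) (block 3) z)%:R * signal r (wR om) z.

Lemma bin_signal_ge0 om z : 0 <= bin_signal om z.
Proof. by rewrite !mulr_ge0 ?lamR_ge0 ?signal_ge0. Qed.

Lemma conditional_variance om :
  Ex mu (fun om2 => Ex mu (fun om1 => (Astat zs lamR (wR om) om1 om2 - M om) ^+ 2)) <=
  512 * noise om + 128 * M om + 16 * Num.sqrt (8 * noise om + 2 * M om) * M om.
Proof.
apply: le_trans (Astat_variance r_ge0 r_sum1 zs lamR (wR_ge0 om)) _.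
pose G z := if (0 < kmin z)%N then (omega z)%:R ^+ 2 * collision om z else 0.
have GE : noise om = \sum_z G z by rewrite /noise big_mkcond.
have G0 z : 0 <= G z.
  by rewrite /G; case: ifP => // _; rewrite mulr_ge0 ?sqr_ge0 ?collision_ge0.
(* Under the square root the quantities of one bin are replaced by the totals, so that the root
   becomes a common factor of the sum. *)
apply: (@le_trans _ _ (\sum_z (512 * G z + 128 * bin_signal om z +
   16 * Num.sqrt (8 * noise om + 2 * M om) * bin_signal om z))); last first.
  rewrite !big_split /= -!mulr_sumr -GE //.
apply: ler_sum => z _.
have [k0|k0] := posnP (kmin z).
  have -> : (npairs zs (block 0) (block 1) z)%:R * (npairs zs (block 2) (block 3) z)%:R = 0 :> R.
    by rewrite kmin_kmaxM k0 mul0r.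
  rewrite mul0r add0r (_ : _ + _ = 0 :> R); last first.
    rewrite !expr2 mulrA kmin_kmaxM k0 mul0r mul0r -mulrA kmin_kmaxM k0 mul0r mulr0 addr0 //.
  rewrite mul0r mulr0; have b0 := bin_signal_ge0 om z; have g0 := G0 z.
  by apply: addr_ge0; [apply: addr_ge0|]; repeat apply: mulr_ge0; rewrite ?sqrtr_ge0 ?signal_ge0.
have [lamU lamL] := lamR_bounds k0.
apply: le_trans (bin_variance_bound (F := collision om z) (G := G z) (M := bin_signal om z)
  _ _ _ (kmin_kmaxM z) (kmin_kmaxD z) _ lamU lamL _ _ _ _ _ _) _ => //.
- by rewrite ler1n.
- by rewrite -natrM ler_nat omega_le.
- by rewrite ler_nat kmin_le_kmax.
- by apply: sumr_ge0 => u _; exact: sqr_ge0.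
- exact: collision_ge0.
- exact: signal_ge0.
- by apply: energy_le => // u; [exact: wR_ge0|exact: wR_le1].
- by rewrite /G k0.
rewrite lerD2l ler_wpM2r ?bin_signal_ge0 // ler_pM2l // ler_wsqrtr //.
apply: lerD; rewrite ler_pM2l // ?GE.
  by rewrite (bigD1 z) //= lerDl; apply: sumr_ge0.
by rewrite /Amean (bigD1 z) //= lerDl; apply: sumr_ge0 => *; exact: bin_signal_ge0.
Qed.

Lemma collisionE om z : collision om z =
  (\sum_x (w1 om z x * marg1 (r z) x) ^+ 2) * (\sum_y (w2 om z y * marg2 (r z) y) ^+ 2).
Proof.
rewrite /collision sum_pair mulr_suml; apply: eq_bigr => x _; rewrite mulr_sumr.
by apply: eq_bigr => y _; rewrite /wR /indep_law /=; ring.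
Qed.

Lemma marg1E z x : marg1 (r z) x = \sum_(s | s.1 == x) r z s.
Proof.
rewrite /marg1; transitivity (\sum_(x' | x' == x) \sum_y r z (x', y)).
  by rewrite big_pred1_eq.
rewrite pair_big /=.
by apply: eq_big => [[a b]|[a b]] //=; rewrite andbT.
Qed.

Lemma marg2E z y : marg2 (r z) y = \sum_(s | s.2 == y) r z s.
Proof.
rewrite /marg2; transitivity (\sum_x \sum_(y' | y' == y) r z (x, y')).
  by apply: eq_bigr => x _; rewrite big_pred1_eq.
by rewrite pair_big /=; apply: eq_big => [[a b]|[a b]].
Qed.

(** [collision] is the product of an X part reading block 4 and a Y part reading block 5, two
    independent factors with means at most 12 over a successor. The square of [omega] is at most the
    product of these successors, which leaves 12 * 12. *)
Lemma mean_collision z : (0 < kmin z)%N ->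
  Ex mu (fun om => (omega z)%:R ^+ 2 * collision om z) <= 144.
Proof.
move=> k0; rewrite ExZ.
under eq_Ex do rewrite collisionE.
pose fx (om : Om) := \sum_x (w1 om z x * marg1 (r z) x) ^+ 2.
pose fy (om : Om) := \sum_y (w2 om z y * marg2 (r z) y) ^+ 2.
have hits_dep (T : finType) b (pr : X * Y -> T) (om om' : Om) t :
    (forall i : 'I_6 * 'I_m, i.1 == b -> om i = om' i) ->
    hits zs b z pr om t = hits zs b z pr om' t.
  by move=> e; apply: eq_card => i; rewrite !inE (e (b, i)).
have depx : depends_on (fun i : 'I_6 * 'I_m => i.1 == block 4) fx.
  move=> om om' e; apply: eq_bigr => x _.
  by rewrite /w1 /wN1 (hits_dep _ _ _ _ _ _ e).
have depy : depends_on (fun i : 'I_6 * 'I_m => i.1 == block 5) fy.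
  move=> om om' e; apply: eq_bigr => x _.
  by rewrite /w2 /wN2 (hits_dep _ _ _ _ _ _ e).
have mu1 i : \sum_v mu i v = 1 by exact: r_sum1.
have -> : Ex mu (fun om => fx om * fy om) = Ex mu fx * Ex mu fy.
  by apply: (indep_disjoint mu1 depx depy) => i /eqP ->.
have hx : Ex mu fx <= 12 / (minn (occ zs (block 4) z) #|X|).+1%:R.
  apply: le_trans (flattened_collision (b := block 4) (z := z) (pr := @fst X Y) r_ge0 r_sum1 X0
    (wt := fun om x => w1 om z x) _) => [|om x]; last by case: (w1_bounds om z x).
  rewrite le_eqVlt; apply/orP; left; apply/eqP; apply: eq_Ex => om; apply: eq_bigr => x _.
  by rewrite marg1E.
have hy : Ex mu fy <= 12 / (minn (occ zs (block 5) z) #|Y|).+1%:R.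
  apply: le_trans (flattened_collision (b := block 5) (z := z) (pr := @snd X Y) r_ge0 r_sum1 Y0
    (wt := fun om x => w2 om z x) _) => [|om x]; last by case: (w2_bounds om z x).
  rewrite le_eqVlt; apply/orP; left; apply/eqP; apply: eq_Ex => om; apply: eq_bigr => x _.
  by rewrite marg2E.
set a := (minn _ #|X|).+1 in hx; set b := (minn _ #|Y|).+1 in hy.
have Ex0 : 0 <= Ex mu fx.
  by apply: Ex_ge0 => [i v|om]; [exact: r_ge0|apply: sumr_ge0 => *; exact: sqr_ge0].
have Ey0 : 0 <= Ex mu fy.
  by apply: Ex_ge0 => [i v|om]; [exact: r_ge0|apply: sumr_ge0 => *; exact: sqr_ge0].
have om2 : (omega z)%:R ^+ 2 <= a%:R * b%:R :> R.
  rewrite -natrX -natrM ler_nat; apply: leq_trans (isqrt_le _) _.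
  by apply: leq_mul; rewrite ltnS; apply: geq_minl.
apply: (@le_trans _ _ ((a%:R * b%:R) * ((12 / a%:R) * (12 / b%:R)))).
  by apply: ler_pM; rewrite ?sqr_ge0 ?mulr_ge0 //; apply: ler_pM.
rewrite le_eqVlt; apply/orP; left; apply/eqP; field.
by rewrite !pnatr_eq0.
Qed.

Lemma mean_noise : Ex mu noise <= 144 * (minn #|Z| m)%:R.
Proof.
rewrite /noise Ex_sum; apply: (@le_trans _ _ (\sum_(z | (0 < kmin z)%N) 144)).
  by apply: ler_sum => z; exact: mean_collision.
by rewrite sumr_const -[_ *+ #|_|]mulr_natr ler_pM2l // ler_nat card_active.
Qed.

Definition dep z : R := \sum_u `|r z u - indep_law (r z) u|.

(** Cauchy-Schwarz with the unrounded weights and their inverses, whose sum is at most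
    [(2 * #|X|%:R) * (2 * #|Y|%:R)] by [shrink_inv_sum]. Rounding loses a factor 4, which the factor
    2 in each [nu] gives back. *)
Lemma signal_lb om z : dep z ^+ 2 <= 4 * (#|X|%:R * #|Y|%:R) * signal r (wR om) z.
Proof.
pose s1 x := shrink R zs (block 4) z (@fst X Y) #|X| om x.
pose s2 y := shrink R zs (block 5) z (@snd X Y) #|Y| om y.
have s1p x : 0 < s1 x.
  rewrite divr_gt0 // ltr0n ?addn_gt0 leq_max X0 orbT //.
have s2p y : 0 < s2 y.
  rewrite divr_gt0 // ltr0n ?addn_gt0 leq_max Y0 orbT //.
have -> : 4 * (#|X|%:R * #|Y|%:R) * signal r (wR om) z =
    signal r (wR om) z * ((2 * #|X|%:R) * (2 * #|Y|%:R)) by ring.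
apply: (@le_trans _ _ ((\sum_u s1 u.1 * s2 u.2 * (r z u - indep_law (r z) u) ^+ 2) *
    (\sum_u (s1 u.1 * s2 u.2)^-1))).
  apply: weighted_cauchy_schwarz => u _.
  - by rewrite mulr_ge0 ?sqr_ge0 // mulr_ge0 // ltW.
  - by rewrite invr_ge0 mulr_ge0 // ltW.
  - rewrite real_normK ?num_real // mulrAC divff ?mul1r //.
    by rewrite mulf_neq0 // gt_eqF.
apply: ler_pM.
- by apply: sumr_ge0 => u _; rewrite mulr_ge0 ?sqr_ge0 // mulr_ge0 // ltW.
- by apply: sumr_ge0 => u _; rewrite invr_ge0 mulr_ge0 // ltW.
- apply: ler_sum => u _.
  have -> : wR om z u * nu (r z) u * nu (r z) u =
    (4 * wR om z u) * (r z u - indep_law (r z) u) ^+ 2 by rewrite /nu; ring.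
  apply: ler_wpM2r; rewrite ?sqr_ge0 //.
  have [/andP[a0 _] a] := w1_bounds om z u.1; have [/andP[b0 _] b] := w2_bounds om z u.2.
  have -> : 4 * wR om z u = (2 * w1 om z u.1) * (2 * w2 om z u.2) by rewrite /wR; ring.
  by apply: ler_pM => //; exact: ltW.
- have -> : \sum_u (s1 u.1 * s2 u.2)^-1 = (\sum_x (s1 x)^-1) * (\sum_y (s2 y)^-1).
    rewrite sum_pair mulr_suml; apply: eq_bigr => x _; rewrite mulr_sumr.
    by apply: eq_bigr => y _; rewrite invfM.
  apply: ler_pM.
  + by apply: sumr_ge0 => x _; rewrite invr_ge0 ltW.
  + by apply: sumr_ge0 => x _; rewrite invr_ge0 ltW.
  + exact: shrink_inv_sum.
  + exact: shrink_inv_sum.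
Qed.

Lemma Amean_lb om :
  \sum_z (kmin z)%:R * (omega z)%:R * dep z ^+ 2 <= 8 * (#|X|%:R * #|Y|%:R) * M om.
Proof.
rewrite /Amean mulr_sumr; apply: ler_sum => z _.
have [k0|k0] := posnP (kmin z).
  by rewrite k0 !mul0r; apply: mulr_ge0; [rewrite !mulr_ge0|exact: (bin_signal_ge0 om z)].
have K0 := leq_trans k0 (kmin_le_kmax z).
have [_ lamL] := lamR_bounds k0; have sig := signal_lb om z.
rewrite (_ : lamR z * _ * _ * _ = lamR z * (kmax z)%:R * ((kmin z)%:R * signal r (wR om) z)); last first.
  by rewrite -(mulrA (lamR z)) kmin_kmaxM; ring.
have h : (omega z)%:R <= 2 * (lamR z * (kmax z)%:R).
  by rewrite mulrA -ler_pdivrMr // ltr0n.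
apply: (@le_trans _ _ ((kmin z)%:R * (omega z)%:R * (4 * (#|X|%:R * #|Y|%:R) * signal r (wR om) z))).
  by rewrite ler_wpM2l // mulr_ge0.
have p : 0 <= 4 * (#|X|%:R * #|Y|%:R) * ((kmin z)%:R * signal r (wR om) z).
  by rewrite !mulr_ge0 ?signal_ge0.
have := ler_wpM2r p h; nra.
Qed.

End BinWeights.

(** * Error probabilities conditional on the Z-coordinates *)

Section ConditionalErrors.
Variables (R : realType) (X Y Z : finType) (m : nat).
Variable zs : {ffun 'I_6 * 'I_m -> Z}.
Variables (r : Z -> X * Y -> R).
Hypothesis r_ge0 : forall z s, 0 <= r z s.
Hypothesis r_sum1 : forall z, \sum_s r z s = 1.
Hypotheses (X0 : (0 < #|X|)%N) (Y0 : (0 < #|Y|)%N) (Z0 : (0 < #|Z|)%N) (m0 : (0 < m)%N).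
Let mu (i : 'I_6 * 'I_m) : X * Y -> R := r (zs i).
Let mu_ge0 i v : 0 <= mu i v. Proof. exact: r_ge0. Qed.
Let mu_sum1 i : \sum_v mu i v = 1. Proof. exact: r_sum1. Qed.

Definition Atot (om : {ffun 'I_6 * 'I_m -> X * Y}) : R :=
  Astat zs (lamR X Y zs R) (wR zs R om) om om.

Definition threshold : R := 10 ^+ 3 * (isqrt (minn #|Z| m))%:R.

Lemma Atot_decouple (h : R -> R) : Ex mu (fun om => h (Atot om)) =
  Ex mu (fun om3 => Ex mu (fun om2 => Ex mu (fun om1 =>
    h (Astat zs (lamR X Y zs R) (wR zs R om3) om1 om2)))).
Proof.
apply: (Ex_decouple3 mu_sum1
  (A := fun i => (i.1 == block 0) || (i.1 == block 1))
  (B := fun i => (i.1 == block 2) || (i.1 == block 3))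
  (f := fun om1 om2 om3 => h (Astat zs (lamR X Y zs R) (wR zs R om3) om1 om2))).
- by move=> i /orP[]/eqP ->.
- move=> w2 w3 om om' e; congr h; apply: eq_bigr => p _; apply: eq_bigr => q _.
  by rewrite !e.
- move=> w1 w3 om om' e; congr h; apply: eq_bigr => p _; apply: eq_bigr => q _.
  by rewrite !e.
- move=> v1 v2 om om' e; congr h; apply: eq_bigr => p _; apply: eq_bigr => q _.
  have hits_eq (T : finType) b (pr : X * Y -> T) z t : (b == block 4) || (b == block 5) ->
      hits zs b z pr om t = hits zs b z pr om' t.
    by move=> hb; apply: eq_card => i; rewrite !inE (e (b, i)) //; case/orP: hb => /eqP ->.
  congr (_ * _); apply: eq_bigr => u _.
  by rewrite /wR /w1 /w2 /wN1 /wN2 !hits_eq.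
Qed.

Local Notation c := (minn #|Z| m).

Let c0 : (0 < c)%N. Proof. by rewrite leq_min Z0 m0. Qed.

Lemma threshold_gt0 : 0 < threshold.
Proof. by rewrite mulr_gt0 ?exprn_gt0 ?ltr0n ?isqrt_gt0. Qed.

Lemma null_error : (forall z u, nu (r z) u = 0) ->
  Ex mu (fun om => (threshold < Atot om)%R%:R) <= 1 / 3.
Proof.
move=> nu0; set t := threshold; have t0 : 0 < t := threshold_gt0.
have M0 om : Amean r zs (lamR X Y zs R) (wR zs R om) = 0.
  apply: big1 => z _; rewrite /signal /ip big1 ?mulr0 // => u _.
  by rewrite nu0 mulr0.
apply: (@le_trans _ _ (Ex mu (fun om => t ^- 2 * Atot om ^+ 2))).
  apply: le_Ex => // om; case: (ltP t (Atot om)) => /= h; last by rewrite mulr_ge0 ?invr_ge0 ?sqr_ge0.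
  rewrite mulrC ler_pdivlMr ?exprn_gt0 // mul1r ler_sqr ?nnegrE; lra.
rewrite (Atot_decouple (fun a => t ^- 2 * a ^+ 2)).
apply: (@le_trans _ _ (Ex mu (fun om => t ^- 2 * 512 * noise zs r om))).
  apply: le_Ex => // om3; rewrite -mulrA.
  have := conditional_variance zs r_ge0 r_sum1 X0 Y0 om3.
  rewrite M0 !mulr0 !addr0 => h.
  under eq_Ex do rewrite ExZ.
  rewrite ExZ ler_wpM2l ?invr_ge0 ?sqr_ge0 //; apply: le_trans h.
  by apply: le_Ex => // om2; apply: le_Ex => // om1; rewrite subr0.
rewrite ExZ mulrAC -mulrA [leLHS]mulrC ler_pdivrMr ?exprn_gt0 //.
have hn := mean_noise zs r_ge0 r_sum1 X0 Y0.
(* [isqrt] loses at most a factor 4 in the square, and 3 * 512 * 144 = 221184 stays below 250000;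
   this fixes the factor 1000 of [threshold]. *)
have ht : 250 * 1000 * c%:R <= t ^+ 2.
  rewrite /t /threshold exprMn -[(isqrt _)%:R ^+ 2]natrX.
  have : (c%:R : R) <= (4 * isqrt c ^ 2)%:R by rewrite ler_nat isqrt_ge.
  by rewrite natrM; lra.
by have := ltr0n R c; rewrite c0; lra.
Qed.

(** The mixed term is the critical one: [M] being at least 10^7 makes the root at most M / 2000,
    hence the term at most M^2 / 125. The bound M^2 / 120 becomes 1/30 after Chebyshev at distance M
    / 2. *)
Lemma deviation_numeric (n M q : R) : 1 <= q -> 0 <= n -> 10 ^+ 7 * q <= M ->
  n <= 1440 * q ^+ 2 ->
  512 * n + 128 * M + 16 * Num.sqrt (8 * n + 2 * M) * M <= M ^+ 2 / 120.
Proof.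
move=> q1 n0 Mq nq.
have q2 : q ^+ 2 <= M ^+ 2 / 10 ^+ 14.
  have -> : 10 ^+ 14 = (10 ^+ 7) ^+ 2 :> R by rewrite -exprM.
  by rewrite ler_pdivlMr ?exprn_gt0 // -exprMn ler_sqr ?nnegrE; lra.
have M1 : 10 ^+ 7 * M <= M ^+ 2.
  by rewrite expr2 ler_wpM2r //; lra.
have M0 : 0 <= M by lra.
set sq := Num.sqrt _.
have sq0 : 0 <= sq by exact: sqrtr_ge0.
have s : 2 * 10 ^+ 3 * sq <= M.
  rewrite -ler_sqr ?nnegrE //; last by rewrite mulr_ge0 // mulr_ge0 // exprn_ge0.
  rewrite exprMn sqr_sqrtr; last by rewrite addr_ge0 // mulr_ge0.
  by move: (M ^+ 2) q2 M1 => M2 q2 M1; lra.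
have : 2 * 10 ^+ 3 * (sq * M) <= M ^+ 2 by rewrite mulrA expr2 ler_wpM2r.
rewrite -(mulrA 16); move: (M ^+ 2) q2 M1 (sq * M) => M2 q2 M1 sM.
by lra.
Qed.

(** By Markov the noise exceeds ten times the bound of [mean_noise] with probability at most 1/10;
    otherwise Chebyshev fails with probability at most 1/30. In the hypothesis, the factor 8 is lost
    in [Amean_lb] and 10^7 is what [deviation_numeric] asks for. *)
Lemma alt_error :
  8 * 10 ^+ 7 * (#|X|%:R * #|Y|%:R) * Num.sqrt c%:R <=
    \sum_z (kmin zs z)%:R * (omega X Y zs z)%:R * dep r z ^+ 2 ->
  Ex mu (fun om => (Atot om <= threshold)%R%:R) <= 2 / 15.
Proof.
move=> big; set t := threshold; have t0 : 0 < t := threshold_gt0.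
pose q : R := Num.sqrt c%:R.
have q2 : q ^+ 2 = c%:R by rewrite sqr_sqrtr.
have q1 : 1 <= q by rewrite -[leLHS]sqrtr1 ler_wsqrtr // ler1n.
have tq : t <= 10 ^+ 3 * q.
  rewrite ler_pM2l ?exprn_gt0 // -ler_sqr ?nnegrE ?sqrtr_ge0 // q2 -[(isqrt _)%:R ^+ 2]natrX ler_nat.
  exact: isqrt_le.
have Mq om : 10 ^+ 7 * q <= Amean r zs (lamR X Y zs R) (wR zs R om).
  have h := Amean_lb zs r X0 Y0 om.
  have p : 0 < 8 * (#|X|%:R * #|Y|%:R) :> R by rewrite !mulr_gt0 // ltr0n.
  rewrite -(ler_pM2l p); apply: le_trans h; apply: le_trans big.
  by rewrite le_eqVlt; apply/orP; left; apply/eqP; rewrite /q; ring.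
rewrite (Atot_decouple (fun a => (a <= t)%R%:R)).
apply: (@le_trans _ _ (Ex mu (fun om => (1440 * c%:R <= noise zs r om)%R%:R + 1 / 30))).
  apply: le_Ex => // om3.
  set M := Amean r zs (lamR X Y zs R) (wR zs R om3) in Mq *.
  case: (lerP (1440 * c%:R) (noise zs r om3)) => h /=.
    apply: (@le_trans _ _ 1); last by lra.
    apply: Ex_le_cst => // om2; apply: Ex_le_cst => // om1.
    by rewrite lern1 leq_b1.
  have Mqq : 10 ^+ 7 * q <= M := Mq om3.
  have V := conditional_variance zs r_ge0 r_sum1 X0 Y0 om3.
  have nn := noise_ge0 zs r om3.
  have num := deviation_numeric q1 nn Mqq.
  rewrite q2 in num; have {}num := num (ltW h).
  have {}V := le_trans V num.
  have M0 : 0 < M by lra.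
  apply: (@le_trans _ _ (Ex mu (fun om2 => Ex mu (fun om1 =>
     4 / M ^+ 2 * (Astat zs (lamR X Y zs R) (wR zs R om3) om1 om2 - M) ^+ 2)))).
    apply: le_Ex => // om2; apply: le_Ex => // om1.
    set a := Astat _ _ _ _ _; case: (lerP a t) => /= le; last first.
      by rewrite mulr_ge0 ?sqr_ge0 // divr_ge0 // sqr_ge0.
    rewrite mulrAC ler_pdivlMr ?exprn_gt0 // mul1r.
    have : M / 2 <= M - a by lra.
    move=> h1; have : (M / 2) ^+ 2 <= (M - a) ^+ 2 by rewrite ler_sqr ?nnegrE; lra.
    by rewrite expr_div_n; lra.
  under eq_Ex do rewrite ExZ.
  rewrite ExZ.
  have p : 0 <= 4 / M ^+ 2 by rewrite divr_ge0 // sqr_ge0.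
  apply: le_trans (ler_wpM2l p V) _.
  rewrite add0r le_eqVlt; apply/orP; left; apply/eqP; field.
  by rewrite gt_eqF.
rewrite ExD Ex_cst //.
have cp : 0 < c%:R :> R by rewrite ltr0n.
have c00 : 0 < 1440 * c%:R :> R by lra.
have := Ex_markov mu_ge0 c00 (noise_ge0 zs r).
have hn := mean_noise zs r_ge0 r_sum1 X0 Y0.
have : Ex mu (noise zs r) / (1440 * c%:R) <= 1 / 10.
  by rewrite ler_pdivrMr; lra.
lra.
Qed.

End ConditionalErrors.

(** * The Z-coordinates *)

Section Occupancy.
Variables (Z : finType) (m : nat) (zs : {ffun 'I_6 * 'I_m -> Z}).

Lemma rank_lt_occ b i : (rank zs b i < occ zs b (zs (b, i)))%N.
Proof.
apply: proper_card; apply/fintype.properP; split.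
  by apply/fintype.subsetP => k; rewrite !inE => /andP[_ ->].
by exists i; rewrite !inE ?ltnn ?eqxx.
Qed.

Lemma rank_onto b z k : (k < occ zs b z)%N -> exists i, zs (b, i) = z /\ rank zs b i = k.
Proof.
move=> lt; pose f (i : 'I_m) : 'I_(occ zs b z) := insubd (Ordinal lt) (rank zs b i).
have fE i : zs (b, i) = z -> val (f i) = rank zs b i.
  by move=> e; have := rank_lt_occ b i; rewrite e /f val_insubd => ->.
have inj : {in [pred i | zs (b, i) == z] &, injective f}.
  move=> i j; rewrite !inE => /eqP ei /eqP ej /(congr1 val); rewrite !fE // => e.
  by apply: (rank_inj _ e); rewrite ei ej.
have : Ordinal lt \in [seq f i | i in [pred i | zs (b, i) == z]].
  have -> : [seq f i | i in [pred i | zs (b, i) == z]] =i 'I_(occ zs b z).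
    apply/subset_cardP; last by apply/fintype.subsetP.
    by rewrite (card_in_image inj) card_ord.
  by [].
by case/mapP => i; rewrite mem_enum inE => /eqP ei e; exists i; rewrite -fE // -e.
Qed.

(** The ranks in a bin fill an initial segment, so every number below both counts is a rank in both
    blocks and makes a pair. *)
Lemma npairs_ge a b z : (minn (occ zs a z) (occ zs b z) <= npairs zs a b z)%N.
Proof.
set k := minn _ _.
have ex (j : 'I_k) : exists p : 'I_m * 'I_m,
    [&& zs (a, p.1) == z, zs (b, p.2) == z, rank zs a p.1 == j & rank zs b p.2 == j].
  have := ltn_ord j; rewrite /k leq_min => /andP[/rank_onto [i [e1 e2]] /rank_onto [i' [e3 e4]]].
  by exists (i, i'); rewrite /= e1 e2 e3 e4 !eqxx.
pose f j := xchoose (ex j).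
have inj : injective f.
  move=> j j' e; have /and4P[_ _ /eqP h _] := xchooseP (ex j).
  have /and4P[_ _ /eqP h' _] := xchooseP (ex j').
  by apply: val_inj; rewrite /= -h -h' -/(f j) -/(f j') e.
rewrite -[leqLHS]card_ord -(fintype.card_image inj); apply: subset_leq_card.
apply/fintype.subsetP => p /mapP[j _ ->]; rewrite inE /matched.
by have /and4P[/eqP h1 /eqP h2 /eqP h3 /eqP h4] := xchooseP (ex j); rewrite h1 h2 h3 h4 !eqxx.
Qed.

Lemma kmin_ge z : (minn (minn (occ zs (block 0) z) (occ zs (block 1) z))
  (minn (occ zs (block 2) z) (occ zs (block 3) z)) <= kmin zs z)%N.
Proof.
rewrite /kmin leq_min; apply/andP; split; apply: leq_trans (npairs_ge _ _ _).
  exact: geq_minl.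
exact: geq_minr.
Qed.

End Occupancy.

(** * Bin counts under independent draws of the Z-coordinates *)

Section OccupancyLaw.
Variables (R : realType) (Z : finType) (m : nat) (p : Z -> R).
Hypothesis p_ge0 : forall z, 0 <= p z.
Hypothesis p_sum1 : \sum_z p z = 1.
Let mu (i : 'I_6 * 'I_m) : Z -> R := p.
Let mu_ge0 i v : 0 <= mu i v. Proof. exact: p_ge0. Qed.
Let mu_sum1 i : \sum_v mu i v = 1. Proof. exact: p_sum1. Qed.
Local Notation Om := {ffun 'I_6 * 'I_m -> Z}.

Lemma p_le1 z : p z <= 1.
Proof. by rewrite -p_sum1 (bigD1 z) //= lerDl; apply: sumr_ge0 => *; exact: p_ge0. Qed.

Lemma occE (zs : Om) b z :
  (occ zs b z)%:R = \sum_(i : 'I_6 * 'I_m | i.1 == b) (zs i == z)%:R :> R.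
Proof.
have := sum_block (m := m) b predT (fun i => (zs i == z)%:R : R).
under eq_bigl do rewrite andbT; move=> ->.
by rewrite /occ -sum1_card natr_sum big_mkcond; apply: eq_bigr => i _; rewrite inE; case: eqP.
Qed.

Lemma card_block_all b : #|[pred i : 'I_6 * 'I_m | i.1 == b]| = m.
Proof.
have := sum_block (m := m) b predT (fun i => 1%N).
rewrite -sum1_card; under [X in X = _ -> _]eq_bigl do rewrite andbT.
by move=> ->; rewrite sum1_card card_ord.
Qed.

Lemma occ_tail b z : 0 < m%:R * p z ->
  Ex mu (fun zs => ((occ zs b z)%:R < m%:R * p z / 2)%R%:R) <= 4 / (m%:R * p z).
Proof.
rewrite -[in m%:R * p z](card_block_all b) => pos.
have h : forall i : 'I_6 * 'I_m, i.1 == b -> \sum_(v | v == z) mu i v = p z.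
  by move=> i _; rewrite big_pred1_eq.
have := count_lower_tail mu_ge0 mu_sum1 (J := [pred i | i.1 == b]) (P := fun _ v => v == z) h pos.
rewrite card_block_all; apply: le_trans; apply: le_Ex => // zs.
by rewrite occE.
Qed.

Definition hit (zs : Om) b z : R := (0 < occ zs b z)%N%:R.

Lemma hitE zs b z : hit zs b z = 1 - \prod_(i : 'I_6 * 'I_m | i.1 == b) (zs i != z)%:R.
Proof.
rewrite /hit; case: posnP => [h|/card_gt0P [i]].
  rewrite big1 ?subrr // => -[b' i] /eqP /= ->.
  by have := card0_eq h i; rewrite !inE => ->.
rewrite inE => /eqP e; rewrite (bigD1 (b, i)) /= ?eqxx // e eqxx /= mul0r subr0 //.
Qed.

Definition phit z : R := 1 - (1 - p z) ^+ m.

Lemma sum_neq z : \sum_v p v * (v != z)%:R = 1 - p z.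
Proof.
rewrite -[X in _ = X - _]p_sum1 (bigD1 z) //= eqxx mulr0 add0r [X in _ = X - _](bigD1 z) //= addrAC subrr add0r.
by apply: eq_bigr => v ->; rewrite mulr1.
Qed.

Lemma mean_miss b z : Ex mu (fun zs => \prod_(i | i.1 == b) (zs i != z)%:R) = (1 - p z) ^+ m.
Proof.
rewrite (Ex_fst mu_sum1 (fun i => i.1 == b) (fun _ v => (v != z)%:R)).
rewrite (eq_bigr (fun _ => 1 - p z)) => [|i _]; last exact: sum_neq.
by rewrite prodr_const card_block_all.
Qed.

Lemma mean_hit b z : Ex mu (fun zs => hit zs b z) = phit z.
Proof. by under eq_Ex do rewrite hitE; rewrite ExB Ex_cst // mean_miss. Qed.

(** Negative correlation for a fixed number of draws: both bins are missed with probability (1 - p -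
    p')^m, which is at most (1 - p)^m (1 - p')^m. *)
Lemma mean_hit2 b z z' : z != z' ->
  Ex mu (fun zs => hit zs b z * hit zs b z') <= phit z * phit z'.
Proof.
move=> zz'.
have -> : Ex mu (fun zs => hit zs b z * hit zs b z') =
   1 - (1 - p z) ^+ m - (1 - p z') ^+ m + (1 - p z - p z') ^+ m.
  have -> : (1 - p z - p z') ^+ m = Ex mu (fun zs => \prod_(i | i.1 == b)
     ((zs i != z)%:R * (zs i != z')%:R)).
    rewrite (Ex_fst mu_sum1 (fun i => i.1 == b) (fun _ v => (v != z)%:R * (v != z')%:R)).
    rewrite (eq_bigr (fun _ => 1 - p z - p z')) => [|i _].
      by rewrite prodr_const card_block_all.
    rewrite -sum_neq; apply/eqP; rewrite eq_sym subr_eq; apply/eqP.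
    rewrite (bigD1 z') //= [in RHS](bigD1 z') //= eqxx (eq_sym z') zz' mulr1 !mulr0 add0r addrC.
    by congr (_ + _); apply: eq_bigr => v ->; rewrite mulr1.
  rewrite -!(mean_miss b) -[X in X - _ - _](Ex_cst mu_sum1) -!ExB -ExD; apply: eq_Ex => zs.
  by rewrite !hitE big_split /=; ring.
have h : (1 - p z - p z') ^+ m <= ((1 - p z) * (1 - p z')) ^+ m.
  have pp : p z + p z' <= 1.
    rewrite -p_sum1 (bigD1 z) //= lerD2l (bigD1 z') /= 1?eq_sym // lerDl.
    by apply: sumr_ge0 => *; exact: p_ge0.
  have := p_ge0 z; have := p_ge0 z' => h1 h2.
  by apply: lerXn2r; rewrite ?nnegrE; nra.
by rewrite /phit; rewrite exprMn in h; move: h; nra.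
Qed.

Lemma hit_dep b z : depends_on (fun i : 'I_6 * 'I_m => i.1 == b) (fun zs => hit zs b z).
Proof.
by move=> zs zs' e; rewrite !hitE; congr (1 - _); apply: eq_bigr => i /e ->.
Qed.

Lemma phit_ge0 z : 0 <= phit z.
Proof.
rewrite subr_ge0 exprn_ile1 ?subr_ge0 ?p_le1 // lerBlDr lerDl; exact: p_ge0.
Qed.

Definition hit4 zs z : R :=
  hit zs (block 0) z * (hit zs (block 1) z * (hit zs (block 2) z * hit zs (block 3) z)).

Lemma mean_block4 (f : 'I_6 -> Om -> R) :
  (forall b, depends_on (fun i : 'I_6 * 'I_m => i.1 == b) (f b)) ->
  Ex mu (fun zs => f (block 0) zs * (f (block 1) zs * (f (block 2) zs * f (block 3) zs))) =
  Ex mu (f (block 0)) * (Ex mu (f (block 1)) * (Ex mu (f (block 2)) * Ex mu (f (block 3)))).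
Proof.
move=> dep.
rewrite (indep_disjoint mu_sum1 (dep (block 0)) (g := fun zs => f (block 1) zs * (f (block 2) zs * f (block 3) zs))
  (S' := fun i => i.1 != block 0)); first last.
- by move=> i /eqP ->.
- move=> zs zs' e; congr (_ * (_ * _)); apply: dep => i /eqP h; apply: e; by rewrite h.
rewrite (indep_disjoint mu_sum1 (dep (block 1)) (g := fun zs => f (block 2) zs * f (block 3) zs)
  (S' := fun i => i.1 != block 1)); first last.
- by move=> i /eqP ->.
- move=> zs zs' e; congr (_ * _); apply: dep => i /eqP h; apply: e; by rewrite h.
by rewrite (indep_disjoint mu_sum1 (dep (block 2)) (dep (block 3))) // => i /eqP ->.
Qed.

Lemma mean_hit4 z : Ex mu (fun zs => hit4 zs z) = phit z ^+ 4.
Proof.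
rewrite (mean_block4 (f := fun b zs => hit zs b z)) => [|b]; last exact: hit_dep.
by rewrite !mean_hit; ring.
Qed.

Lemma mean_hit4_2 z z' : z != z' ->
  Ex mu (fun zs => hit4 zs z * hit4 zs z') <= phit z ^+ 4 * phit z' ^+ 4.
Proof.
move=> zz'.
have -> : Ex mu (fun zs => hit4 zs z * hit4 zs z') = Ex mu (fun zs =>
   let f b := hit zs b z * hit zs b z' in
   f (block 0) * (f (block 1) * (f (block 2) * f (block 3)))).
  by apply: eq_Ex => zs; rewrite /hit4 /=; ring.
rewrite /= (mean_block4 (f := fun b zs => hit zs b z * hit zs b z')); last first.
  by move=> b zs zs' e; rewrite (hit_dep z e) (hit_dep z' e).
have g0 b : 0 <= Ex mu (fun zs => hit zs b z * hit zs b z').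
  by apply: Ex_ge0 => // zs; exact: mulr_ge0.
have -> : phit z ^+ 4 * phit z' ^+ 4 = (phit z * phit z') * ((phit z * phit z') *
  ((phit z * phit z') * (phit z * phit z'))) by ring.
apply: ler_pM; rewrite ?mulr_ge0 ?mean_hit2 //; apply: ler_pM; rewrite ?mulr_ge0 ?mean_hit2 //; apply: ler_pM; rewrite ?mulr_ge0 ?mean_hit2 //. 
Qed.

Lemma hit4_sqr zs z : hit4 zs z * hit4 zs z = hit4 zs z.
Proof. by rewrite /hit4 /hit; do 4![case: (0 < _)%N]; rewrite /= !(mulr1, mulr0, mul0r). Qed.

(** Since (1 - p)^m (1 + p)^m <= 1 and (1 + p)^m >= 1 + m p by Bernoulli, a bin with a = m p is
    missed with probability at most 1 / (1 + a). *)
Lemma phit_ge z A : m%:R * p z <= A -> m%:R * p z / (1 + A) <= phit z.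
Proof.
move=> leA; set a := m%:R * p z in leA *.
have a0 : 0 <= a by rewrite mulr_ge0.
have bern : 1 + a <= (1 + p z) ^+ m.
  rewrite /a; elim: (m) => [|k IH]; first by rewrite mul0r addr0 expr0.
  rewrite exprS -natr1 mulrDl mul1r; have := p_ge0 z => pz.
  have k0 : 0 <= k%:R :> R by [].
  have : (1 + p z) * (1 + k%:R * p z) <= (1 + p z) * (1 + p z) ^+ k.
    by apply: ler_wpM2l => //; lra.
  by have := mulr_ge0 k0 (mulr_ge0 pz pz); nra.
have miss : (1 - p z) ^+ m * (1 + a) <= 1.
  apply: (@le_trans _ _ ((1 - p z) ^+ m * (1 + p z) ^+ m)).
    by apply: ler_wpM2l => //; rewrite exprn_ge0 // subr_ge0 p_le1.
  rewrite -exprMn exprn_ile1 //; have := p_ge0 z; have := p_le1 z; nra.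
apply: (@le_trans _ _ (a / (1 + a))).
  by rewrite ler_wpM2l // lef_pV2 ?posrE; lra.
by rewrite ler_pdivrMr; rewrite /phit; nra.
Qed.

Variable e : Z -> R.
Hypothesis e_bd : forall z, 0 <= e z <= 2.

(** By negative correlation the off-diagonal part of the second moment is absorbed by [E ^+ 2]; the
    diagonal is at most 4 E because [hit4] is 0 or 1 and e^2 <= 4. Chebyshev at distance E / 2 gives
    16 / E. *)
Lemma light_concentration (P : pred Z) (t : R) :
  0 < t -> 2 * t <= \sum_(z | P z) e z ^+ 2 * phit z ^+ 4 ->
  Ex mu (fun zs => (\sum_(z | P z) e z ^+ 2 * hit4 zs z < t)%R%:R) <= 16 / (2 * t).
Proof.
move=> t0; set E := \sum_(z | P z) _ => tE.
pose Y zs := \sum_(z | P z) e z ^+ 2 * hit4 zs z.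
have EY : Ex mu Y = E.
  by rewrite /Y Ex_sum; apply: eq_bigr => z _; rewrite ExZ mean_hit4.
have V : Ex mu (fun zs => (Y zs - E) ^+ 2) <= 4 * E.
  have -> : Ex mu (fun zs => (Y zs - E) ^+ 2) = Ex mu (fun zs => Y zs ^+ 2) - E ^+ 2.
    have -> : Ex mu (fun zs => (Y zs - E) ^+ 2) = Ex mu (fun zs => Y zs ^+ 2 + ((- 2 * E) * Y zs + E ^+ 2)).
      by apply: eq_Ex => zs; ring.
    by rewrite ExD ExD ExZ Ex_cst // EY; ring.
  rewrite lerBlDr expr2 {2 3}/E big_distrlr /=.
  have -> : Ex mu (fun zs => Y zs ^+ 2) = \sum_(z | P z) \sum_(z' | P z')
     (e z ^+ 2 * e z' ^+ 2) * Ex mu (fun zs => hit4 zs z * hit4 zs z').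
    transitivity (Ex mu (fun zs => \sum_(z | P z) \sum_(z' | P z')
       (e z ^+ 2 * e z' ^+ 2) * (hit4 zs z * hit4 zs z'))).
      apply: eq_Ex => zs; rewrite expr2 big_distrlr /=; apply: eq_bigr => z _.
      by apply: eq_bigr => z' _; ring.
    rewrite Ex_sum; apply: eq_bigr => z _; rewrite Ex_sum; apply: eq_bigr => z' _.
    by rewrite ExZ.
  rewrite /E mulr_sumr -big_split /=; apply: ler_sum => z Pz.
  rewrite (bigD1 z) //= [in leRHS](bigD1 z) //= addrA; apply: lerD.
    under eq_Ex do rewrite hit4_sqr.
    rewrite mean_hit4; have /andP[e0 e2] := e_bd z.
    have h4 : 0 <= phit z ^+ 4 by rewrite exprn_ge0 // phit_ge0.
    have e4 : e z ^+ 2 <= 4 by nra.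
    have e20 := sqr_ge0 (e z).
    have : e z ^+ 2 * e z ^+ 2 * phit z ^+ 4 <= 4 * (e z ^+ 2 * phit z ^+ 4).
      by rewrite -mulrA; apply: ler_wpM2r e4; apply: mulr_ge0.
    by move=> h; apply: le_trans h _; rewrite lerDl; apply: mulr_ge0; apply: mulr_ge0.
  apply: ler_sum => z' /andP[_ zz'].
  rewrite (_ : _ * _ * (_ * _) = (e z ^+ 2 * e z' ^+ 2) * (phit z ^+ 4 * phit z' ^+ 4)); last by ring.
  apply: ler_wpM2l; first by apply: mulr_ge0; exact: sqr_ge0.
  by apply: mean_hit4_2; rewrite eq_sym.
have E0 : 0 < E by lra.
have c0 : 0 < (E / 2) ^+ 2 by rewrite exprn_gt0 // divr_gt0.
apply: (@le_trans _ _ (Ex mu (fun zs => ((E / 2) ^+ 2 <= (Y zs - E) ^+ 2)%R%:R))).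
  apply: le_Ex => // zs; rewrite -/(Y zs); case: (ltP (Y zs) t) => //= h.
  have -> : (E / 2) ^+ 2 <= (Y zs - E) ^+ 2 by rewrite -[leRHS]sqrrN ler_sqr ?nnegrE; lra.
  by [].
apply: le_trans (Ex_markov mu_ge0 c0 (fun zs => sqr_ge0 (Y zs - E))) _.
apply: (@le_trans _ _ (4 * E / (E / 2) ^+ 2)).
  by rewrite ler_wpM2r // invr_ge0 ltW.
apply: (@le_trans _ _ (16 / E)); last by rewrite ler_wpM2l // lef_pV2 ?posrE //; lra.
by rewrite le_eqVlt; apply/orP; left; apply/eqP; field; rewrite gt_eqF.
Qed.

End OccupancyLaw.

(** * The signal found in a typical sample *)

Section TypicalSignal.
Variables (R : realType) (X Y Z : finType) (m : nat) (p e : Z -> R) (eps : R).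
Hypothesis p_ge0 : forall z, 0 <= p z.
Hypothesis p_sum1 : \sum_z p z = 1.
Hypothesis e_bd : forall z, 0 <= e z <= 2.
Hypothesis far : 2 * eps <= \sum_z p z * e z.
Hypotheses (eps0 : 0 < eps) (m0 : (0 < m)%N) (Z0 : (0 < #|Z|)%N) (Y0 : (0 < #|Y|)%N)
  (leYX : (#|Y| <= #|X|)%N).

Let mu (i : 'I_6 * 'I_m) : Z -> R := p.
Let mu_ge0 i v : 0 <= mu i v. Proof. exact: p_ge0. Qed.
Let mu_sum1 i : \sum_v mu i v = 1. Proof. exact: p_sum1. Qed.
Local Notation Om := {ffun 'I_6 * 'I_m -> Z}.

Let l1 : R := #|X|%:R.
Let l2 : R := #|Y|%:R.
Let n : R := #|Z|%:R.
Let M : R := m%:R.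
Let c : R := (minn #|Z| m)%:R.
Let al z : R := M * p z.

Let X0 : (0 < #|X|)%N. Proof. exact: leq_trans Y0 leYX. Qed.
Let l10 : 0 < l1. Proof. by rewrite ltr0n. Qed.
Let l20 : 0 < l2. Proof. by rewrite ltr0n. Qed.
Let n0 : 0 < n. Proof. by rewrite ltr0n. Qed.
Let M0 : 0 < M. Proof. by rewrite ltr0n. Qed.
Let l21 : l2 <= l1. Proof. by rewrite ler_nat. Qed.
Let al0 z : 0 <= al z. Proof. by rewrite mulr_ge0 // ltW. Qed.

Definition total_signal (zs : Om) : R :=
  \sum_z (kmin zs z)%:R * (omega X Y zs z)%:R * e z ^+ 2.

Definition target : R := 8 * 10 ^+ 7 * (l1 * l2) * Num.sqrt c.

(** The size of [omega], up to constants, when all counts are near their mean [al z]. *)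
Let psi z : R := Num.sqrt (Num.min (al z) l1 * Num.min (al z) l2).

Let psi_gt0 z : 0 < al z -> 0 < psi z.
Proof. by move=> h; rewrite sqrtr_gt0 mulr_gt0 // lt_min h. Qed.

Let le_natr_min (a : R) (x y : nat) : a <= x%:R -> a <= y%:R -> a <= (minn x y)%:R.
Proof. by case: leqP. Qed.

Lemma heavy_bin (zs : Om) z : (forall b, al z / 2 <= (occ zs b z)%:R) ->
  al z * psi z <= 8 * ((kmin zs z)%:R * (omega X Y zs z)%:R).
Proof.
move=> h; have k : al z / 2 <= (kmin zs z)%:R.
  apply: le_trans (_ : _ <= (minn (minn (occ zs (block 0) z) (occ zs (block 1) z))
    (minn (occ zs (block 2) z) (occ zs (block 3) z)))%:R) _.
    by do 2![apply: le_natr_min].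
  by rewrite ler_nat kmin_ge.
have t1 : Num.min (al z) l1 / 2 <= (flat1 X zs z).+1%:R.
  apply: (@le_trans _ _ (flat1 X zs z)%:R); last by rewrite ler_nat.
  have ga : Num.min (al z) l1 <= al z by rewrite ge_min lexx.
  have gl : Num.min (al z) l1 <= l1 by rewrite ge_min lexx orbT.
  have gp : 0 <= Num.min (al z) l1 by rewrite le_min al0 ltW.
  apply: le_natr_min; [apply: le_natr_min|].
  - by apply: le_trans (h (block 4)); lra.
  - by rewrite -/l1; lra.
  - by apply: le_trans k; lra.
have t2 : Num.min (al z) l2 / 2 <= (flat2 Y zs z).+1%:R.
  apply: (@le_trans _ _ (flat2 Y zs z)%:R); last by rewrite ler_nat.
  have ga : Num.min (al z) l2 <= al z by rewrite ge_min lexx.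
  have gl : Num.min (al z) l2 <= l2 by rewrite ge_min lexx orbT.
  have gp : 0 <= Num.min (al z) l2 by rewrite le_min al0 ltW.
  apply: le_natr_min; [apply: le_natr_min|].
  - by apply: le_trans (h (block 5)); lra.
  - by rewrite -/l2; lra.
  - by apply: le_trans k; lra.
have m1 : 0 <= Num.min (al z) l1 by rewrite le_min al0 ltW.
have m2 : 0 <= Num.min (al z) l2 by rewrite le_min al0 ltW.
have om : psi z <= 4 * (omega X Y zs z)%:R.
  rewrite -ler_sqr ?nnegrE ?sqrtr_ge0 ?mulr_ge0 // sqr_sqrtr ?mulr_ge0 //.
  have := isqrt_ge ((flat1 X zs z).+1 * (flat2 Y zs z).+1).
  rewrite -(ler_nat R) !natrM -/(omega X Y zs z) exprMn expr2 (expr2 (omega _ _ _ _)%:R) => h4.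
  have : (Num.min (al z) l1 / 2) * (Num.min (al z) l2 / 2) <=
    (flat1 X zs z).+1%:R * (flat2 Y zs z).+1%:R by apply: ler_pM; rewrite ?divr_ge0.
  by move: ((omega X Y zs z)%:R * _) h4 => o2; lra.
have al2 : 0 <= al z / 2 by rewrite divr_ge0.
by have := ler_pM al2 (sqrtr_ge0 _ : 0 <= psi z) k om; lra.
Qed.

(** The summands are the cases al <= l2, l2 < al <= l1 and l1 < al. Summed over the bins they
    produce [D], whose three terms are met by [H2], [H3] and [H4]. *)
Let heavy_ratio z : 0 < al z ->
  al z / psi z <= 1 + Num.sqrt (al z) / Num.sqrt l2 + al z / Num.sqrt (l1 * l2).
Proof.
move=> a0; have s1 : 0 <= Num.sqrt (al z) / Num.sqrt l2 by rewrite divr_ge0 ?sqrtr_ge0.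
have s2 : 0 <= al z / Num.sqrt (l1 * l2) by rewrite divr_ge0 ?sqrtr_ge0.
rewrite /psi; case: (leP (al z) l2) => h2.
  have h1 : al z <= l1 by apply: le_trans h2 l21.
  rewrite (min_idPl h1) -expr2 sqrtr_sqr ger0_norm // divff ?gt_eqF //.
  by lra.
case: (leP (al z) l1) => h1.
  have -> : al z / Num.sqrt (al z * l2) = Num.sqrt (al z) / Num.sqrt l2.
    rewrite sqrtrM // -{1}[al z]sqr_sqrtr // expr2.
    by field; rewrite !gt_eqF // sqrtr_gt0.
  by lra.
by lra.
Qed.

(* Square roots of the parameters, in which every bound is polynomial. *)
Let a := Num.sqrt l1.
Let b := Num.sqrt l2.
Let v := Num.sqrt n.
Let w := Num.sqrt M.
Let a0 : 0 < a. Proof. by rewrite sqrtr_gt0. Qed.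
Let b0 : 0 < b. Proof. by rewrite sqrtr_gt0. Qed.
Let v0 : 0 < v. Proof. by rewrite sqrtr_gt0. Qed.
Let w0 : 0 < w. Proof. by rewrite sqrtr_gt0. Qed.
Let a2 : a ^+ 2 = l1. Proof. by rewrite sqr_sqrtr // ltW. Qed.
Let b2 : b ^+ 2 = l2. Proof. by rewrite sqr_sqrtr // ltW. Qed.
Let v2 : v ^+ 2 = n. Proof. by rewrite sqr_sqrtr // ltW. Qed.
Let w2 : w ^+ 2 = M. Proof. by rewrite sqr_sqrtr // ltW. Qed.

(** [H1] covers both alternatives of the minimum in the sample bound: for c = n it gives the
    exponent 7/8 of n, and for c = M one factor M cancels and the exponent becomes 6/7. The other
    hypotheses are the remaining three terms, raised to the powers 4, 3 and 2. *)
Hypothesis H1 : 10 ^+ 42 * (l1 * l2) ^+ 2 * n ^+ 6 * c <= (M * eps) ^+ 8.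
Hypothesis H2 : 10 ^+ 22 * (l1 * l2) ^+ 2 * n ^+ 3 <= (M * eps) ^+ 4.
Hypothesis H3 : 10 ^+ 22 * l1 ^+ 2 * l2 * n ^+ 2 <= M ^+ 3 * eps ^+ 4.
Hypothesis H4 : 10 ^+ 22 * l1 * l2 * n <= M ^+ 2 * eps ^+ 4.

Lemma sqrt_bound (x : R) : 0 <= x -> 10 ^+ 22 * x ^+ 2 <= (M * eps) ^+ 4 ->
  10 ^+ 11 * x <= (M * eps) ^+ 2.
Proof.
move=> x0 h; rewrite -ler_sqr ?nnegrE ?sqr_ge0 ?mulr_ge0 ?exprn_ge0 //.
by rewrite exprMn -!exprM.
Qed.

Let sum_al : \sum_z al z = M.
Proof. by rewrite -mulr_sumr p_sum1 mulr1. Qed.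

Let D : R := n + v * w / b + M / (a * b).
Let D0 : 0 < D.
Proof. by rewrite addr_gt0 ?addr_gt0 ?divr_gt0 ?mulr_gt0. Qed.

Let target_ge0 : 0 <= target.
Proof. by rewrite !mulr_ge0 ?exprn_ge0 ?sqrtr_ge0 // ltW. Qed.

Let heavy_numeric : 16 * target * D <= (M * eps / 2) ^+ 2.
Proof.
have cv : Num.sqrt c <= v by rewrite ler_wsqrtr // ler_nat geq_minl.
have B : target * D <= 8 * 10 ^+ 7 * (a ^+ 2 * b ^+ 2 * v * D).
  rewrite [leRHS](_ : _ = 8 * 10 ^+ 7 * (a ^+ 2 * b ^+ 2) * v * D); last by ring.
  apply: ler_wpM2r; first exact: ltW.
  rewrite /target -a2 -b2; apply: ler_wpM2l => //.
  by rewrite mulr_ge0 ?mulr_ge0 ?exprn_ge0 ?ltW.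
have DE : (a ^+ 2 * b ^+ 2) * v * D = a ^+ 2 * b ^+ 2 * v ^+ 3 + a ^+ 2 * b * v ^+ 2 * w +
    a * b * v * w ^+ 2.
  by rewrite /D -v2 -w2; field; rewrite !gt_eqF.
have x1 : 10 ^+ 11 * (a ^+ 2 * b ^+ 2 * v ^+ 3) <= (M * eps) ^+ 2.
  apply: sqrt_bound; first by rewrite !mulr_ge0 ?exprn_ge0 // ltW.
  by apply: le_trans H2; rewrite -a2 -b2 -v2 le_eqVlt; apply/orP; left; apply/eqP; ring.
have x2 : 10 ^+ 11 * (a ^+ 2 * b * v ^+ 2 * w) <= (M * eps) ^+ 2.
  apply: sqrt_bound; first by rewrite !mulr_ge0 ?exprn_ge0 // ltW.
  have := ler_wpM2r (ltW M0) H3; rewrite -a2 -b2 -v2 -w2.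
  by congr (_ <= _); ring.
have x3 : 10 ^+ 11 * (a * b * v * w ^+ 2) <= (M * eps) ^+ 2.
  apply: sqrt_bound; first by rewrite !mulr_ge0 ?exprn_ge0 // ltW.
  have := ler_wpM2r (sqr_ge0 M) H4; rewrite -a2 -b2 -v2 -w2.
  by congr (_ <= _); ring.
have y1 : 0 <= a ^+ 2 * b ^+ 2 * v ^+ 3 by rewrite !mulr_ge0 ?exprn_ge0 // ltW.
have y2 : 0 <= a ^+ 2 * b * v ^+ 2 * w by rewrite !mulr_ge0 ?exprn_ge0 // ltW.
have y3 : 0 <= a * b * v * w ^+ 2 by rewrite !mulr_ge0 ?exprn_ge0 // ltW.
rewrite DE in B.
have -> : (M * eps / 2) ^+ 2 = (M * eps) ^+ 2 / 4 by field.
rewrite -mulrA; move: (a ^+ 2 * b ^+ 2 * v ^+ 3) (a ^+ 2 * b * v ^+ 2 * w)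
  (a * b * v * w ^+ 2) (target * D) ((M * eps) ^+ 2) x1 x2 x3 y1 y2 y3 B.
move=> A1 A2 A3 T E x1 x2 x3 y1 y2 y3 B; lra.
Qed.

Lemma heavy_case (P : pred Z) : (forall z, P z -> 480 <= al z) ->
  M * eps / 2 <= \sum_(z | P z) al z * e z ->
  Ex mu (fun zs => (total_signal zs < target)%R%:R) <= 1 / 10.
Proof.
move=> hP big.
have ap z : P z -> 0 < al z by move=> /hP; lra.
set S := \sum_(z | P z) al z * psi z * e z ^+ 2.
have S0 z : 0 <= al z * psi z * e z ^+ 2 by exact: mulr_ge0 (mulr_ge0 (al0 z) (sqrtr_ge0 _)) (sqr_ge0 _).
have cs : (M * eps / 2) ^+ 2 <= S * D.
  apply: (@le_trans _ _ ((\sum_(z | P z) al z * e z) ^+ 2)).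
    rewrite ler_sqr ?nnegrE //; first by rewrite divr_ge0 // mulr_ge0 ?ltW.
    by apply: le_trans big; rewrite divr_ge0 // mulr_ge0 ?ltW.
  apply: le_trans (weighted_cauchy_schwarz (a := fun z => al z * psi z * e z ^+ 2)
     (b := fun z => al z / psi z) _ _ _) _.
  - by move=> z _.
  - by move=> z _; rewrite divr_ge0 ?sqrtr_ge0.
  - move=> z Pz; have := psi_gt0 (ap z Pz) => s0.
    by rewrite le_eqVlt; apply/orP; left; apply/eqP; field; rewrite gt_eqF.
  apply: ler_wpM2l; first by apply: sumr_ge0.
  apply: (@le_trans _ _ (\sum_z (1 + Num.sqrt (al z) / b + al z / (a * b)))).
    rewrite big_mkcond; apply: ler_sum => z _; case: ifP => Pz.
      by have := heavy_ratio (ap z Pz); rewrite (sqrtrM _ (ltW l10)).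
    by rewrite !addr_ge0 ?divr_ge0 ?sqrtr_ge0 ?mulr_ge0 // ltW.
  rewrite !big_split /= -!mulr_suml sum_al sumr_const /D lerD2r lerD //.
  rewrite ler_pM2r ?invr_gt0 //.
  have : (\sum_z Num.sqrt (al z)) ^+ 2 <= (\sum_(z : Z) 1) * (\sum_z al z).
    apply: weighted_cauchy_schwarz => // z _.
    by rewrite mul1r sqr_sqrtr.
  rewrite sum_al sumr_const -/n -v2 -w2 -exprMn ler_sqr ?nnegrE //.
    by apply: sumr_ge0 => z _; exact: sqrtr_ge0.
  by rewrite mulr_ge0 ?sqrtr_ge0.
have S16 : 16 * target <= S.
  by have := le_trans heavy_numeric cs; rewrite ler_pM2r.
(* A bound for the part of [S] lost to bins where some block has less than half of its expected
   count. *)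
pose bad (zs : Om) := \sum_(z | P z) al z * psi z * e z ^+ 2 *
  \sum_(b : 'I_6) ((occ zs b z)%:R < al z / 2)%R%:R.
have det zs : S - bad zs <= 8 * total_signal zs.
  rewrite /S /bad -sumrB /total_signal mulr_sumr big_mkcond; apply: ler_sum => z _.
  have g0 : 0 <= (kmin zs z)%:R * (omega X Y zs z)%:R * e z ^+ 2 by rewrite mulr_ge0 ?sqr_ge0.
  case: ifP => Pz; last by rewrite mulr_ge0.
  case: (boolP [forall b : 'I_6, al z / 2 <= (occ zs b z)%:R]) => [/forallP h|].
    rewrite big1 => [|b' _]; last by rewrite ltNge h.
    rewrite mulr0 subr0 mulrA; apply: ler_wpM2r; first exact: sqr_ge0.
    exact: heavy_bin.
  rewrite negb_forall => /existsP [b' hb]; rewrite -ltNge in hb.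
  apply: le_trans (_ : _ <= 0) _; last by rewrite mulr_ge0.
  rewrite subr_le0 ler_peMr // (bigD1 b') //= hb lerDl; exact: sumr_ge0.
have bad0 zs : 0 <= bad zs by apply: sumr_ge0 => z _; apply: mulr_ge0 => //; exact: sumr_ge0.
have Ebad : Ex mu bad <= S / 20.
  rewrite /bad Ex_sum /S mulr_suml; apply: ler_sum => z Pz.
  rewrite ExZ ler_wpM2l // Ex_sum.
  have az : 480 <= al z := hP z Pz.
  (* Each of six blocks fails with probability at most 4 / al, and 24 / 480 = 1/20; this is the
     origin of 480. *)
  apply: (@le_trans _ _ (\sum_(b : 'I_6) (4 / al z))).
    apply: ler_sum => b' _; apply: occ_tail => //; exact: ap.
  rewrite sumr_const card_ord -[_ *+ 6]mulr_natr mulrAC ler_pdivrMr ?ap //; lra.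
case: (ltP 0 S) => Spos; last first.
  have t0 : target <= 0 by lra.
  apply: Ex_le_cst => // zs; rewrite ltNge (_ : target <= _) /=; first by lra.
  apply: le_trans t0 _; apply: sumr_ge0 => z _; rewrite mulr_ge0 ?sqr_ge0 //.
have h2 : 0 < S / 2 by lra.
apply: (@le_trans _ _ (Ex mu (fun zs => (S / 2 <= bad zs)%R%:R))).
  apply: le_Ex => // zs; case: (ltP (total_signal zs) target) => //= h.
  have -> : S / 2 <= bad zs by have := det zs; lra.
  by [].
apply: le_trans (Ex_markov mu_ge0 h2 bad0) _.
by rewrite ler_pdivrMr //; lra.
Qed.

Lemma light_case (P : pred Z) : (forall z, P z -> al z <= 480) ->
  (forall z, P z -> M * eps / (2 * n) <= al z) ->
  M * eps / 2 <= \sum_(z | P z) al z * e z ->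
  Ex mu (fun zs => (total_signal zs < target)%R%:R) <= 1 / 10.
Proof.
move=> hP hP' big.
set S := \sum_(z | P z) al z ^+ 4 * e z ^+ 2.
have me0 : 0 < M * eps by rewrite mulr_gt0.
have S0 : 0 <= S by apply: sumr_ge0 => z _; exact: mulr_ge0 (exprn_ge0 4 (al0 z)) (sqr_ge0 _).
have ap z : P z -> 0 < al z.
  by move=> /hP'; apply: lt_le_trans; rewrite divr_gt0 // mulr_gt0.
(* The product al * e is split into al^2 * e and 1 / al: al^4 is the order of the probability that
   four blocks hit the bin, and the lower bound on [al] controls the inverse squares. *)
have cs : (M * eps / 2) ^+ 2 <= S * (4 * n ^+ 3 / (M * eps) ^+ 2).
  apply: (@le_trans _ _ ((\sum_(z | P z) al z * e z) ^+ 2)).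
    rewrite ler_sqr ?nnegrE //; first by rewrite divr_ge0 // ltW.
    by apply: le_trans big; rewrite divr_ge0 // ltW.
  apply: le_trans (weighted_cauchy_schwarz (a := fun z => al z ^+ 4 * e z ^+ 2)
     (b := fun z => al z ^- 2) _ _ _) _.
  - by move=> z _; exact: mulr_ge0 (exprn_ge0 4 (al0 z)) (sqr_ge0 _).
  - by move=> z _; rewrite invr_ge0 sqr_ge0.
  - move=> z /ap az; rewrite le_eqVlt; apply/orP; left; apply/eqP; field.
    by rewrite gt_eqF.
  apply: ler_wpM2l => //.
  apply: (@le_trans _ _ (\sum_(z : Z) (4 * n ^+ 2 / (M * eps) ^+ 2))).
    rewrite big_mkcond; apply: ler_sum => z _; case: ifP => Pz; last first.
      by apply: divr_ge0 (sqr_ge0 _); apply: mulr_ge0 (sqr_ge0 _).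
    have h := hP' z Pz; rewrite -[leLHS]mul1r ler_pdivrMr ?exprn_gt0 ?ap //.
    rewrite mulrAC ler_pdivlMr ?exprn_gt0 // mul1r.
    have : M * eps <= al z * (2 * n) by rewrite -ler_pdivrMr // mulr_gt0.
    move=> h'; have : (M * eps) ^+ 2 <= (al z * (2 * n)) ^+ 2.
      rewrite ler_sqr ?nnegrE //; first exact: ltW.
      by apply: mulr_ge0 => //; apply: mulr_ge0 => //; exact: ltW.
    by congr (_ <= _); ring.
  rewrite sumr_const -[_ *+ #|_|]mulr_natr -/n.
  by rewrite le_eqVlt; apply/orP; left; apply/eqP; ring.
have S1 : (M * eps) ^+ 4 <= 16 * n ^+ 3 * S.
  move: cs; rewrite mulrA ler_pdivlMr ?exprn_gt0 //.
  set x := M * eps => h.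
  have -> : x ^+ 4 = 4 * ((x / 2) ^+ 2 * x ^+ 2) by field.
  by lra.
have big1' : 10 ^+ 21 * (l1 * l2) * n ^+ 3 * Num.sqrt c <= (M * eps) ^+ 4.
  have q0 : 0 <= 10 ^+ 21 * (l1 * l2) * n ^+ 3 * Num.sqrt c.
    by rewrite mulr_ge0 ?sqrtr_ge0 // mulr_ge0 ?exprn_ge0 // mulr_ge0 ?exprn_ge0 // mulr_ge0.
  have q1 : 0 <= (M * eps) ^+ 4 by rewrite exprn_ge0 // ltW.
  rewrite -ler_sqr ?nnegrE // -exprM; apply: le_trans H1; rewrite (exprM _ 21 2).
  rewrite -[c in leRHS]sqr_sqrtr //; move: (10 ^+ 21) => K.
  by rewrite le_eqVlt; apply/orP; left; apply/eqP; ring.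
(* From [phit_ge] with the bound 480 on [al]. The factor 10^21, the square root of 10^42 in [H1],
   pays for 16 * d^4 * 2 * 8 * 10^7, about 1.4 * 10^20. *)
pose d : R := 1 + 480.
have d0 : 0 < d by rewrite /d; lra.
have phi z : P z -> (al z / d) ^+ 4 <= phit m p z ^+ 4.
  move=> Pz; have h := phit_ge (m := m) p_ge0 p_sum1 (hP z Pz).
  have h0 : 0 <= al z / d by apply: divr_ge0; [exact: al0|exact: ltW].
  by apply: lerXn2r (h); rewrite nnegrE //; exact: le_trans (h).
have q1 : 1 <= l1 * l2 * Num.sqrt c.
  have c1 : 1 <= Num.sqrt c.
    by rewrite -[leLHS]sqrtr1 ler_wsqrtr // ler1n leq_min Z0 m0.
  have l1l2 : 1 <= l1 * l2 by rewrite -natrM ler1n muln_gt0 X0.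
  by rewrite mulr_ege1.
have tp : 100 <= target.
  by rewrite /target -(mulrA (8 * 10 ^+ 7)); move: (_ * Num.sqrt c) q1 => q; lra.
have E2 : 2 * target <= \sum_(z | P z) e z ^+ 2 * phit m p z ^+ 4.
  apply: (@le_trans _ _ (S / d ^+ 4)); last first.
    rewrite /S mulr_suml; apply: ler_sum => z Pz; rewrite mulrAC mulrC -expr_div_n.
    by apply: ler_wpM2l; [exact: sqr_ge0|exact: phi].
  have n3 : 0 < n ^+ 3 by rewrite exprn_gt0.
  have h : 10 ^+ 21 * (l1 * l2 * Num.sqrt c) <= 16 * S.
    rewrite -(ler_pM2l n3); apply: le_trans (le_trans (_ : _ <= _) (le_trans big1' S1)) _.
      by rewrite le_eqVlt; apply/orP; left; apply/eqP; move: (10 ^+ 21) => K; ring.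
    by rewrite le_eqVlt; apply/orP; left; apply/eqP; ring.
  rewrite ler_pdivlMr ?exprn_gt0 // /target -(mulrA (8 * 10 ^+ 7)).
  move: (_ * Num.sqrt c) q1 h => q q1 h; rewrite /d; lra.
apply: le_trans (_ : _ <= 16 / (2 * target)) _.
  have t0 : 0 < target by lra.
  apply: le_trans (light_concentration p_ge0 p_sum1 e_bd t0 E2).
  apply: le_Ex => // zs; rewrite ler_nat.
  case: (ltP (total_signal zs) target) => //= h.
  suff -> : \sum_(z | P z) e z ^+ 2 * hit4 R zs z < target by [].
  apply: le_lt_trans h.
  rewrite big_mkcond; apply: ler_sum => z _.
  have g0 : 0 <= (kmin zs z)%:R * (omega X Y zs z)%:R * e z ^+ 2 by rewrite mulr_ge0 ?sqr_ge0.
  case: ifP => // Pz; rewrite mulrC; apply: ler_wpM2r; first exact: sqr_ge0.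
  (* One sample in each of blocks 0 to 3 already forces [kmin] and [omega] to be at least 1. *)
  have := kmin_ge zs z; rewrite /hit4 /hit.
  case: (posnP (occ zs (block 0) z)) => o0; first by rewrite mul0r.
  case: (posnP (occ zs (block 1) z)) => o1; first by rewrite mul0r mulr0.
  case: (posnP (occ zs (block 2) z)) => o2; first by rewrite mul0r !mulr0.
  case: (posnP (occ zs (block 3) z)) => o3; first by rewrite !mulr0.
  move=> h'; rewrite /= !mulr1 -natrM ler1n muln_gt0 omega_gt0 andbT.
  by apply: leq_trans h'; rewrite !leq_min o0 o1 o2 o3.
rewrite ler_pdivrMr; lra.
Qed.

(** Bins with al below M eps / (2 n) carry at most M eps of a total of at least 2 M eps, as [e] is
    at most 2. Of the remaining M eps, either the bins above 480 or those below carry half. *)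
Lemma typical_signal : Ex mu (fun zs => (total_signal zs < target)%R%:R) <= 1 / 10.
Proof.
pose T z := M * eps / (2 * n) <= al z.
have low : \sum_(z | ~~ T z) al z * e z <= M * eps.
  apply: (@le_trans _ _ (\sum_(z : Z) M * eps / n)); last first.
    rewrite sumr_const -[_ *+ #|_|]mulr_natr -/n divfK ?gt_eqF //.
  rewrite big_mkcond; apply: ler_sum => z _; case: ifP => Tz; last first.
    by rewrite divr_ge0 ?mulr_ge0 // ltW.
  have /andP[e0 e2] := e_bd z.
  have h : al z <= M * eps / (2 * n) by rewrite ltW // ltNge.
  have -> : M * eps / n = M * eps / (2 * n) * 2 by field; rewrite gt_eqF.
  by apply: ler_pM.
have tot : 2 * (M * eps) <= \sum_z al z * e z.
  rewrite (eq_bigr (fun z => M * (p z * e z))) => [|z _]; last by rewrite /al mulrA.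
  by rewrite -mulr_sumr mulrCA ler_pM2l.
have high : M * eps <= \sum_(z | T z) al z * e z.
  by move: tot; rewrite (bigID T) /=; lra.
rewrite (bigID (fun z => 480 <= al z)) /= in high.
case: (lerP (M * eps / 2) (\sum_(z | T z && (480 <= al z)) al z * e z)) => h.
  by apply: heavy_case h => z /andP[].
apply: (@light_case (fun z => T z && ~~ (480 <= al z))).
- by move=> z /andP[_]; rewrite -ltNge => /ltW.
- by move=> z /andP[].
- by lra.
Qed.

End TypicalSignal.

(** * From the joint distribution to its conditional laws *)

Section Disintegration.
Variables (R : realType) (X Y Z : finType) (p : {ffun X * Y * Z -> R}) (u0 : X * Y).
Hypothesis p_dist : is_dist p.

Definition lawZ (z : Z) : R := \sum_u p (u, z).
(** A null bin is given a point mass, which is a product law: every [lawXY z] is then a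
    distribution, and null bins carry no dependence. *)
Definition lawXY (z : Z) (u : X * Y) : R :=
  if lawZ z == 0 then (u == u0)%:R else p (u, z) / lawZ z.

Let p_ge0 w : 0 <= p w. Proof. by case: p_dist. Qed.

Lemma lawZ_ge0 z : 0 <= lawZ z.
Proof. exact: sumr_ge0. Qed.

Lemma sum_pair_swap (f : X * Y * Z -> R) : \sum_w f w = \sum_z \sum_u f (u, z).
Proof. by rewrite sum_pair exchange_big. Qed.

Lemma lawZ_sum1 : \sum_z lawZ z = 1.
Proof. by case: p_dist => _ <-; rewrite -sum_pair_swap. Qed.

Lemma lawXY_ge0 z u : 0 <= lawXY z u.
Proof. by rewrite /lawXY; case: ifP => // _; rewrite divr_ge0 // lawZ_ge0. Qed.

Lemma lawXY_sum1 z : \sum_u lawXY z u = 1.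
Proof.
rewrite /lawXY; case: eqP => [_|/eqP nz]; last by rewrite -mulr_suml divff.
by rewrite (bigD1 u0) //= eqxx big1 ?addr0 // => u /negbTE ->.
Qed.

Lemma lawE u z : p (u, z) = lawZ z * lawXY z u.
Proof.
rewrite /lawXY; case: eqP => [e|/eqP nz]; last by rewrite mulrC divfK.
by rewrite e mul0r; apply/eqP; move/eqP: e; rewrite psumr_eq0 // => /allP; apply; rewrite mem_index_enum.
Qed.

Definition join (I : finType) (zs : {ffun I -> Z}) (xy : {ffun I -> X * Y}) :
  {ffun I -> X * Y * Z} := [ffun i => (xy i, zs i)].

Lemma Ex_disintegrate (I : finType) (F : {ffun I -> X * Y * Z} -> R) :
  Ex (fun _ : I => p) F =
  Ex (fun _ : I => lawZ) (fun zs => Ex (fun i => lawXY (zs i)) (fun xy => F (join zs xy))).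
Proof.
rewrite /Ex; under [RHS]eq_bigr do rewrite mulr_sumr.
rewrite pair_bigA /= (reindex (fun t : {ffun I -> Z} * {ffun I -> X * Y} => join t.1 t.2)) /=.
  apply: eq_bigr => -[zs xy] _ /=; rewrite mulrA -big_split /=; congr (_ * _).
  by apply: eq_bigr => i _; rewrite ffunE lawE.
exists (fun w => ([ffun i => (w i).2], [ffun i => (w i).1])) => [[zs xy] _|w _] /=.
  by congr pair; apply/ffunP => i; rewrite !ffunE.
by apply/ffunP => i; rewrite !ffunE -surjective_pairing.
Qed.

Lemma PrE (q : {ffun X * Y * Z -> R}) (P : pred (X * Y)) z :
  Pr q (predI [pred w | P w.1] [pred w | w.2 == z]) = \sum_(u | P u) q (u, z).
Proof.
rewrite /Pr; transitivity (\sum_(u | P u) \sum_(z' | z' == z) q (u, z')).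
  by rewrite pair_big /=; apply: eq_big => [[u z']|[u z']].
by apply: eq_bigr => u _; rewrite big_pred1_eq.
Qed.

Lemma PrZ (q : {ffun X * Y * Z -> R}) z : Pr q [pred w | w.2 == z] = \sum_u q (u, z).
Proof. by rewrite -(PrE q predT). Qed.

Lemma cond_PrE (P : pred (X * Y)) z : lawZ z != 0 ->
  cond_Pr p [pred w | P w.1] [pred w | w.2 == z] = \sum_(u | P u) lawXY z u.
Proof.
move=> nz; rewrite /cond_Pr PrE PrZ -/(lawZ z) mulr_suml; apply: eq_bigr => u _.
by rewrite /lawXY (negbTE nz).
Qed.

Lemma cond_indep_nu : cond_indep p -> forall z u, nu (lawXY z) u = 0.
Proof.
move=> ci z [i j]; rewrite /nu /indep_law /= marg1E marg2E.
suff -> : lawXY z (i, j) = (\sum_(s | s.1 == i) lawXY z s) * (\sum_(s | s.2 == j) lawXY z s).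
  by rewrite subrr mulr0.
have [e|nz] := eqVneq (lawZ z) 0; last first.
  have := ci i j z.
  rewrite (cond_PrE (fun u => (u.1 == i) && (u.2 == j)) nz) (cond_PrE (fun u => u.1 == i) nz).
  rewrite (cond_PrE (fun u => u.2 == j) nz) => <-.
  by rewrite (big_pred1 (i, j)) // => -[a b]; rewrite xpair_eqE.
have D (P : pred (X * Y)) : \sum_(s | P s) lawXY z s = (P u0)%:R.
  rewrite /lawXY e eqxx big_mkcond (bigD1 u0) //= eqxx big1 ?addr0.
    by case: (P u0).
  by move=> s /negbTE ->; case: ifP.
rewrite !D /lawXY e eqxx; case: u0 => [a b] /=; rewrite xpair_eqE (eq_sym i) (eq_sym j).
by case: (a == i); case: (b == j); rewrite /= ?mulr0 ?mulr1.
Qed.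

Lemma marg1_sum1 z : \sum_x marg1 (lawXY z) x = 1.
Proof. by rewrite -sum_pair lawXY_sum1. Qed.

Lemma marg2_sum1 z : \sum_y marg2 (lawXY z) y = 1.
Proof. by rewrite exchange_big -sum_pair lawXY_sum1. Qed.

Lemma indep_sum1 z : \sum_u indep_law (lawXY z) u = 1.
Proof.
rewrite sum_pair /indep_law /= -(marg1_sum1 z); apply: eq_bigr => x _.
by rewrite -mulr_sumr marg2_sum1 mulr1.
Qed.

Lemma dep_bounds z : 0 <= dep lawXY z <= 2.
Proof.
apply/andP; split; first by apply: sumr_ge0.
apply: (@le_trans _ _ (\sum_u (lawXY z u + indep_law (lawXY z) u))).
  apply: ler_sum => u _; apply: le_trans (ler_normB _ _) _.
  by rewrite !ger0_norm ?lawXY_ge0 // indep_law_ge0 // => s; exact: lawXY_ge0.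
by rewrite big_split /= lawXY_sum1 indep_sum1.
Qed.

Definition indep_version : {ffun X * Y * Z -> R} :=
  [ffun w => lawZ w.2 * indep_law (lawXY w.2) w.1].

Lemma indep_version_CI : CI R X Y Z indep_version.
Proof.
have qE z (P : pred (X * Y)) : \sum_(u | P u) indep_version (u, z) =
    lawZ z * \sum_(u | P u) indep_law (lawXY z) u.
  by rewrite mulr_sumr; apply: eq_bigr => u _; rewrite ffunE.
have q1 z : \sum_u indep_version (u, z) = lawZ z.
  by rewrite (qE z predT) indep_sum1 mulr1.
split.
  split=> [w|].
    by rewrite ffunE mulr_ge0 ?lawZ_ge0 // indep_law_ge0 // => s; exact: lawXY_ge0.
  by rewrite sum_pair_swap (eq_bigr _ (fun z _ => q1 z)) lawZ_sum1.
move=> i j z; rewrite /cond_Pr.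
rewrite (PrE _ (fun u => (u.1 == i) && (u.2 == j))) (PrE _ (fun u => u.1 == i)).
rewrite (PrE _ (fun u => u.2 == j)) PrZ q1 !qE.
have [->|nz] := eqVneq (lawZ z) 0; first by rewrite !mul0r.
rewrite ![lawZ z * _]mulrC !mulfK //.
rewrite (big_pred1 (i, j)) => [|[a b]]; last by rewrite /= xpair_eqE.
rewrite /indep_law /=; congr (_ * _).
  transitivity (\sum_(x | x == i) \sum_y marg1 (lawXY z) x * marg2 (lawXY z) y).
    by rewrite big_pred1_eq -mulr_sumr marg2_sum1 mulr1.
  by rewrite pair_big /=; apply: eq_big => [[a b]|[a b]] //=; rewrite andbT.
transitivity (\sum_x \sum_(y | y == j) marg1 (lawXY z) x * marg2 (lawXY z) y).
  by rewrite (eq_bigr (fun x => marg1 (lawXY z) x * marg2 (lawXY z) j)) => [|x _];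
     rewrite ?big_pred1_eq // -mulr_suml marg1_sum1 mul1r.
by rewrite pair_big /=; apply: eq_big => [[a b]|[a b]].
Qed.

(** The infimum is at most the distance to [indep_version]; since this has the same Z-marginal, that
    distance is half the average of [dep] over the bins. *)
Lemma far_dep eps : eps <= dTV_set p (CI R X Y Z) ->
  2 * eps <= \sum_z lawZ z * dep lawXY z.
Proof.
move=> far.
have h : dTV_set p (CI R X Y Z) <= dTV p indep_version.
  apply: ge_inf; last by exists indep_version => //; exact: indep_version_CI.
  exists 0 => _ [q _ <-]; apply: mulr_ge0 => //; exact: sumr_ge0.
have e : dTV p indep_version = 2^-1 * \sum_z lawZ z * dep lawXY z.
  rewrite /dTV sum_pair_swap; congr (_ * _); apply: eq_bigr => z _.
  rewrite mulr_sumr; apply: eq_bigr => u _.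
  by rewrite ffunE /= lawE -mulrBr normrM ger0_norm // lawZ_ge0.
by have := le_trans far h; rewrite e; lra.
Qed.

End Disintegration.

(** * Error probabilities under the joint law *)

Section ErrorProbability.
Variables (R : realType) (X Y Z : finType) (m : nat) (p : {ffun X * Y * Z -> R}).
Hypothesis p_dist : is_dist p.
Hypotheses (m0 : (0 < m)%N) (Z0 : (0 < #|Z|)%N) (Y0 : (0 < #|Y|)%N)
  (leYX : (#|Y| <= #|X|)%N).

Let X0 : (0 < #|X|)%N. Proof. exact: leq_trans Y0 leYX. Qed.
Let u0 : X * Y := (enum_val (Ordinal X0), enum_val (Ordinal Y0)).
Let I : finType := ('I_6 * 'I_m)%type.

Definition accepts (w : {ffun I -> X * Y * Z}) : bool :=
  Atot R [ffun i => (w i).2] [ffun i => (w i).1] <= threshold R Z m.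

Let accepts_join zs xy : accepts (join zs xy) = (Atot R zs xy <= threshold R Z m).
Proof.
by rewrite /accepts; congr (Atot _ _ _ <= _); apply/ffunP => i; rewrite !ffunE.
Qed.

Let p_ge0 (i : I) v : 0 <= p v. Proof. by case: p_dist. Qed.
Let p_sum1 (i : I) : \sum_v p v = 1. Proof. by case: p_dist. Qed.

Lemma Ex_negb (b : {ffun I -> X * Y * Z} -> bool) :
  Ex (fun _ : I => p) (fun w => (~~ b w)%:R) = 1 - Ex (fun _ : I => p) (fun w => (b w)%:R).
Proof.
rewrite -[X in X - _](Ex_cst p_sum1) -ExB; apply: eq_Ex => w.
by case: (b w); rewrite /= ?subrr ?subr0.
Qed.

Lemma null_accepts : cond_indep p ->
  2 / 3 <= Ex (fun _ : I => p) (fun w => (accepts w)%:R).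
Proof.
move=> ci; have nu0 := cond_indep_nu u0 ci.
suff h : Ex (fun _ : I => p) (fun w => (~~ accepts w)%:R) <= 1 / 3.
  by move: h; rewrite Ex_negb; lra.
rewrite (Ex_disintegrate u0 p_dist).
apply: (Ex_le_cst (mu := fun _ : I => lawZ p)) => [i v|i|zs].
- exact: lawZ_ge0.
- exact: lawZ_sum1.
apply: le_trans (null_error zs (lawXY_ge0 u0 p_dist) (lawXY_sum1 p u0) X0 Y0 Z0 m0 nu0).
rewrite le_eqVlt; apply/orP; left; apply/eqP; apply: eq_Ex => xy.
by rewrite accepts_join -ltNge.
Qed.

Lemma alt_rejects eps : 0 < eps -> eps <= dTV_set p (CI R X Y Z) ->
  let l1 : R := #|X|%:R in let l2 : R := #|Y|%:R in let n : R := #|Z|%:R in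
  let M : R := m%:R in
  10 ^+ 42 * (l1 * l2) ^+ 2 * n ^+ 6 * (minn #|Z| m)%:R <= (M * eps) ^+ 8 ->
  10 ^+ 22 * (l1 * l2) ^+ 2 * n ^+ 3 <= (M * eps) ^+ 4 ->
  10 ^+ 22 * l1 ^+ 2 * l2 * n ^+ 2 <= M ^+ 3 * eps ^+ 4 ->
  10 ^+ 22 * l1 * l2 * n <= M ^+ 2 * eps ^+ 4 ->
  2 / 3 <= Ex (fun _ : I => p) (fun w => (~~ accepts w)%:R).
Proof.
move=> eps0 far l1 l2 n M H1 H2 H3 H4; have far' := far_dep u0 p_dist far.
suff h : Ex (fun _ : I => p) (fun w => (accepts w)%:R) <= 1 / 10 + 2 / 15.
  by rewrite Ex_negb; lra.
have ts := typical_signal (lawZ_ge0 p_dist) (lawZ_sum1 p_dist) (dep_bounds u0 p_dist) far'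
  eps0 m0 Z0 Y0 leYX H1 H2 H3 H4.
rewrite (Ex_disintegrate u0 p_dist).
have lg (i : I) v : 0 <= lawZ p v by exact: lawZ_ge0.
have ls (i : I) : \sum_v lawZ p v = 1 by exact: lawZ_sum1.
have rg (zs : {ffun I -> Z}) (i : I) v : 0 <= lawXY p u0 (zs i) v by exact: lawXY_ge0.
have rs (zs : {ffun I -> Z}) (i : I) : \sum_v lawXY p u0 (zs i) v = 1 by exact: lawXY_sum1.
apply: (@le_trans _ _ (Ex (fun _ : I => lawZ p) (fun zs =>
  (total_signal X Y (dep (lawXY p u0)) zs < target R X Y Z m)%R%:R + 2 / 15))); last first.
  by rewrite ExD Ex_cst // lerD2r.
apply: le_Ex => // zs; under eq_Ex do rewrite accepts_join.
case: ltP => /= h.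
  apply: (@le_trans _ _ 1); last by rewrite lerDl divr_ge0.
  by apply: Ex_le_cst => // xy; rewrite lern1 leq_b1.
rewrite add0r.
exact: (alt_error (zs := zs) (lawXY_ge0 u0 p_dist) (lawXY_sum1 p u0) X0 Y0 Z0 m0 h).
Qed.

End ErrorProbability.

(** * The decision as a term of the language *)

(** Variables 0 to 3 hold [#|X|], [#|Y|], [#|Z|] and the ceiling of 1 / eps, variable 4 holds [m], 5
    to 8 the indices of a quadruple of samples, and 10 its bin. Local names take 11 to 15, 20 to 22,
    30 to 33 and 40 to 42, so that no binder captures a variable still needed. *)
Definition tEq a b := IfPos (Minus a b) (Lit 0) (IfPos (Minus b a) (Lit 0) (Lit 1)).
Definition tLe a b := IfPos (Plus (Minus b a) (Lit 1)) (Lit 1) (Lit 0).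
Definition tMin a b := IfPos (Minus b a) a b.
Definition tMax a b := IfPos (Minus b a) b a.
Definition tSucc a := Plus a (Lit 1).

(* The operand [b] of [tDiv a b] must not mention the variable 40. *)
Definition tDiv a b := LetIn 40 a (LetIn 41 b (IfPos (Var 41)
  (Sum 42 (Var 40) (tLe (Times (tSucc (Var 42)) (Var 41)) (Var 40))) (Lit 0))).

Definition tSqrt a := LetIn 40 a
  (Sum 42 (Var 40) (tLe (Times (tSucc (Var 42)) (tSucc (Var 42))) (Var 40))).

Section DerivedTerms.
Variables (arr e : nat -> int).
Local Notation den := (den arr).

Lemma den_tEq a b (x y : nat) : den e a = x%:Z -> den e b = y%:Z ->
  den e (tEq a b) = (x == y)%:Z.
Proof. by move=> /= -> ->; case: (ltngtP x y) => h; do ?case: ifP; lia. Qed.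

Lemma den_tLe a b (x y : nat) : den e a = x%:Z -> den e b = y%:Z ->
  den e (tLe a b) = (x <= y)%N%:Z.
Proof. by move=> /= -> ->; case: (leqP x y) => h; do ?case: ifP; lia. Qed.

Lemma den_tLe_int a b : den e (tLe a b) = (den e a <= den e b)%R%:Z.
Proof. by move=> /=; case: (lerP (den e a) (den e b)) => h; do ?case: ifP; lia. Qed.

Lemma den_tMin a b (x y : nat) : den e a = x%:Z -> den e b = y%:Z ->
  den e (tMin a b) = (minn x y)%:Z.
Proof. by move=> /= -> ->; case: (leqP x y) => h; do ?case: ifP; lia. Qed.

Lemma den_tMax a b (x y : nat) : den e a = x%:Z -> den e b = y%:Z ->
  den e (tMax a b) = (maxn x y)%:Z.
Proof. by move=> /= -> ->; case: (leqP x y) => h; do ?case: ifP; lia. Qed.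

Lemma den_Times a b (x y : nat) : den e a = x%:Z -> den e b = y%:Z ->
  den e (Times a b) = (x * y)%N%:Z.
Proof. by move=> /= -> ->; rewrite PoszM. Qed.

Lemma den_Plus a b (x y : nat) : den e a = x%:Z -> den e b = y%:Z ->
  den e (Plus a b) = (x + y)%N%:Z.
Proof. by move=> /= -> ->; rewrite PoszD. Qed.

Lemma den_tSucc a (x : nat) : den e a = x%:Z -> den e (tSucc a) = x.+1%:Z.
Proof. by move=> /= ->; rewrite addrC -intS. Qed.

Lemma den_Sum v b f (n : nat) (F : 'I_n -> nat) : den e b = n%:Z ->
  (forall j : 'I_n, den (set_var e v (j : nat)%:Z) f = (F j)%:Z) ->
  den e (Sum v b f) = (\sum_(j < n) F j)%N%:Z.
Proof.
move=> /= -> h; rewrite (eq_bigr _ (fun j _ => h j)).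
by rewrite (big_morph Posz PoszD (erefl _)).
Qed.

Lemma den_LetIn v a b (x : int) : den e a = x ->
  den e (LetIn v a b) = den (set_var e v x) b.
Proof. by move=> /= ->. Qed.

End DerivedTerms.

Lemma sum_ltn q a : (q <= a)%N -> (\sum_(j < a) (j < q) = q)%N.
Proof.
move=> /minn_idPl {2}<-; elim: a => [|a IH]; first by rewrite big_ord0 minn0.
by rewrite big_ord_recr /= IH; case: (ltnP a q) => h /=; lia.
Qed.

Lemma divn_sum a b : (0 < b)%N -> (\sum_(j < a) (j.+1 * b <= a) = a %/ b)%N.
Proof.
move=> b0; rewrite -[RHS](sum_ltn (leq_div a b)); apply: eq_bigr => j _.
by rewrite -leq_divRL.
Qed.

Lemma den_tDiv arr e a b (x y : nat) : den arr e a = x%:Z ->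
  den arr (set_var e 40 x%:Z) b = y%:Z -> den arr e (tDiv a b) = (x %/ y)%N%:Z.
Proof.
move=> ha hb; rewrite /tDiv (den_LetIn _ _ ha) (den_LetIn _ _ hb).
set e' := set_var _ _ _; case: (posnP y) => [y0|y0].
  by rewrite /= /e' /set_var /= y0 divn0.
set S := Sum _ _ _.
have -> : den arr e' (IfPos (Var 41) S (Lit 0)) = if 0 < y%:Z then den arr e' S else 0 by [].
rewrite ltz_nat y0 -divn_sum //.
apply: (@den_Sum arr e' 42 (Var 40) _ x (fun j => (j.+1 * y <= x)%N)) => // j.
by apply: den_tLe => //; apply: den_Times => //; exact: den_tSucc.
Qed.

Lemma den_tSqrt arr e a (x : nat) : den arr e a = x%:Z ->
  den arr e (tSqrt a) = (isqrt x)%:Z.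
Proof.
move=> ha; rewrite /tSqrt (den_LetIn _ _ ha).
apply: (@den_Sum arr _ 42 (Var 40) _ x (fun j => (j.+1 * j.+1 <= x)%N)) => // j.
by apply: den_tLe => //; apply: den_Times => //; exact: den_tSucc.
Qed.

(* Coordinate [c] of the [i]-th sample of block [b], where [i] is held by the
   variable [iv]. *)
Definition tCell (c b iv : nat) : tm :=
  Get (Plus (Times (Lit 3) (Plus (Times (Lit b%:Z) (Var 4)) (Var iv))) (Lit c%:Z)).

Definition tOcc (b zv : nat) : tm := Sum 20 (Var 4) (tEq (tCell 2 b 20) (Var zv)).

Definition tRank (b iv : nat) : tm := Sum 20 (Var 4)
  (Times (tLe (tSucc (Var 20)) (Var iv)) (tEq (tCell 2 b 20) (tCell 2 b iv))).

Definition tMatched (a b iv jv : nat) : tm :=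
  Times (tEq (tCell 2 a iv) (tCell 2 b jv)) (tEq (tRank a iv) (tRank b jv)).

Definition tPairs (a b zv : nat) : tm := Sum 21 (Var 4) (Sum 22 (Var 4)
  (Times (tMatched a b 21 22) (tEq (tCell 2 a 21) (Var zv)))).

Definition tHits (c b zv tv : nat) : tm := Sum 20 (Var 4)
  (Times (tEq (tCell 2 b 20) (Var zv)) (tEq (tCell c b 20) (Var tv))).

Definition tScale : tm :=
  tSucc (Plus (Plus (Times (Var 4) (Var 4)) (Var 0)) (Var 1)).

Definition tLam : tm :=
  LetIn 11 (tPairs 0 1 10) (LetIn 12 (tPairs 2 3 10)
  (LetIn 13 (tMin (Var 11) (Var 12))
  (LetIn 14 (tMin (tMin (tOcc 4 10) (Var 0)) (Var 13))
  (LetIn 15 (tMin (tMin (tOcc 5 10) (Var 1)) (Var 13))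
  (tDiv (Times tScale (tSqrt (Times (tSucc (Var 14)) (tSucc (Var 15)))))
        (tMax (Var 11) (Var 12))))))).

(* [c] and [b] are the coordinate and the flattening block, [sv] holds the size of
   the corresponding set. *)
Definition tWeight (c b sv tv : nat) : tm :=
  LetIn 11 (tMax (tOcc b 10) (Var sv))
    (tDiv (Times tScale (Var 11)) (Plus (Var 11) (Times (Var sv) (tHits c b 10 tv)))).

(** A difference of two point masses lives on two points, so the weighted sum over the alphabet
    collapses to two terms, as [inner_sum] shows. Weights and matrices are both products, hence the
    inner product of two matrices is an X factor times a Y factor. *)
Definition tInner (c b sv : nat) : tm :=
  LetIn 30 (tCell c 0 5) (LetIn 31 (tCell c 1 6)
  (LetIn 32 (tCell c 2 7) (LetIn 33 (tCell c 3 8)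
  (Plus (Times (Minus (tEq (Var 30) (Var 32)) (tEq (Var 30) (Var 33))) (tWeight c b sv 30))
        (Times (Minus (tEq (Var 31) (Var 33)) (tEq (Var 31) (Var 32))) (tWeight c b sv 31)))))).

Definition tStat : tm :=
  Sum 5 (Var 4) (Sum 6 (Var 4) (Sum 7 (Var 4) (Sum 8 (Var 4)
  (LetIn 10 (tCell 2 0 5)
  (Times (Times (tMatched 0 1 5 6) (Times (tMatched 2 3 7 8) (tEq (tCell 2 2 7) (Var 10))))
     (Times tLam (Times (tInner 0 4 0) (tInner 1 5 1)))))))).

(** One factor [tScale] for each rounded weight in a summand: [lamN], [wN1] and [wN2]. *)
Definition tDecide : tm :=
  tLe tStat (Times (Times tScale (Times tScale tScale))
                   (Times (Lit (10 ^+ 3)) (tSqrt (tMin (Var 2) (Var 4))))).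

Section Decision.
Variables (X Y Z : finType) (m : nat) (w : {ffun 'I_6 * 'I_m -> X * Y * Z}).
Variable arr : nat -> int.

Definition code (T : finType) (t : T) : nat := enum_rank t.
Definition coord (c : nat) (u : X * Y * Z) : nat :=
  if c is 0 then code u.1.1 else if c is 1 then code u.1.2 else code u.2.

Hypothesis arrE : forall (c : nat) (b : 'I_6) (i : 'I_m), (c < 3)%N ->
  arr (3 * (b * m + i) + c)%N = (coord c (w (b, i)))%:Z.

Let zs : {ffun 'I_6 * 'I_m -> Z} := [ffun i => (w i).2].
Let xy : {ffun 'I_6 * 'I_m -> X * Y} := [ffun i => (w i).1].

Definition params (e : nat -> int) : Prop :=
  [/\ e 0%N = #|X|%:Z, e 1%N = #|Y|%:Z, e 2 = #|Z|%:Z & e 4 = m%:Z].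

Lemma params_set e v x : (4 < v)%N -> params e -> params (set_var e v x).
Proof. by case: v => [|[|[|[|[|v]]]]] // _ [h1 h2 h3 h4]; split. Qed.

Lemma code_eq (T : finType) (t t' : T) : (code t == code t') = (t == t').
Proof. by rewrite /code val_eqE (inj_eq enum_rank_inj). Qed.

Lemma den_tCell e c (b : 'I_6) iv (i : 'I_m) : (c < 3)%N -> params e ->
  e iv = (i : nat)%:Z -> den arr e (tCell c b iv) = (coord c (w (b, i)))%:Z.
Proof.
move=> c3 [_ _ _ h4] hi; rewrite /tCell /= h4 hi -PoszM -PoszD -PoszM -PoszD.
exact: arrE.
Qed.

Lemma set_varE e v x u : set_var e v x u = if u == v then x else e u.
Proof. by []. Qed.

Lemma card_sum (P : pred 'I_m) : #|P| = (\sum_(i < m) P i)%N.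
Proof. by rewrite -sum1_card big_mkcond; apply: eq_bigr => i _; rewrite unfold_in; case: (P i). Qed.

Lemma den_tOcc e (b : 'I_6) zv z : (zv < 20)%N -> params e -> e zv = (code z)%:Z ->
  den arr e (tOcc b zv) = (occ zs b z)%:Z.
Proof.
move=> zv20 pe hz; rewrite /occ card_sum.
apply: den_Sum => [|i]; first by case: pe.
have pe' := params_set (i : nat)%:Z (isT : (4 < 20)%N) pe.
rewrite (den_tEq (x := code (w (b, i)).2) (y := code z)).
- by rewrite code_eq /= ffunE.
- exact: (den_tCell b (isT : (2 < 3)%N) pe').
- by rewrite /= set_varE ltn_eqF.
Qed.

Lemma den_tRank e (b : 'I_6) iv (i : 'I_m) : (iv != 20)%N -> params e ->
  e iv = (i : nat)%:Z -> den arr e (tRank b iv) = (rank zs b i)%:Z.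
Proof.
move=> iv20 pe hi; rewrite /rank card_sum.
apply: den_Sum => [|j]; first by case: pe.
have pe' := params_set (j : nat)%:Z (isT : (4 < 20)%N) pe.
have hi' : set_var e 20 (j : nat)%:Z iv = (i : nat)%:Z by rewrite set_varE (negbTE iv20).
rewrite (den_Times (x := (j < i)%N) (y := zs (b, j) == zs (b, i))) ?mulnb //.
  by apply: den_tLe => //; exact: den_tSucc.
rewrite (den_tEq (x := code (w (b, j)).2) (y := code (w (b, i)).2)).
- by rewrite code_eq /= !ffunE.
- exact: (den_tCell b (isT : (2 < 3)%N) pe').
- exact: (den_tCell b (isT : (2 < 3)%N) pe').
Qed.

Lemma den_tMatched e (a b : 'I_6) iv jv (i j : 'I_m) : (iv != 20)%N -> (jv != 20)%N -> params e ->
  e iv = (i : nat)%:Z -> e jv = (j : nat)%:Z ->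
  den arr e (tMatched a b iv jv) = (matched zs a b (i, j))%:Z.
Proof.
move=> iv20 jv20 pe hi hj.
rewrite (den_Times (x := zs (a, i) == zs (b, j)) (y := rank zs a i == rank zs b j)) ?mulnb //.
  rewrite (den_tEq (x := code (w (a, i)).2) (y := code (w (b, j)).2)); [by rewrite code_eq /= ?ffunE| |].
    exact: (den_tCell a (isT : (2 < 3)%N) pe).
  exact: (den_tCell b (isT : (2 < 3)%N) pe).
by apply: den_tEq; apply: den_tRank.
Qed.

Lemma den_tPairs e (a b : 'I_6) zv z : (zv < 20)%N -> params e -> e zv = (code z)%:Z ->
  den arr e (tPairs a b zv) = (npairs zs a b z)%:Z.
Proof.
move=> zv20 pe hz.
have -> : npairs zs a b z =
   (\sum_(i < m) \sum_(j < m) (matched zs a b (i, j) && (zs (a, i) == z)))%N.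
  rewrite /npairs -sum1_card big_mkcond pair_bigA /=; apply: eq_bigr => -[i j] _.
  by rewrite inE /=; case: (_ && _).
apply: den_Sum => [|i]; first by case: pe.
have pe1 := params_set (i : nat)%:Z (isT : (4 < 21)%N) pe.
apply: den_Sum => [|j]; first by case: pe1.
have pe2 := params_set (j : nat)%:Z (isT : (4 < 22)%N) pe1.
rewrite (den_Times (x := matched zs a b (i, j)) (y := zs (a, i) == z)) ?mulnb //.
  exact: den_tMatched.
rewrite (den_tEq (x := code (w (a, i)).2) (y := code z)); [by rewrite code_eq /= ?ffunE| |].
  exact: (den_tCell a (isT : (2 < 3)%N) pe2).
by rewrite /= !set_varE !ltn_eqF // ltnW // ltnW.
Qed.

Lemma den_tHits e c (b : 'I_6) zv tv z (T : finType) (pr : X * Y -> T) (t : T) :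
  (c < 2)%N -> (forall u, coord c u = code (pr u.1)) ->
  (zv < 20)%N -> (tv != 20)%N -> params e -> e zv = (code z)%:Z -> e tv = (code t)%:Z ->
  den arr e (tHits c b zv tv) = (hits zs b z pr xy t)%:Z.
Proof.
move=> c2 hc zv20 tv20 pe hz ht; rewrite /hits card_sum.
apply: den_Sum => [|i]; first by case: pe.
have pe' := params_set (i : nat)%:Z (isT : (4 < 20)%N) pe.
rewrite (den_Times (x := zs (b, i) == z) (y := pr (xy (b, i)) == t)) ?mulnb //.
  rewrite (den_tEq (x := code (w (b, i)).2) (y := code z)); [by rewrite code_eq /= ?ffunE| |].
    exact: (den_tCell b (isT : (2 < 3)%N) pe').
  by rewrite /= set_varE ltn_eqF.
rewrite (den_tEq (x := coord c (w (b, i))) (y := code t)); [by rewrite hc code_eq /= ?ffunE| |].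
  by apply: (den_tCell b) => //; exact: ltnW.
by rewrite /= set_varE (negbTE tv20).
Qed.

Lemma den_tScale e : params e -> den arr e tScale = (scaleL X Y m)%:Z.
Proof. by case=> h0 h1 h2 h4; apply: den_tSucc; rewrite /= h0 h1 h4 !PoszD PoszM. Qed.

Lemma den_tLam e z : params e -> e 10 = (code z)%:Z ->
  den arr e tLam = (lamN X Y zs z)%:Z.
Proof.
move=> pe hz; rewrite /tLam.
rewrite (den_LetIn _ _ (den_tPairs (block 0) (block 1) (isT : (10 < 20)%N) pe hz)).
set e1 := set_var e _ _; have pe1 : params e1 by exact: params_set.
rewrite (den_LetIn _ _ (den_tPairs (block 2) (block 3) (isT : (10 < 20)%N) pe1 hz)).
set e2 := set_var e1 _ _; have pe2 : params e2 by exact: params_set.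
have k : den arr e2 (tMin (Var 11) (Var 12)) = (kmin zs z)%:Z by exact: den_tMin.
rewrite (den_LetIn _ _ k); set e3 := set_var e2 _ _.
have pe3 : params e3 by exact: params_set.
have f1 : den arr e3 (tMin (tMin (tOcc 4 10) (Var 0)) (Var 13)) = (flat1 X zs z)%:Z.
  apply: den_tMin => //; apply: den_tMin; last by case: pe3.
  exact: (den_tOcc (block 4)).
rewrite (den_LetIn _ _ f1); set e4 := set_var e3 _ _.
have pe4 : params e4 by exact: params_set.
have f2 : den arr e4 (tMin (tMin (tOcc 5 10) (Var 1)) (Var 13)) = (flat2 Y zs z)%:Z.
  apply: den_tMin => //; apply: den_tMin; last by case: pe4.
  exact: (den_tOcc (block 5)).
rewrite (den_LetIn _ _ f2); set e5 := set_var e4 _ _.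
have pe5 : params e5 by exact: params_set.
apply: den_tDiv; last exact: den_tMax.
apply: den_Times; first exact: den_tScale.
by apply: den_tSqrt; apply: den_Times; exact: den_tSucc.
Qed.

Lemma den_tWeight1 e tv z x : (11 < tv)%N -> (tv != 20)%N -> params e ->
  e 10 = (code z)%:Z -> e tv = (code x)%:Z -> (tv != 40)%N ->
  den arr e (tWeight 0 4 0 tv) = (wN1 zs xy z x)%:Z.
Proof.
move=> tv11 tv20 pe hz hx tv40; rewrite /tWeight.
have h : den arr e (tMax (tOcc 4 10) (Var 0)) = (maxn (occ zs (block 4) z) #|X|)%:Z.
  by apply: den_tMax; [exact: (den_tOcc (block 4))|case: pe].
rewrite (den_LetIn _ _ h); set e1 := set_var e _ _.
have pe1 : params e1 by exact: params_set.
apply: den_tDiv; first by apply: den_Times; [exact: den_tScale|].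
set e2 := set_var e1 _ _; have pe2 : params e2 by exact: params_set.
apply: den_Plus => //; apply: den_Times; first by case: pe2.
apply: (den_tHits (c := 0) (block 4) (pr := @fst X Y)) => //.
by rewrite /e2 set_varE (negbTE tv40) /e1 set_varE gtn_eqF.
Qed.

Lemma den_tWeight2 e tv z y : (11 < tv)%N -> (tv != 20)%N -> params e ->
  e 10 = (code z)%:Z -> e tv = (code y)%:Z -> (tv != 40)%N ->
  den arr e (tWeight 1 5 1 tv) = (wN2 zs xy z y)%:Z.
Proof.
move=> tv11 tv20 pe hz hx tv40; rewrite /tWeight.
have h : den arr e (tMax (tOcc 5 10) (Var 1)) = (maxn (occ zs (block 5) z) #|Y|)%:Z.
  by apply: den_tMax; [exact: (den_tOcc (block 5))|case: pe].
rewrite (den_LetIn _ _ h); set e1 := set_var e _ _.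
have pe1 : params e1 by exact: params_set.
apply: den_tDiv; first by apply: den_Times; [exact: den_tScale|].
set e2 := set_var e1 _ _; have pe2 : params e2 by exact: params_set.
apply: den_Plus => //; apply: den_Times; first by case: pe2.
apply: (den_tHits (c := 1) (block 5) (pr := @snd X Y)) => //.
by rewrite /e2 set_varE (negbTE tv40) /e1 set_varE gtn_eqF.
Qed.

Definition inner (T : finType) (wt : T -> nat) (a b c d : T) : int :=
  ((a == c)%:Z - (a == d)%:Z) * (wt a)%:Z + ((b == d)%:Z - (b == c)%:Z) * (wt b)%:Z.

Lemma den_tInner (T : finType) c bl sv (pr : X * Y -> T) (wt : T -> nat) e (z : Z) (i j i' j' : 'I_m) :
  (c < 2)%N -> (forall u, coord c u = code (pr u.1)) ->
  (forall e' tv (t : T), (11 < tv)%N -> (tv != 20)%N -> params e' -> e' 10 = (code z)%:Z ->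
     e' tv = (code t)%:Z -> (tv != 40)%N -> den arr e' (tWeight c bl sv tv) = (wt t)%:Z) ->
  params e -> e 10 = (code z)%:Z ->
  e 5 = (i : nat)%:Z -> e 6 = (j : nat)%:Z -> e 7 = (i' : nat)%:Z -> e 8 = (j' : nat)%:Z ->
  den arr e (tInner c bl sv) = inner wt (pr (xy (block 0, i))) (pr (xy (block 1, j)))
    (pr (xy (block 2, i'))) (pr (xy (block 3, j'))).
Proof.
move=> c2 hc hw pe hz h5 h6 h7 h8; have c3 : (c < 3)%N by exact: ltnW.
rewrite /tInner !ffunE.
rewrite (den_LetIn _ _ (den_tCell (block 0) c3 pe h5)) hc.
set e1 := set_var e _ _; have pe1 : params e1 by exact: params_set.
rewrite (den_LetIn _ _ (den_tCell (block 1) c3 pe1 (h6 : e1 6 = _))) hc.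
set e2 := set_var e1 _ _; have pe2 : params e2 by exact: params_set.
rewrite (den_LetIn _ _ (den_tCell (block 2) c3 pe2 (h7 : e2 7 = _))) hc.
set e3 := set_var e2 _ _; have pe3 : params e3 by exact: params_set.
rewrite (den_LetIn _ _ (den_tCell (block 3) c3 pe3 (h8 : e3 8 = _))) hc.
set e4 := set_var e3 _ _; have pe4 : params e4 by exact: params_set.
rewrite /inner -!code_eq.
have q u v (x y : T) : e4 u = (code x)%:Z -> e4 v = (code y)%:Z ->
   den arr e4 (tEq (Var u) (Var v)) = (code x == code y)%:Z.
  by move=> hx hy; exact: den_tEq.
have E1 := q 30 32 (pr (w (block 0, i)).1) (pr (w (block 2, i')).1) (erefl _) (erefl _); have E2 := q 30 33 (pr (w (block 0, i)).1) (pr (w (block 3, j')).1) (erefl _) (erefl _).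
have E3 := q 31 33 (pr (w (block 1, j)).1) (pr (w (block 3, j')).1) (erefl _) (erefl _); have E4 := q 31 32 (pr (w (block 1, j)).1) (pr (w (block 2, i')).1) (erefl _) (erefl _).
have W1 := hw e4 30 (pr (w (block 0, i)).1) isT isT pe4 (hz : e4 10 = _) (erefl _) isT.
have W2 := hw e4 31 (pr (w (block 1, j)).1) isT isT pe4 (hz : e4 10 = _) (erefl _) isT.
set w1 := tWeight c bl sv 30 in W1 *; set w2 := tWeight c bl sv 31 in W2 *.
rewrite -[LHS]/((den arr e4 (tEq (Var 30) (Var 32)) - den arr e4 (tEq (Var 30) (Var 33))) *
  den arr e4 w1 + (den arr e4 (tEq (Var 31) (Var 33)) - den arr e4 (tEq (Var 31) (Var 32))) *
  den arr e4 w2).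
by rewrite E1 E2 E3 E4 W1 W2.
Qed.

Definition intStat : int :=
  \sum_(i < m) \sum_(j < m) \sum_(i' < m) \sum_(j' < m)
  ((matched zs (block 0) (block 1) (i, j))%:Z *
   ((matched zs (block 2) (block 3) (i', j'))%:Z *
    (zs (block 2, i') == zs (block 0, i))%:Z)) *
  ((lamN X Y zs (zs (block 0, i)))%:Z *
   (inner (wN1 zs xy (zs (block 0, i))) (xy (block 0, i)).1 (xy (block 1, j)).1
      (xy (block 2, i')).1 (xy (block 3, j')).1 *
    inner (wN2 zs xy (zs (block 0, i))) (xy (block 0, i)).2 (xy (block 1, j)).2
      (xy (block 2, i')).2 (xy (block 3, j')).2)).

Lemma den_SumZ e v b f (n : nat) (F : 'I_n -> int) : den arr e b = n%:Z ->
  (forall j : 'I_n, den arr (set_var e v (j : nat)%:Z) f = F j) ->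
  den arr e (Sum v b f) = \sum_(j < n) F j.
Proof. by move=> /= -> h; apply: eq_bigr => j _; exact: h. Qed.

Lemma den_tStat e : params e -> den arr e tStat = intStat.
Proof.
move=> pe; apply: den_SumZ => [|i]; first by case: pe.
set e1 := set_var e _ _; have pe1 : params e1 by exact: params_set.
apply: den_SumZ => [|j]; first by case: pe1.
set e2 := set_var e1 _ _; have pe2 : params e2 by exact: params_set.
apply: den_SumZ => [|i']; first by case: pe2.
set e3 := set_var e2 _ _; have pe3 : params e3 by exact: params_set.
apply: den_SumZ => [|j']; first by case: pe3.
set e4 := set_var e3 _ _; have pe4 : params e4 by exact: params_set.
rewrite (den_LetIn _ _ (den_tCell (block 0) (isT : (2 < 3)%N) pe4 (erefl _ : e4 5 = (i : nat)%:Z))).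
set e5 := set_var e4 _ _; have pe5 : params e5 by exact: params_set.
have hz : e5 10 = (code (zs (block 0, i)))%:Z by rewrite ffunE.
rewrite /intStat.
have M1 := den_tMatched (block 0) (block 1) (isT : (5 != 20)%N) (isT : (6 != 20)%N) pe5
  (erefl _ : e5 5 = (i : nat)%:Z) (erefl _ : e5 6 = (j : nat)%:Z).
have M2 := den_tMatched (block 2) (block 3) (isT : (7 != 20)%N) (isT : (8 != 20)%N) pe5
  (erefl _ : e5 7 = (i' : nat)%:Z) (erefl _ : e5 8 = (j' : nat)%:Z).
have M3 : den arr e5 (tEq (tCell 2 2 7) (Var 10)) = (zs (block 2, i') == zs (block 0, i))%:Z.
  rewrite (den_tEq (x := code (w (block 2, i')).2) (y := code (zs (block 0, i)))); [by rewrite code_eq /= ?ffunE| |].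
  exact: (den_tCell (block 2) (isT : (2 < 3)%N) pe5).
  by [].
have L := den_tLam pe5 hz.
have G1 := den_tInner (c := 0) (pr := @fst X Y) (isT : (0 < 2)%N) (fun u => erefl _)
  (fun e' tv t a b c d f g => den_tWeight1 a b c d f g) pe5 hz (erefl _ : e5 5 = (i : nat)%:Z)
  (erefl _ : e5 6 = (j : nat)%:Z) (erefl _ : e5 7 = (i' : nat)%:Z) (erefl _ : e5 8 = (j' : nat)%:Z).
have G2 := den_tInner (c := 1) (pr := @snd X Y) (isT : (1 < 2)%N) (fun u => erefl _)
  (fun e' tv t a b c d f g => den_tWeight2 a b c d f g) pe5 hz (erefl _ : e5 5 = (i : nat)%:Z)
  (erefl _ : e5 6 = (j : nat)%:Z) (erefl _ : e5 7 = (i' : nat)%:Z) (erefl _ : e5 8 = (j' : nat)%:Z).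
by rewrite -M1 -M2 -M3 -L -G1 -G2.
Qed.

Lemma den_tDecide e : params e -> den arr e tDecide =
  (intStat <= (scaleL X Y m * (scaleL X Y m * scaleL X Y m))%N%:Z *
     (10 ^+ 3 * (isqrt (minn #|Z| m))%:Z))%R%:Z.
Proof.
move=> pe; rewrite /tDecide den_tLe_int den_tStat //.
have S := den_tScale pe.
have Q : den arr e (tSqrt (tMin (Var 2) (Var 4))) = (isqrt (minn #|Z| m))%:Z.
  by apply: den_tSqrt; apply: den_tMin; case: pe.
rewrite -[den arr e (Times _ _)]/((den arr e tScale * (den arr e tScale * den arr e tScale)) *
  (10 ^+ 3 * den arr e (tSqrt (tMin (Var 2) (Var 4))))).
by rewrite S Q !PoszM.
Qed.

Lemma inner_sum (R : realType) (T : finType) (wt : T -> nat) (a b c d : T) :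
  (inner wt a b c d)%:~R = \sum_t (wt t)%:R * (((a == t)%:R - (b == t)%:R) *
    ((c == t)%:R - (d == t)%:R)) :> R.
Proof.
have D (g : T -> R) x : \sum_t (x == t)%:R * g t = g x.
  rewrite (bigD1 x) //= eqxx mul1r big1 ?addr0 // => t /negbTE.
  by rewrite eq_sym => ->; rewrite mul0r.
pose g t : R := (wt t)%:R * ((c == t)%:R - (d == t)%:R).
have -> : \sum_t (wt t)%:R * (((a == t)%:R - (b == t)%:R) * ((c == t)%:R - (d == t)%:R)) =
   g a - g b.
  rewrite -(D g a) -(D g b) -sumrB; apply: eq_bigr => t _; rewrite /g; ring.
rewrite /inner /g (eq_sym c a) (eq_sym d a) (eq_sym c b) (eq_sym d b).
by rewrite rmorphD !rmorphM !rmorphB /= -!pmulrn; ring.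
Qed.

Lemma ip_cross (R : realType) z (s s' t t' : X * Y) :
  (scaleL X Y m)%:R ^+ 2 * ip (wR zs R xy z) (cross R s s') (cross R t t') =
  (inner (wN1 zs xy z) s.1 s'.1 t.1 t'.1 * inner (wN2 zs xy z) s.2 s'.2 t.2 t'.2)%:~R.
Proof.
rewrite rmorphM /= !inner_sum /ip sum_pair mulr_suml mulr_sumr; apply: eq_bigr => x _.
rewrite !mulr_sumr; apply: eq_bigr => y _; rewrite /wR /w1 /w2 /cross /=.
by field; rewrite pnatr_eq0.
Qed.

Lemma intStatE (R : realType) :
  intStat%:~R = (scaleL X Y m)%:R ^+ 3 * Atot R zs xy :> R.
Proof.
have L0 : (scaleL X Y m)%:R != 0 :> R by rewrite pnatr_eq0.
pose f (p q : 'I_m * 'I_m) : R := (scaleL X Y m)%:R ^+ 3 * (lamR X Y zs R (zs (block 0, p.1)) *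
  ip (wR zs R xy (zs (block 0, p.1))) (cross R (xy (block 0, p.1)) (xy (block 1, p.2)))
      (cross R (xy (block 2, q.1)) (xy (block 3, q.2)))).
have -> : (scaleL X Y m)%:R ^+ 3 * Atot R zs xy =
  \sum_(p | matched zs (block 0) (block 1) p)
   \sum_(q | matched zs (block 2) (block 3) q && (zs (block 2, q.1) == zs (block 0, p.1))) f p q.
  rewrite /Atot /Astat mulr_sumr; apply: eq_bigr => p _.
  by rewrite mulr_sumr; apply: eq_bigr.
rewrite /intStat [RHS]big_mkcond -(pair_bigA _ (fun i j => if matched zs (block 0) (block 1) (i, j)
   then \sum_(q | matched zs (block 2) (block 3) q && (zs (block 2, q.1) == zs (block 0, i))) f (i, j) q
   else 0)) /=.
rewrite rmorph_sum; apply: eq_bigr => i _; rewrite rmorph_sum; apply: eq_bigr => j _.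
case: (matched _ _ _ (i, j)); last first.
  by rewrite rmorph_sum big1 // => i' _; rewrite rmorph_sum big1 // => j' _; rewrite !mul0r.
rewrite [RHS]big_mkcond [RHS]sum_pair rmorph_sum; apply: eq_bigr => i' _.
rewrite rmorph_sum; apply: eq_bigr => j' _ /=; rewrite /f /= /lamR.
rewrite -PoszM mulnb; case: (_ && _); last first.
  by have -> : true%:Z * false%:Z = 0 :> int by []; rewrite mul0r.
have -> : true%:Z * true%:Z = 1 :> int by [].
rewrite !mul1r rmorphM /= -ip_cross -pmulrn.
by field.
Qed.

Lemma den_tDecide_accepts (R : realType) e : params e ->
  (0 < den arr e tDecide) = accepts R w.
Proof.
move=> pe; rewrite den_tDecide // ltz_nat lt0b /accepts -/zs -/xy /threshold.
have e3 : (10 ^+ 3 : int)%:~R = 10 ^+ 3 :> R by rewrite rmorphXn /= rmorph_nat.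
rewrite -(ler_int R) intStatE; move: e3; move: (10 ^+ 3 : int) => K e3.
rewrite !rmorphM /= e3 -!pmulrn.
set L : R := (scaleL X Y m)%:R; have L0 : 0 < L ^+ 3 by rewrite exprn_gt0 // ltr0n.
rewrite natrM natrM -/L (_ : L * (L * L) = L ^+ 3); last by ring.
by rewrite ler_pM2l.
Qed.

End Decision.

(** * The number of samples *)

Section SampleSize.

(* Each inequality asks [j] to exceed one of the terms of the sample bound, raised
   to the power that makes it a polynomial, with [E] in place of [1 / eps]. *)
Definition enough (l1 l2 n E j : nat) : bool :=
  [&& (n ^ 7 * l1 ^ 2 * l2 ^ 2 * E ^ 8 <= j ^ 8) || (n ^ 6 * l1 ^ 2 * l2 ^ 2 * E ^ 8 <= j ^ 7),
      n ^ 3 * l1 ^ 2 * l2 ^ 2 * E ^ 4 <= j ^ 4,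
      n ^ 2 * l1 ^ 2 * l2 * E ^ 4 <= j ^ 3 &
      n * l1 * l2 * E ^ 4 <= j ^ 2]%N.

(** As [enough] is monotone in [j], counting its failures below a value that satisfies it gives the
    least solution; a bounded sum replaces an unbounded search. *)
Definition size0 (l1 l2 n E : nat) : nat :=
  (\sum_(j < n * l1 * l2 * E ^ 2) ~~ enough l1 l2 n E j)%N.

Lemma enough_mono l1 l2 n E j j' : (j <= j')%N -> enough l1 l2 n E j -> enough l1 l2 n E j'.
Proof.
move=> le /and4P[h1 h2 h3 h4]; have le' k : (j ^ k <= j' ^ k)%N by case: k => // k; rewrite leq_exp2r.
apply/and4P; split; [|exact: leq_trans (le' _)..].
by case/orP: h1 => h; apply/orP; [left|right]; exact: leq_trans (le' _).
Qed.

Lemma enough_bound l1 l2 n E : (0 < l1)%N -> (0 < l2)%N -> (0 < n)%N -> (0 < E)%N ->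
  enough l1 l2 n E (n * l1 * l2 * E ^ 2).
Proof.
move=> l10 l20 n0 E0.
have le (x a b : nat) : (0 < x)%N -> (a <= b)%N -> (x ^ a <= x ^ b)%N.
  by move=> x0 ab; rewrite leq_pexp2l.
have E4 : (E ^ 4 = (E ^ 2) ^ 2)%N by rewrite -expnM.
have E8 : (E ^ 8 = (E ^ 2) ^ 4)%N by rewrite -expnM.
have D0 : (0 < E ^ 2)%N by rewrite expn_gt0 E0.
rewrite /enough E4 E8; move: (E ^ 2)%N D0 => D D0; rewrite !expnMn.
apply/and4P; split; [apply/orP; left|..]; rewrite ?leq_mul ?le //.
all: by rewrite ?expnS leq_pmulr ?muln_gt0 ?expn_gt0 ?n0 ?l10 ?l20 ?D0.
Qed.

Lemma count_until (c : pred nat) (k : nat) :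
  (forall j j', (j <= j')%N -> c j -> c j') ->
  let s := (\sum_(j < k) ~~ c j)%N in
  (c k -> c s) /\ (forall j, (j < s)%N -> ~~ c j).
Proof.
move=> mono; elim: k => [|k [IH1 IH2]] s; first by rewrite /s big_ord0.
rewrite /s {s} big_ord_recr /=; set s := (\sum_(j < k) _)%N in IH1 IH2 *.
have les : (s <= k)%N.
  apply: (@leq_trans (\sum_(j < k) 1)); first by apply: leq_sum => j _; exact: leq_b1.
  by rewrite sum_nat_const card_ord muln1.
case: (boolP (c k)) => ck; rewrite /= ?addn0 ?addn1; first by split=> // _; exact: IH1.
have sk : s = k.
  rewrite /s (eq_bigr (fun _ => 1%N)) => [|j _].
    by rewrite sum_nat_const card_ord muln1.
  by rewrite (contra (mono _ _ (ltnW (ltn_ord j))) ck).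
by rewrite sk; split=> // j; rewrite ltnS => le; apply: contra ck; exact: mono.
Qed.

End SampleSize.

Section SampleBound.
Variables (R : realType) (l1 l2 n : nat) (eps : R).
Hypotheses (l1_gt0 : (0 < l1)%N) (l2_gt0 : (0 < l2)%N) (n_gt0 : (0 < n)%N)
  (eps_gt0 : 0 < eps) (eps_le1 : eps <= 1).

Definition inv_eps : nat := `|Num.ceil eps^-1|%N.

Lemma inv_epsE : Num.ceil eps^-1 = inv_eps%:Z.
Proof. by rewrite /inv_eps gez0_abs // ceil_ge0 (lt_le_trans _ (_ : 0 <= _)) // invr_ge0 ltW. Qed.

Lemma inv_eps_ge : eps^-1 <= inv_eps%:R.
Proof. by rewrite -[_%:R]/((inv_eps%:Z)%:~R) -inv_epsE ceil_ge. Qed.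

Lemma inv_eps_ge1 : 1 <= inv_eps%:R * eps.
Proof. by have := inv_eps_ge; rewrite -ler_pdivrMr // div1r. Qed.

Lemma inv_eps_gt0 : (0 < inv_eps)%N.
Proof. by rewrite lt0n; apply/eqP => e; have := inv_eps_ge1; rewrite e mul0r ler10. Qed.

Lemma inv_eps_le : inv_eps%:R <= 2 / eps.
Proof.
have h : (inv_eps%:R : R) < eps^-1 + 1.
  by rewrite -ltrBlDr -[inv_eps%:R]/((inv_eps%:Z)%:~R) -inv_epsE -[1]/(1%:~R) -rmorphB ceilB1_lt.
have : 1 <= eps^-1 by rewrite invf_ge1.
by lra.
Qed.

Local Notation E := inv_eps.
Local Notation m0 := (size0 l1 l2 n E).

Lemma size0_enough : enough l1 l2 n E m0.
Proof.
case: (count_until (n * l1 * l2 * E ^ 2) (@enough_mono l1 l2 n E)) => h _; apply: h.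
by apply: enough_bound => //; exact: inv_eps_gt0.
Qed.

Lemma size0_least j : (j < m0)%N -> ~~ enough l1 l2 n E j.
Proof.
by case: (count_until (n * l1 * l2 * E ^ 2) (@enough_mono l1 l2 n E)) => _; apply.
Qed.

Lemma size0_gt0 : (0 < m0)%N.
Proof.
rewrite lt0n; apply/eqP => e; have := size0_enough; rewrite e => /and4P[_ _ _].
by rewrite leqn0 !muln_eq0 !eqn0Ngt n_gt0 l1_gt0 l2_gt0 inv_eps_gt0.
Qed.

Lemma powR_fracX (a b : nat) (x : R) : 0 <= x -> (0 < b)%N ->
  (x `^ (a%:R / b%:R)) ^+ b = x ^+ a.
Proof.
move=> x0 b0; rewrite -powR_mulrn ?powR_ge0 // -powRrM divfK ?powR_mulrn //.
by rewrite pnatr_eq0 -lt0n.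
Qed.

Arguments powR_fracX a b [x].

Lemma le_of_pow (x y : R) k : (0 < k)%N -> 0 <= x -> 0 <= y -> x ^+ k <= y ^+ k -> x <= y.
Proof. by move=> k0 x0 y0; rewrite ler_pXn2r. Qed.

(** The predecessor of [m0] violates an inequality, hence lies below a term of the bound with
    [inv_eps] for 1 / eps. As [inv_eps] is at most 2 / eps, this costs 2^k <= 4^q before a q-th
    root, that is a factor 4; returning from the predecessor costs another 2. *)
Lemma size0_le : m0%:R <= 8 * sample_bound l1 l2 n eps.
Proof.
have L1 : 1 <= l1%:R :> R by rewrite ler1n.
have L2 : 1 <= l2%:R :> R by rewrite ler1n.
have N1 : 1 <= n%:R :> R by rewrite ler1n.
have a0 : 0 <= l1%:R :> R by [].
have b0 : 0 <= l2%:R :> R by [].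
have c0 : 0 <= n%:R :> R by [].
rewrite /sample_bound; set T1 := _ / eps; set T2 := _ / eps `^ _; set T3 := _ / eps.
set T4 := _ / eps `^ _; set T5 := _ / eps ^+ 2.
have e0 := ltW eps_gt0.
have T1_0 : 0 <= T1 by rewrite !mulr_ge0 ?powR_ge0 ?invr_ge0.
have T2_0 : 0 <= T2 by rewrite !mulr_ge0 ?powR_ge0 ?invr_ge0 ?powR_ge0.
have T3_0 : 0 <= T3 by rewrite !mulr_ge0 ?powR_ge0 ?invr_ge0.
have T4_0 : 0 <= T4 by rewrite !mulr_ge0 ?powR_ge0 ?invr_ge0 ?powR_ge0.
have T5_0 : 0 <= T5 by rewrite !mulr_ge0 ?powR_ge0 ?invr_ge0 ?exprn_ge0.
have E2 := inv_eps_le.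
have Ek k : (E ^ k)%:R <= 2 ^+ k / eps ^+ k :> R.
  by rewrite natrX -expr_div_n lerXn2r // nnegrE // divr_ge0.
have P1 : T1 ^+ 8 = n%:R ^+ 7 * l1%:R ^+ 2 * l2%:R ^+ 2 / eps ^+ 8.
  rewrite !exprMn exprVn (powR_fracX 7 8) // (_ : 1 / 4 = 2 / 8) ?(powR_fracX 2 8) //.
  by field.
have P2 : T2 ^+ 7 = n%:R ^+ 6 * l1%:R ^+ 2 * l2%:R ^+ 2 / eps ^+ 8.
  by rewrite !exprMn exprVn (powR_fracX 6 7) // !(powR_fracX 2 7) // (powR_fracX 8 7).
have P3 : T3 ^+ 4 = n%:R ^+ 3 * l1%:R ^+ 2 * l2%:R ^+ 2 / eps ^+ 4.
  rewrite !exprMn exprVn (powR_fracX 3 4) // (_ : 1 / 2 = 2 / 4) ?(powR_fracX 2 4) //.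
  by field.
have P4 : T4 ^+ 3 = n%:R ^+ 2 * l1%:R ^+ 2 * l2%:R / eps ^+ 4.
  by rewrite !exprMn exprVn !(powR_fracX 2 3) // (powR_fracX 1 3) // (powR_fracX 4 3).
have P5 : T5 ^+ 2 = n%:R * l1%:R * l2%:R / eps ^+ 4.
  by rewrite !exprMn exprVn !(powR_fracX 1 2) // -exprM.
have T5_1 : 1 <= T5.
  apply: (@le_of_pow _ _ 2) => //; rewrite expr1n P5 ler_pdivlMr ?exprn_gt0 // mul1r.
  apply: (@le_trans _ _ 1); first by rewrite exprn_ile1.
  by rewrite mulr_ege1 ?mulr_ege1.
set S := Num.max _ _.
have S5 : T5 <= S by rewrite !le_max lexx !orbT.
have S4 : T4 <= S by rewrite !le_max lexx !orbT.
have S3 : T3 <= S by rewrite !le_max lexx !orbT.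
have S12 : Num.min T1 T2 <= S by rewrite le_max lexx.
(* Comparing [m0] with twice its predecessor needs [m0 >= 2]; below that, the bound itself is at
   least 1. *)
case: (ltnP m0 2) => [|m2].
  rewrite ltnS => m1; apply: (@le_trans _ _ 1); first by rewrite -[1]/(1%:R) ler_nat.
  by lra.
have [j mj] : exists j, m0 = j.+2 by case: (m0) m2 => [|[|j]] // _; exists j.
have fail : ~~ enough l1 l2 n E j.+1 by apply: size0_least; rewrite mj.
suff h : j.+1%:R <= 4 * S.
  apply: (@le_trans _ _ (2 * j.+1%:R)); last by lra.
  by rewrite mj -natrM ler_nat; clear; lia.
have key q k (x : nat) (T : R) : (0 < q)%N -> 0 <= T -> T ^+ q = x%:R / eps ^+ k ->
    (2 ^ k <= 4 ^ q)%N -> (j.+1 ^ q < x * E ^ k)%N -> j.+1%:R <= 4 * T.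
  move=> q0 T0 TE le24 lt; apply: (@le_of_pow _ _ q) => //; first by rewrite mulr_ge0.
  apply: (@le_trans _ _ (x%:R * (2 ^+ k / eps ^+ k))).
    apply: (@le_trans _ _ (x%:R * (E ^ k)%:R)); last by rewrite ler_wpM2l.
    by rewrite -natrX -natrM ler_nat ltnW.
  rewrite exprMn TE (mulrC (x%:R)) -mulrA (mulrC _ x%:R) ler_wpM2r //.
    by rewrite divr_ge0 // exprn_ge0.
  by rewrite -!natrX ler_nat.
have M3 a b c : (a * b * c)%N%:R = a%:R * b%:R * c%:R :> R by rewrite !natrM.
move: fail; rewrite !negb_and negb_or -!ltnNge => /or4P[/andP[h1 h2]|h|h|h].
(* A disjunction fails only if both alternatives fail, which matches the minimum of the two
   terms. *)
- suff : j.+1%:R <= 4 * Num.min T1 T2 by move: S12; lra.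
  rewrite minr_pMr // le_min; apply/andP; split.
    by apply: key h1 => //; rewrite P1 M3 !natrX.
  by apply: key h2 => //; rewrite P2 M3 !natrX.
- suff : j.+1%:R <= 4 * T3 by move: S3; lra.
  by apply: key h => //; rewrite P3 M3 !natrX.
- suff : j.+1%:R <= 4 * T4 by move: S4; lra.
  by apply: key h => //; rewrite P4 M3 !natrX.
- suff : j.+1%:R <= 4 * T5 by move: S5; lra.
  by apply: key h => //; rewrite P5 M3.
Qed.

End SampleBound.

(** * The program *)

Fixpoint tPow (a : tm) (k : nat) : tm := if k is k'.+1 then Times a (tPow a k') else Lit 1.

Definition tOr a b := IfPos (Plus a b) (Lit 1) (Lit 0).

Definition tMonomial (k2 k0 k1 k3 : nat) : tm :=
  Times (Times (Times (tPow (Var 2) k2) (tPow (Var 0) k0)) (tPow (Var 1) k1)) (tPow (Var 3) k3).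

Definition tEnough : tm :=
  Times (tOr (tLe (tMonomial 7 2 2 8) (tPow (Var 5) 8)) (tLe (tMonomial 6 2 2 8) (tPow (Var 5) 7)))
 (Times (tLe (tMonomial 3 2 2 4) (tPow (Var 5) 4))
 (Times (tLe (tMonomial 2 2 1 4) (tPow (Var 5) 3))
        (tLe (tMonomial 1 1 1 4) (tPow (Var 5) 2)))).

Definition tSize (A : nat) : tm :=
  Times (Lit A%:Z) (Sum 5 (tMonomial 1 1 1 2) (Minus (Lit 1) tEnough)).

Lemma den_tPow arr e a k (x : nat) : den arr e a = x%:Z -> den arr e (tPow a k) = (x ^ k)%N%:Z.
Proof. by move=> ha; elim: k => [|k IH] //=; rewrite IH ha -PoszM expnS. Qed.

Lemma den_tOr arr e a b (x y : bool) : den arr e a = x%:Z -> den arr e b = y%:Z ->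
  den arr e (tOr a b) = (x || y)%:Z.
Proof. by rewrite /tOr /= => -> ->; case: x; case: y. Qed.

Section SizeTerm.
Variables (arr e : nat -> int) (l1 l2 n E : nat).
Hypotheses (e0 : e 0 = l1%:Z) (e1 : e 1 = l2%:Z) (e2 : e 2 = n%:Z) (e3 : e 3 = E%:Z).

Lemma den_tMonomial k2 k0 k1 k3 : den arr e (tMonomial k2 k0 k1 k3) =
  (n ^ k2 * l1 ^ k0 * l2 ^ k1 * E ^ k3)%N%:Z.
Proof. by apply: den_Times; [apply: den_Times; [apply: den_Times|]|]; exact: den_tPow. Qed.

Lemma den_tEnough j : e 5 = j%:Z -> den arr e tEnough = (enough l1 l2 n E j)%:Z.
Proof.
move=> e5; have P k : den arr e (tPow (Var 5) k) = (j ^ k)%N%:Z by exact: den_tPow.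
have L k2 k0 k1 k3 k : den arr e (tLe (tMonomial k2 k0 k1 k3) (tPow (Var 5) k)) =
   (n ^ k2 * l1 ^ k0 * l2 ^ k1 * E ^ k3 <= j ^ k)%N%:Z.
  by apply: den_tLe; [exact: den_tMonomial|exact: P].
rewrite /enough -!mulnb; apply: den_Times; first by apply: den_tOr; exact: L.
apply: den_Times; first exact: L.
apply: den_Times; first by have := L 2 2 1 4 3; rewrite expn1.
by have := L 1 1 1 4 2; rewrite !expn1.
Qed.
End SizeTerm.

Lemma den_tSize arr e (A l1 l2 n E : nat) :
  e 0 = l1%:Z -> e 1 = l2%:Z -> e 2 = n%:Z -> e 3 = E%:Z ->
  den arr e (tSize A) = (A * size0 l1 l2 n E)%N%:Z.
Proof.
move=> e0 e1 e2 e3; apply: den_Times => //; rewrite /size0.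
apply: den_Sum => [|j].
  by rewrite (den_tMonomial _ e0 e1 e2 e3) !expn1.
set e' := set_var _ _ _.
have h : den arr e' tEnough = (enough l1 l2 n E j)%:Z by exact: den_tEnough.
rewrite -[LHS]/(1 - den arr e' tEnough) h.
by case: (enough _ _ _ _ _).
Qed.

Definition read_loop : cmd :=
  While (rvar 5) (Seq (Draw (rvar 6)) (Seq (wvar 6 (Add (rvar 6) (Cst 3)))
    (wvar 5 (Sub (rvar 5) (Cst 1))))).

Definition comp (c : nat) (t : nat * nat * nat) : nat :=
  if c is 0 then t.1.1 else if c is 1 then t.1.2 else t.2.

(** [q] counts the samples already stored, so that the induction on [s] can move the write address;
    a round takes 6 steps. *)
Lemma read_loop_ok (s : seq (nat * nat * nat)) (q : nat) (M : memory) :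
  M (var_addr 5) = (size s)%:Z -> M (var_addr 6) = (3 * q)%N%:Z ->
  exists M', [/\ forall k ss bs,
      iter (size s * 6).+1 step (Config (read_loop :: k) M (s ++ ss) bs) = Config k M' ss bs,
    forall i c, (i < size s)%N -> (c < 3)%N ->
      M' (3 * (q + i) + c)%N%:Z = (comp c (nth (0, 0, 0)%N s i))%:Z,
    forall k : nat, (k < 3 * q)%N || (3 * (q + size s) <= k)%N -> M' k%:Z = M k%:Z,
    M' (var_addr 5) = 0 /\ M' (var_addr 6) = (3 * (q + size s))%N%:Z &
    forall v, v != 5 -> v != 6 -> M' (var_addr v) = M (var_addr v)].
Proof.
elim: s q M => [|[[x y] z] s IH] q M h5 h6.
  exists M; split=> //; first by move=> k ss bs /=; rewrite h5.
  by rewrite addn0.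
pose a0 := (3 * q)%N%:Z.
pose M1 := upd (upd (upd M a0 x%:Z) (a0 + 1) y%:Z) (a0 + 2) z%:Z.
pose M2 := upd M1 (var_addr 6) (3 * q.+1)%N%:Z.
pose M3 := upd M2 (var_addr 5) (size s)%:Z.
have M3pos (k : nat) : M3 k%:Z = M1 k%:Z by rewrite /M3 /M2 /upd !addrE.
have v5 : M3 (var_addr 5) = (size s)%:Z by rewrite /M3 upd_same.
have v6 : M3 (var_addr 6) = (3 * q.+1)%N%:Z by rewrite /M3 /M2; read_mem.
have [M' [run cells other [w5 w6] vars]] := IH q.+1 M3 v5 v6.
have a1 : a0 + 1 = (3 * q + 1)%N%:Z by rewrite /a0 PoszD.
have a2 : a0 + 2 = (3 * q + 2)%N%:Z by rewrite /a0 PoszD.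
exists M'; split.
- move=> k ss bs; have -> : ((size ((x, y, z) :: s) * 6).+1 = (size s * 6).+1 + 6)%N.
    by rewrite /=; lia.
  rewrite iterD -run; congr (iter _ _ _).
  rewrite [LHS]/= h5 /= h6 -/a0 -/M1.
  congr Config; rewrite /M3 /M2.
  have e6 : M1 (var_addr 6) = a0 by rewrite /M1 /a0 a1 a2 /upd /= h6.
  have e5 : M1 (var_addr 5) = (size s).+1%:Z by rewrite /M1 /a0 a1 a2 /upd /= h5.
  rewrite e6; have -> : a0 + 3 = (3 * q.+1)%N%:Z by rewrite /a0; lia.
  congr (upd _ _ _); rewrite upd_diff // e5; lia.
- move=> [|i] c /= lti c3; last by rewrite -(cells i c) // addSnnS.
  rewrite addn0 other ?M3pos; last by apply/orP; left; lia.
  rewrite /M1 a1 a2 /a0; case: c c3 => [|[|[|c]]] // _; rewrite /upd /= ?addn0 ?eqxx //.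
  + by do 2?[case: eqP => [[]|_]; first by lia].
  + by case: eqP => [[]|_]; first by lia.
- move=> k hk; rewrite /= in hk; rewrite other ?M3pos; last by move: hk; lia.
  rewrite /M1 a1 a2 /a0 /upd; do 3?[case: eqP => [[]|_]; first by move: hk; lia].
  by [].
- by rewrite w5 w6; split=> //; congr Posz; rewrite /=; lia.
- move=> v n5 n6; rewrite vars // /M3 /M2 /M1 a1 a2 /a0 /upd !addrE.
  by rewrite (negbTE n5) (negbTE n6).
Qed.

(** The samples are stored from address 0 on and overwrite the input, which is therefore copied to
    variables beforehand. Variable 6, the write address, relies on the initial memory being 0
    there. *)
Definition tester (A : nat) : cmd :=
  Seq (Seq (wvar 0 (Cell (Cst 0))) (Seq (wvar 1 (Cell (Cst 1)))
      (Seq (wvar 2 (Cell (Cst 2))) (wvar 3 (Cell (Cst 3))))))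
 (Seq (compile (tSize A) 0)
 (Seq (wvar 4 (rtmp 0))
 (Seq (compile (Times (Lit 6) (Var 4)) 0)
 (Seq (wvar 5 (rtmp 0))
 (Seq read_loop
 (Seq (compile tDecide 0)
      (Assign (Cst 0) (rtmp 0)))))))).

Lemma iter_seq_config n1 n2 c1 c2 M k ss bs h g :
  iter n1 step (Config [:: c1, c2 & k] M ss bs) = h -> iter n2 step h = g ->
  iter (n2 + n1).+1 step (Config (Seq c1 c2 :: k) M ss bs) = g.
Proof. by move=> <- <-; rewrite iterSr iterD. Qed.

Lemma iter_seq n1 n2 c1 c2 M M1 k ss bs g : Run n1 c1 M M1 ->
  iter n2 step (Config (c2 :: k) M1 ss bs) = g ->
  iter (n2 + n1).+1 step (Config (Seq c1 c2 :: k) M ss bs) = g.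
Proof. by move=> h1; apply: iter_seq_config; exact: h1. Qed.

Lemma upd_le (M : memory) a x B : (forall a, (`|M a| <= B)%N) -> (`|x| <= B)%N ->
  forall b, (`|upd M a x b| <= B)%N.
Proof. by move=> hM hx b; rewrite /upd; case: ifP. Qed.

Lemma tester_run A : exists K, forall (l1 l2 n E : nat) (s : seq (nat * nat * nat)),
  (0 < l1)%N -> (0 < l2)%N -> (0 < n)%N -> (0 < E)%N ->
  size s = (6 * (A * size0 l1 l2 n E))%N ->
  (forall i c, (comp c (nth (0, 0, 0)%N s i) <= l1 * l2 * n * E)%N) ->
  exists N M' arr e, [/\ (N <= (2 * (l1 * l2 * n * E)) ^ K)%N,
    forall bs, iter N step (Config [:: tester A]
      (init_mem [:: l1%:Z; l2%:Z; n%:Z; E%:Z]) s bs) = Config [::] M' [::] bs,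
    M' 0 = den arr e tDecide,
    [/\ e 0 = l1%:Z, e 1 = l2%:Z, e 2 = n%:Z & e 4 = (A * size0 l1 l2 n E)%N%:Z] &
    forall i c, (i < size s)%N -> (c < 3)%N ->
      arr (3 * i + c)%N = (comp c (nth (0, 0, 0)%N s i))%:Z].
Proof.
have [Kd hd] := den_bound (tSize A).
have [K1 hK1] := compile_ok (tSize A).
have [K2 hK2] := compile_ok (Times (Lit 6) (Var 4)).
have [K3 hK3] := compile_ok tDecide.
pose Kf := (Kd + 7)%N; pose Q := (40 + K1 + Kf * K2 + Kf * K3 + Kd + 6)%N.
exists (Q + 3)%N => l1 l2 n E s l10 l20 n0 E0 sz hs.
set S := (l1 * l2 * n * E)%N in hs *; set m := (A * size0 l1 l2 n E)%N in sz *.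
have S0 : (0 < S)%N by rewrite !muln_gt0 l10 l20 n0 E0.
(* Doubling guarantees a base above 1 even if all parameters are 1. *)
pose B := (2 * S)%N; have B2 : (1 < B)%N by rewrite /B; lia.
have SB : (S <= B)%N by rewrite /B; lia.
have l1S : (l1 <= S)%N by apply: dvdn_leq S0 _; do 3![apply: dvdn_mulr].
have l2S : (l2 <= S)%N by apply: dvdn_leq S0 _; do 2![apply: dvdn_mulr]; exact: dvdn_mull.
have nS : (n <= S)%N by apply: dvdn_leq S0 _; apply: dvdn_mulr; exact: dvdn_mull.
have ES : (E <= S)%N by apply: dvdn_leq S0 _; exact: dvdn_mull.
set M0 := init_mem _.
have M0b a : (`|M0 a| <= S)%N by case: a => [[|[|[|[|k]]]]|k] //=; rewrite nth_nil.
pose Ma := upd M0 (var_addr 0) l1%:Z; pose Mb := upd Ma (var_addr 1) l2%:Z.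
pose Mc := upd Mb (var_addr 2) n%:Z; pose Md := upd Mc (var_addr 3) E%:Z.
have Mdb a : (`|Md a| <= S)%N by do 4![apply: upd_le => // {a} a].
have Mdpos (k : nat) : Md k%:Z = M0 k%:Z by [].
have runcopy : Run (((1 + 1).+1 + 1).+1 + 1).+1
   (Seq (wvar 0 (Cell (Cst 0))) (Seq (wvar 1 (Cell (Cst 1)))
      (Seq (wvar 2 (Cell (Cst 2))) (wvar 3 (Cell (Cst 3)))))) M0 Md by [].
pose envM (M : memory) v := M (var_addr v); pose arrM (M : memory) (k : nat) := M k%:Z.
have holdsM M : holds_env M (arrM M) (envM M) by [].
have bd M b : (forall a, (`|M a| <= b)%N) -> bounded b (arrM M) /\ bounded b (envM M).
  by move=> h; split=> v; exact: h.
have MdB a : (`|Md a| <= B)%N by exact: leq_trans (Mdb a) SB.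
have [bda bde] := bd _ _ MdB.
have sizeE : den (arrM Md) (envM Md) (tSize A) = m%:Z by exact: den_tSize.
have mB : (m <= B ^ Kd)%N by have := hd B _ _ B2 bda bde; rewrite sizeE.
have [n1 [M1 [le1 run1 v1 s1]]] := hK1 B _ _ Md 0 B2 bda bde (holdsM Md).
rewrite sizeE in v1.
pose M2 := upd M1 (var_addr 4) m%:Z.
(* The memory will contain [m] and addresses up to 18 m, which are bounded by a higher power of [B]
   only; the remaining code is run with this power as its base. *)
pose Bf := (B ^ Kf)%N; have Bf2 : (1 < Bf)%N by apply: ltn1_exp => //; rewrite /Kf; lia.
have BBf : (B <= Bf)%N by rewrite /Bf -{1}(expn1 B) leq_exp2l // /Kf; lia.
have c64 : (64 <= B ^ 6)%N by have := leq_exp2r 2 B (isT : (0 < 6)%N); rewrite B2 => /esym.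
have mBf : (64 * m <= Bf)%N.
  rewrite /Bf /Kf (_ : (Kd + 7 = 6 + Kd + 1)%N); last by lia.
  rewrite expnD expnD expn1; apply: (@leq_trans (B ^ 6 * B ^ Kd)%N); first exact: leq_mul.
  by rewrite leq_pmulr // ltnW.
have e1 v : M1 (var_addr v) = Md (var_addr v) by exact: same_but_var s1.
have p1 (k : nat) : M1 k%:Z = Md k%:Z by exact: same_but_pos s1.
have M2v v : (`|envM M2 v| <= Bf)%N.
  rewrite /envM /M2 /upd; case: ifP => _ /=; first by lia.
  by rewrite e1; exact: leq_trans (MdB _) BBf.
have M2a k : (`|arrM M2 k| <= Bf)%N.
  by rewrite /arrM /M2 upd_diff // p1; exact: leq_trans (MdB _) BBf.
have [n2 [M3 [le2 run2 v2 s2]]] := hK2 Bf _ _ M2 0 Bf2 M2a M2v (holdsM M2).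
have e24 : envM M2 4 = m%:Z by rewrite /envM /M2 upd_same.
rewrite /= e24 in v2.
pose M4 := upd M3 (var_addr 5) (6 * m)%N%:Z.
have e3 v : M3 (var_addr v) = M2 (var_addr v) by exact: same_but_var s2.
have p3 (k : nat) : M3 k%:Z = M2 k%:Z by exact: same_but_pos s2.
have M4_5 : M4 (var_addr 5) = (size s)%:Z by rewrite /M4 upd_same sz.
have M4_6 : M4 (var_addr 6) = (3 * 0)%N%:Z.
  by rewrite /M4 upd_diff ?addrE // e3 /M2 upd_diff ?addrE // e1.
have [M5 [run5 cells5 other5 [w5 w6] vars5]] := read_loop_ok M4_5 M4_6.
have vars5' v : v != 4 -> v != 5 -> v != 6 -> M5 (var_addr v) = Md (var_addr v).
  move=> n4 n5 n6; rewrite vars5 // /M4 upd_diff ?addrE // e3 /M2 upd_diff ?addrE //.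
have M5_4 : M5 (var_addr 4) = m%:Z.
  by rewrite vars5 // /M4 upd_diff ?addrE // e3 /M2 upd_same.
have M5v v : (`|envM M5 v| <= Bf)%N.
  rewrite /envM; case: (eqVneq v 4) => [->|n4]; first by rewrite M5_4 /=; lia.
  case: (eqVneq v 5) => [->|n5]; first by rewrite w5.
  case: (eqVneq v 6) => [->|n6]; first by rewrite w6 sz /=; lia.
  by rewrite vars5' //; exact: leq_trans (MdB _) BBf.
have M5a k : (`|arrM M5 k| <= Bf)%N.
  rewrite /arrM; case: (ltnP k (3 * size s)) => hk.
    have := cells5 (k %/ 3)%N (k %% 3)%N.
    rewrite ltn_divLR // mulnC hk ltn_mod add0n mulnC -divn_eq => -> //=.
    by apply: leq_trans (hs _ _) _; exact: leq_trans SB BBf.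
  rewrite other5; last by rewrite add0n hk orbT.
  rewrite /M4 upd_diff // p3 /M2 upd_diff // p1; exact: leq_trans (MdB _) BBf.
have [n6 [M6 [le6 run6 v6 s6]]] := hK3 Bf _ _ M5 0 Bf2 M5a M5v (holdsM M5).
pose M7 := upd M6 0 (M6 (tmp_addr 0)).
exists (((((((1 + n6).+1 + (size s * 6).+1).+1 + 1).+1 + n2).+1 + 1).+1 + n1).+1 + 7).+1, M7.
exists (arrM M5), (envM M5); split.
- have le2' : (n2 <= B ^ (Kf * K2))%N by rewrite expnM.
  have le6' : (n6 <= B ^ (Kf * K3))%N by rewrite expnM.
  have up a : (a <= Q)%N -> (B ^ a <= B ^ Q)%N by move=> h; rewrite leq_exp2l.
  have u1 := leq_trans le1 (up K1 (_ : _ <= Q)%N).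
  have u2 := leq_trans le2' (up (Kf * K2)%N (_ : _ <= Q)%N).
  have u6 := leq_trans le6' (up (Kf * K3)%N (_ : _ <= Q)%N).
  have um : (size s * 6 <= B ^ Q)%N.
    apply: (@leq_trans (B ^ 6 * B ^ Kd)%N); first by rewrite sz; nia.
    by rewrite -expnD; apply: up; rewrite /Q; lia.
  have uc : (40 <= B ^ Q)%N.
    by apply: leq_trans (poly_const B2 40) (up _ _); rewrite /Q; lia.
  have q1 : (K1 <= Q)%N by rewrite /Q; lia.
  have q2 : (Kf * K2 <= Q)%N by rewrite /Q; lia.
  have q3 : (Kf * K3 <= Q)%N by rewrite /Q; lia.
  have {}u1 := u1 q1; have {}u2 := u2 q2; have {}u6 := u6 q3.
  rewrite -/B expnD; have c8 : (8 <= B ^ 3)%N.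
    by have := leq_exp2r 2 B (isT : (0 < 3)%N); rewrite B2 => /esym.
  apply: (@leq_trans (B ^ Q * 8)%N); last by rewrite leq_mul.
  by move: (B ^ Q)%N (size s * 6)%N u1 u2 u6 um uc => b t; lia.
- move=> bs; apply: (iter_seq runcopy); apply: (iter_seq run1).
  apply: (iter_seq (M1 := M2)); first by rewrite /M2 -v1; exact: Run_assign.
  apply: (iter_seq run2); apply: (iter_seq (M1 := M4)).
    by rewrite /M4 PoszM -v2; exact: Run_assign.
  have := run5 [:: Seq (compile tDecide 0) (Assign (Cst 0) (rtmp 0))] [::] bs.
  rewrite cats0 => run5'; apply: (iter_seq_config run5').
  by apply: (iter_seq run6).
- by rewrite /M7 upd_same v6.
- by rewrite /envM M5_4 !vars5'.
- by move=> i c hi hc; rewrite /arrM -[i in LHS]add0n; exact: cells5.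
Qed.

(** * From the computed sample size to the inequalities behind the typical signal *)

Section SampleConditions.
Variables (R : realType) (l1 l2 n A : nat) (eps : R).
Hypotheses (l1_gt0 : (0 < l1)%N) (l2_gt0 : (0 < l2)%N) (n_gt0 : (0 < n)%N)
  (eps_gt0 : 0 < eps) (A_ge : 10 ^+ 11 <= A%:R :> R).
Let m0 := size0 l1 l2 n (inv_eps eps).
Let m := (A * m0)%N.
Let M : R := m%:R.

(** Multiplying the size by [A] gains A^a in an inequality of degree a, and E * eps >= 1 removes the
    powers of E. The tightest case is a = 2 with 10^22, which dictates 10^11. *)
Let pow_ge a k b (x : nat) : (10 ^+ b <= (10 ^+ 11) ^+ a :> R) ->
  (x * inv_eps eps ^ k <= m0 ^ a)%N -> 10 ^+ b * x%:R <= M ^+ a * eps ^+ k.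
Proof.
move=> hb h; have E1 := inv_eps_ge1 eps_gt0.
have e0 := ltW eps_gt0; have ek : 0 <= eps ^+ k by rewrite exprn_ge0.
have h1 : x%:R * (inv_eps eps)%:R ^+ k <= m0%:R ^+ a :> R by rewrite -!natrX -natrM ler_nat.
have h2 : x%:R <= m0%:R ^+ a * eps ^+ k :> R.
  apply: le_trans (ler_wpM2r ek h1); rewrite -mulrA -exprMn ler_peMr //.
  exact: exprn_ege1.
have h3 : 10 ^+ b <= A%:R ^+ a :> R.
  by apply: le_trans hb _; rewrite lerXn2r ?nnegrE ?exprn_ge0.
by rewrite /M /m natrM exprMn -mulrA; apply: ler_pM.
Qed.

Let ten_pow b a : (b <= 11 * a)%N -> 10 ^+ b <= (10 ^+ 11) ^+ a :> R.
Proof. by move=> h; rewrite -exprM ler_eXn2l // ltr1n. Qed.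

Lemma sample_conditions :
  [/\ 10 ^+ 42 * (l1%:R * l2%:R) ^+ 2 * n%:R ^+ 6 * (minn n m)%:R <= (M * eps) ^+ 8,
      10 ^+ 22 * (l1%:R * l2%:R) ^+ 2 * n%:R ^+ 3 <= (M * eps) ^+ 4,
      10 ^+ 22 * l1%:R ^+ 2 * l2%:R * n%:R ^+ 2 <= M ^+ 3 * eps ^+ 4 &
      10 ^+ 22 * l1%:R * l2%:R * n%:R <= M ^+ 2 * eps ^+ 4].
Proof.
have /and4P[h1 h2 h3 h4] := size0_enough l1_gt0 l2_gt0 n_gt0 eps_gt0.
have M3 a b c : (a * b * c)%N%:R = a%:R * b%:R * c%:R :> R by rewrite !natrM.
split.
(* In one alternative [minn n m] is bounded by [n], in the other by [m], where the missing power of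
   [M] is multiplied back. *)
- case/orP: h1 => h.
    have := pow_ge (b := 42) (ten_pow (b := 42) (a := 8) isT) h; rewrite M3 !natrX -exprMn.
    apply: le_trans; move: (10 ^+ 42) (exprn_ge0 42 (ler0n R 10)) => K K0.
    have c : (minn n m)%:R <= n%:R :> R by rewrite ler_nat geq_minl.
    have := ler_wpM2l (_ : 0 <= K * (l1%:R * l2%:R) ^+ 2 * n%:R ^+ 6) c.
    rewrite !mulr_ge0 ?exprn_ge0 ?mulr_ge0 // => /(_ isT) /le_trans; apply.
    by rewrite le_eqVlt; apply/orP; left; apply/eqP; ring.
  have := pow_ge (b := 42) (ten_pow (b := 42) (a := 7) isT) h; rewrite M3 !natrX.
  move=> /(ler_wpM2l (ler0n R m)).
  move: (10 ^+ 42) (exprn_ge0 42 (ler0n R 10)) => K K0 le.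
  have c : (minn n m)%:R <= m%:R :> R by rewrite ler_nat geq_minr.
  have := ler_wpM2l (_ : 0 <= K * (l1%:R * l2%:R) ^+ 2 * n%:R ^+ 6) c.
  rewrite !mulr_ge0 ?exprn_ge0 ?mulr_ge0 // => /(_ isT) /le_trans; apply.
  apply: le_trans (le_trans (_ : _ <= _) le) _.
    by rewrite le_eqVlt; apply/orP; left; apply/eqP; ring.
  by rewrite le_eqVlt; apply/orP; left; apply/eqP; rewrite /M; ring.
- have := pow_ge (b := 22) (ten_pow (b := 22) (a := 4) isT) h2; rewrite M3 !natrX -exprMn.
  apply: le_trans; move: (10 ^+ 22) => K.
  by rewrite le_eqVlt; apply/orP; left; apply/eqP; ring.
- have := pow_ge (b := 22) (ten_pow (b := 22) (a := 3) isT) h3; rewrite M3 !natrX.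
  apply: le_trans; move: (10 ^+ 22) => K.
  by rewrite le_eqVlt; apply/orP; left; apply/eqP; ring.
- have := pow_ge (b := 22) (ten_pow (b := 22) (a := 2) isT) h4; rewrite M3.
  apply: le_trans; move: (10 ^+ 22) => K.
  by rewrite le_eqVlt; apply/orP; left; apply/eqP; ring.
Qed.

End SampleConditions.

(** * Tuples of samples as families indexed by block and position *)

Section Tuples.
Variables (R : realType) (W : finType) (m : nat) (p : W -> R).

Lemma flat_index_lt (bi : 'I_6 * 'I_m) : (bi.1 * m + bi.2 < 6 * m)%N.
Proof.
case: bi => b i /=; have := ltn_ord i; have := ltn_ord b => hb hi.
have : (b.+1 * m <= 6 * m)%N by rewrite leq_mul2r hb orbT.
by rewrite mulSn; lia.
Qed.

Definition flat_index (bi : 'I_6 * 'I_m) : 'I_(6 * m) := Ordinal (flat_index_lt bi).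

Lemma flat_index_bij : bijective flat_index.
Proof.
apply: inj_card_bij; last by rewrite card_prod !card_ord.
move=> [b i] [b' i'] /(congr1 val) /= e.
have eb : b = b' :> nat.
  have m0 : (0 < m)%N by apply: leq_ltn_trans (ltn_ord i).
  by have := congr1 (fun x => x %/ m)%N e; rewrite !divnMDl // !divn_small // !addn0.
have ei : i = i' :> nat by move: e; rewrite eb => /addnI.
by congr pair; apply: val_inj.
Qed.

Definition of_tuple (s : (6 * m).-tuple W) : {ffun 'I_6 * 'I_m -> W} :=
  [ffun bi => tnth s (flat_index bi)].

Lemma of_tuple_bij : bijective of_tuple.
Proof.
apply: inj_card_bij; last by rewrite card_tuple card_ffun card_prod !card_ord.
move=> s s' e; apply: eq_from_tnth => k; have [g gK fK] := flat_index_bij.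
by have := congr1 (fun f : {ffun _ -> _} => f (g k)) e; rewrite !ffunE fK.
Qed.

Lemma sum_tuples (f : {ffun 'I_6 * 'I_m -> W} -> R) :
  \sum_(s : (6 * m).-tuple W) (\prod_(i < 6 * m) p (tnth s i)) * f (of_tuple s) =
  Ex (fun _ => p) f.
Proof.
rewrite /Ex [RHS](reindex of_tuple) /=; last exact: onW_bij of_tuple_bij.
apply: eq_bigr => s _; congr (_ * _).
rewrite (reindex flat_index) /=; last exact: onW_bij flat_index_bij.
by apply: eq_bigr => bi _; rewrite ffunE.
Qed.

End Tuples.

(** * Correctness and running time of the program *)

Section Tester.
Variable R : realType.

Lemma tester_correct (A : nat) : 10 ^+ 11 <= A%:R :> R -> exists K : nat,
  forall (X Y Z : finType) (eps : R), (0 < #|Y|)%N -> (0 < #|Z|)%N -> (#|Y| <= #|X|)%N ->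
  0 < eps -> eps <= 1 ->
  is_tester X Y Z (tester A) eps (6 * (A * size0 #|X| #|Y| #|Z| (inv_eps eps)))
    (time_bound K #|X| #|Y| #|Z| eps).
Proof.
move=> A_ge; have [K0 run] := tester_run A.
(* In [time_bound] the same [K] is factor and exponent, and (2 S)^K0 = 2^K0 * S^K0. *)
exists (2 ^ K0 + K0)%N => X Y Z eps Y0 Z0 leYX eps0 eps1.
have X0 : (0 < #|X|)%N by exact: leq_trans Y0 leYX.
have E0 := inv_eps_gt0 eps0.
have A0 : (0 < A)%N.
  by rewrite -(ltr_nat R); apply: lt_le_trans A_ge; rewrite exprn_gt0.
set m := (A * size0 #|X| #|Y| #|Z| (inv_eps eps))%N.
have m0 : (0 < m)%N by rewrite muln_gt0 A0 size0_gt0.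
set S := (#|X| * #|Y| * #|Z| * inv_eps eps)%N.
have S0 : (0 < S)%N by rewrite !muln_gt0 X0 Y0 Z0 E0.
set t := time_bound _ _ _ _ _.
have le_t : ((2 * S) ^ K0 <= t)%N.
  rewrite /t /time_bound -/(inv_eps eps) -/S expnMn; apply: leq_mul; first exact: leq_addr.
  by rewrite leq_pexp2l // leq_addl.
(* The program flips no coins, so for given samples either all coin sequences lead to a given
   verdict or none does. *)
have verdictE (s : (6 * m).-tuple (X * Y * Z)) (bs : seq bool) :
  verdict (tester A) (input X Y Z eps) t [seq encode w | w <- s] bs =
  Some (accepts R (of_tuple s)).
  have comp_le i c : (comp c (nth (0, 0, 0)%N [seq encode w | w <- s] i) <= S)%N.
    case: (ltnP i (6 * m)) => hi; last by rewrite nth_default ?size_map ?size_tuple //; case: c => [|[|c]].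
    have w0 : X * Y * Z by exact: tnth s (Ordinal hi).
    rewrite (nth_map w0) ?size_tuple //.
    case: (nth w0 s i) => [[x y] z]; case: c => [|[|c]] /=; apply: leq_trans (ltnW (ltn_ord _)) _;
      apply: dvdn_leq S0 _; rewrite /S.
    - by do 3![apply: dvdn_mulr].
    - by do 2![apply: dvdn_mulr]; exact: dvdn_mull.
    - by apply: dvdn_mulr; exact: dvdn_mull.
  have [|N [M' [arr [e [leN runN v [e0 e1 e2 e4] cells]]]]] :=
    run #|X| #|Y| #|Z| (inv_eps eps) [seq encode w | w <- s] X0 Y0 Z0 E0 _ comp_le.
    by rewrite size_map size_tuple.
  have arrE (c : nat) (b : 'I_6) (i : 'I_m) : (c < 3)%N ->
      arr (3 * (b * m + i) + c)%N = (coord c (of_tuple s (b, i)))%:Z.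
    move=> c3; rewrite cells ?size_map ?size_tuple //; last exact: (flat_index_lt (b, i)).
    have w0 := tnth s (flat_index (b, i)).
    rewrite (nth_map w0) ?size_tuple; last exact: (flat_index_lt (b, i)).
    rewrite ffunE (tnth_nth w0) /=.
    by case: (nth _ _ _) => [[x y] z]; case: c c3 => [|[|[|c]]].
  have acc := den_tDecide_accepts arrE R (And4 e0 e1 e2 e4).
  rewrite /verdict /input (inv_epsE eps0) -(subnK (leq_trans leN le_t)) iterD runN.
  have halt k : iter k step (Config [::] M' [::] bs) = Config [::] M' [::] bs.
    by elim: k => //= k ->.
  by rewrite halt /= v acc.
have PrE (p : {ffun X * Y * Z -> R}) v : Pr_verdict (tester A) eps (6 * m) t p v =
    Ex (fun _ => p) (fun w : {ffun 'I_6 * 'I_m -> X * Y * Z} => (accepts R w == v)%:R).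
  rewrite -(sum_tuples (m := m)) /Pr_verdict; apply: eq_bigr => s _; congr (_ * _).
  case: (boolP (accepts R (of_tuple s) == v)) => [/eqP h|h] /=.
    rewrite (eq_card (B := predT)) => [|bs].
      by rewrite card_tuple card_bool natrX divff // expf_neq0.
    by rewrite !inE verdictE h eqxx.
  rewrite eq_card0 ?mul0r // => bs; rewrite !inE verdictE; apply/negbTE.
  by apply: contra h => /eqP [->].
split=> [s bs|p p_dist]; first by rewrite verdictE.
have [H1 H2 H3 H4] := sample_conditions X0 Y0 Z0 eps0 A_ge.
split=> [[_ ci]|far]; rewrite PrE.
  apply: le_trans (null_accepts p_dist m0 Z0 Y0 leYX ci) _.
  by rewrite le_eqVlt; apply/orP; left; apply/eqP; apply: eq_Ex => w; rewrite eqb_id.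
apply: le_trans (alt_rejects p_dist m0 Z0 Y0 leYX eps0 far H1 H2 H3 H4) _.
by rewrite le_eqVlt; apply/orP; left; apply/eqP; apply: eq_Ex => w; rewrite eqbF_neg.
Qed.

End Tester.

Theorem theorem1p4 (R : realType) :
  exists (P : cmd) (C : R) (K : nat), 0 < C /\
    forall (X Y Z : finType) (eps : R),
      (0 < #|Y|)%N -> (0 < #|Z|)%N -> (#|Y| <= #|X|)%N ->
      0 < eps -> eps <= 1 ->
      exists m : nat,
        m%:R <= C * sample_bound #|X| #|Y| #|Z| eps /\
        is_tester X Y Z P eps m (time_bound K #|X| #|Y| #|Z| eps).
Proof.
(* [A] stays abstract, since the numeral [10 ^ 11] must never be evaluated. *)
have [A A_ge] : exists A : nat, 10 ^+ 11 <= A%:R :> R by exists (10 ^ 11)%N; rewrite natrX.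
have [K hK] := tester_correct A_ge.
have A0 : 0 < A%:R :> R by apply: lt_le_trans A_ge; rewrite exprn_gt0.
(* 48 is 6 blocks times the 8 of [size0_le]. *)
exists (tester A), (48 * A%:R), K; split=> [|X Y Z eps Y0 Z0 leYX eps0 eps1].
  by rewrite mulr_gt0.
exists (6 * (A * size0 #|X| #|Y| #|Z| (inv_eps eps)))%N; split; last exact: hK.
have X0 : (0 < #|X|)%N by exact: leq_trans Y0 leYX.
have h := size0_le X0 Y0 Z0 eps0 eps1.
rewrite !natrM; apply: le_trans (_ : _ <= 6 * (A%:R * (8 * sample_bound #|X| #|Y| #|Z| eps))) _.
  by rewrite ler_pM2l // ler_pM2l.
by rewrite le_eqVlt; apply/orP; left; apply/eqP; ring.
Qed.
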